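(* There exists $c_0\in(0,1)$ with $c_0^2\ge 0.83$ such that for every velocity $c\in[c_0,1]$ the following holds, with $k_0=\pi/2$ and $\alpha=c^2(\pi/2)^2-2$. Let $(\psi_\epsilon)_{\epsilon>0}$ be a family of even functions $\psi_\epsilon\in C^2(\mathbb{R})$ such that, for every $\epsilon>0$, $\psi_\epsilon'(x)=\operatorname{sgn}(x)$ for $|x|\ge\epsilon$ and $|\psi_\epsilon''(x)|\le 2\epsilon^{-1}$ for $|x|<\epsilon$. Let $u_{\mathrm p}\in H^2_{\mathrm{loc}}(\mathbb{R})$ be the odd solution, described in the context, of $c^2u''-\Delta_D u+\alpha u-\alpha\operatorname{sgn}(u)=0$, and let $u_{\mathrm o}\in H^2_{\mathrm{loc}}(\mathbb{R})$ be an odd function such that for each $l=0,1,2$ $$(1+x^2)\frac{\mathrm d^l}{\mathrm dx^l}\bigl(u_{\mathrm o}(x)-\operatorname{sgn}(x)\cos(k_0x)\bigr)\in L^2(\mathbb{R}\setminus[-1,1]).$$ Then for all $\gamma\in\mathbb{R}$ with $|\gamma|$ small enough and all $\rho>0$ small enough there exists $\epsilon_0>0$ such that for every $\epsilon\in(0,\epsilon_0)$ there exist $r\in H^2_{\mathrm{odd}}(\mathbb{R})$ and $\beta\in\mathbb{R}$ with $\|r\|_{H^2(\mathbb{R})}<\rho$ such that $$u:=u_{\mathrm p}+\beta u_{\mathrm o}+\gamma\sin(k_0\,\cdot)-r$$ is a solution on $\mathbb{R}$ of $$c^2u''-\Delta_D u+\alpha u-\alpha\psi_\epsilon'(u)=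0.$$
   Context: Functions are real-valued on $\mathbb{R}$. $\Delta_D u(x):=u(x+1)-2u(x)+u(x-1)$. $H^2_{\mathrm{odd}}(\mathbb{R})$ is the space of odd functions in $H^2(\mathbb{R})$, with norm $\|r\|_{H^2(\mathbb{R})}:=\|(1+k^2)\widehat r\|_{L^2(\mathbb{R})}$, where $\widehat{\ }$ is the unitary Fourier transform (normalisation $1/\sqrt{2\pi}$). Subsonic means $c\le 1$. The sign convention is $\operatorname{sgn}(0)=0$. The function $u_{\mathrm p}$: by a known result (Kreiner and Zimmer), for $c^2\in[0.83,1]$, $k_0=\pi/2$, $\alpha=c^2(\pi/2)^2-2$, the equation $c^2u''-\Delta_D u+\alpha u-\alpha\operatorname{sgn}(u)=0$ has an odd solution $u_{\mathrm p}\in H^2_{\mathrm{loc}}(\mathbb{R})$ of the form $u_{\mathrm p}=u_{\mathrm{pa}}-r_*$, where $$u_{\mathrm{pa}}(x)=\operatorname{sgn}(x)\left[A\left(1-e^{-b|x|}\right)+B\left(1-\cos(k_0x)\right)\right],$$ $$A=\frac{c^2k_0^2-\alpha}{c^2(b^2+k_0^2)},\quad B=\frac{\alpha+b^2c^2}{c^2(b^2+k_0^2)},\quad b^2=\frac{\alpha}{c^2}\cdot\frac{k_0}{2-k_0},\ b>0,$$ and $\sqrt{\pi/2}\,|r_*|\le 0.257$, $\sqrt{\pi/2}\,|r_*'|\le 0.43$ if $c^2\in[0.9,1]$, while $\sqrt{\pi/2}\,|r_*|\le 0.339$, $\sqrt{\pi/2}\,|r_*'|\le 0.34$ if $c^2\in[0.83,0.9]$.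 This solution satisfies $\operatorname{sgn}(u_{\mathrm p}(x))=\operatorname{sgn}(x)$ on $\mathbb{R}$, $u_{\mathrm p}'(0)>0$, $\liminf_{|x|\to\infty}|u_{\mathrm p}(x)|>0$, and $\lim_{x\to\pm\infty}[u_{\mathrm p}(x)\mp1-\lambda\sin(k_0x\pm\theta)]=0$ for some $|\lambda|<1$ and $\theta\in[0,2\pi)$. The existence and these properties of $u_{\mathrm p}$ may be taken as given. *)

(* Defs.v *)
From HB Require Import structures.
From mathcomp Require Import all_boot all_order all_algebra.
From mathcomp Require Import all_classical all_reals all_analysis.
From mathcomp Require Import complex.

Set Implicit Arguments.
Unset Strict Implicit.
Unset Printing Implicit Defensive.

Import Order.TTheory GRing.Theory Num.Theory.
Import numFieldNormedType.Exports.

Local Open Scope ring_scope.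
Local Open Scope classical_set_scope.

Section function_spaces.
Context {R : realType}.
Implicit Types (D K : set R) (f g u r phi : R -> R).

Local Notation mu := (@lebesgue_measure R).

Definition odd_fct f := forall x, f (- x) = - f x.

Definition even_fct f := forall x, f (- x) = f x.

Definition C1 f := (forall x, derivable f x 1) /\ continuous f^`().

Definition C2 f := (forall x, derivable f x 1) /\ C1 f^`().

(* f \_ D is f extended by 0 off D. *)
Definition L2 D f := f \_ D \in Lfun mu 2%:E.

Definition L2loc f := forall K, compact K -> L2 K f.

(* Weak derivative on the open set D, with C^1 test functions whose compact
   support lies in D.  The values of f and g off D are irrelevant. *)
Definition weak_derivative D f g :=
  [/\ locally_integrable D f, locally_integrable D g &
   forall phi, C1 phi ->
     (exists K, [/\ compact K, K `<=` D & forall x, ~ K x -> phi x = 0]) ->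
     \int[mu]_(x in D) (f x * derive1 phi x) =
     - \int[mu]_(x in D) (g x * phi x)].

(* u is in H^2_loc(R), with weak derivatives u1 = u' and u2 = u''.
   Pointwise values of u occur below (oddness, sgn(u), u'(0)), so a class in
   H^2_loc(R) is always given by its continuous representative. *)
Definition H2loc_with u u1 u2 :=
  [/\ continuous u, L2loc u, L2loc u1 /\ L2loc u2,
      weak_derivative setT u u1 & weak_derivative setT u1 u2].

Definition H2loc u := exists u1 u2, H2loc_with u u1 u2.

Local Open Scope complex_scope.

(* (2 pi)^(-1/2) \int_(-N)^N f(x) e^(-ikx) dx *)
Definition truncated_fourier f (N : nat) (k : R) : R[i] :=
  ((\int[mu]_(x in `[- N%:R, N%:R]) (f x * cos (k * x))) / Num.sqrt (2 * pi))
  -i*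
  ((\int[mu]_(x in `[- N%:R, N%:R]) (f x * sin (k * x))) / Num.sqrt (2 * pi)).

(* h is the Fourier-Plancherel transform of f in L^2(R): the limit in L^2 of
   the truncated transforms. *)
Definition is_fourier f (h : R -> R[i]) :=
  [/\ L2 setT (fun k => complex.Re (h k)), L2 setT (fun k => complex.Im (h k)) &
   'N[mu]_2%:E[EFin \o (fun k => Normc.normc (truncated_fourier f N k - h k)%R)]%E
     @[N --> \oo] --> 0%E].

(* A version of the transform, which exists for every f in L^2(R) by
   Plancherel's theorem and is unique up to a null set; it is only used for
   such f. *)
Definition fourier f : R -> R[i] := xget (fun=> 0) [set h | is_fourier f h].

Local Close Scope complex_scope.

Definition H2_weighted_fourier r (k : R) : R :=
  (1 + k ^+ 2) * Normc.normc (fourier r k).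

Definition H2norm r : \bar R :=
  ('N[mu]_2%:E[EFin \o H2_weighted_fourier r])%E.

Definition H2 r :=
  [/\ continuous r, L2 setT r & L2 setT (H2_weighted_fourier r)].

Definition H2odd r := H2 r /\ odd_fct r.

End function_spaces.

Section travelling_waves.
Context {R : realType}.
Implicit Types (c x : R) (u Phi : R -> R).

Local Notation mu := (@lebesgue_measure R).

Definition k0 : R := pi / 2.

Definition alpha c : R := c ^+ 2 * (pi / 2) ^+ 2 - 2.

Definition lapD u x : R := u (x + 1) - 2 * u x + u (x - 1).

(* u in H^2_loc(R) solves c^2 u'' - Delta_D u + alpha u - alpha Phi(u) = 0. *)
Definition solution c Phi u :=
  exists u1 u2, H2loc_with u u1 u2 /\
    {ae mu, forall x, c ^+ 2 * u2 x - lapD u x + alpha c * u x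
                      - alpha c * Phi (u x) = 0}.

Definition regularisation (psi : R -> R -> R) :=
  forall eps : R, 0 < eps ->
    [/\ even_fct (psi eps), C2 (psi eps),
        (forall x, eps <= `|x| -> (psi eps)^`() x = Num.sg x) &
        (forall x, `|x| < eps -> `|(psi eps)^`(2) x| <= 2 * eps^-1)].

(* The radicand is positive for c^2 >= 83/100. *)
Definition bcoef c : R := Num.sqrt (alpha c / c ^+ 2 * (k0 / (2 - k0))).

Definition Acoef c : R :=
  (c ^+ 2 * k0 ^+ 2 - alpha c) / (c ^+ 2 * ((bcoef c) ^+ 2 + k0 ^+ 2)).

Definition Bcoef c : R :=
  (alpha c + (bcoef c) ^+ 2 * c ^+ 2) / (c ^+ 2 * ((bcoef c) ^+ 2 + k0 ^+ 2)).

Definition u_pa c x : R :=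
  Num.sg x * (Acoef c * (1 - expR (- (bcoef c * `|x|)))
              + Bcoef c * (1 - cos (k0 * x))).

Definition r_star c u x : R := u_pa c x - u x.

Definition r_star_bounds c u (m m' : R) :=
  forall x, Num.sqrt (pi / 2) * `|r_star c u x| <= m /\
            Num.sqrt (pi / 2) * `|(r_star c u)^`() x| <= m'.

(* The filter |x| -> oo on R *)
Definition abs_infty : set_system R :=
  filter_from setT (fun M : R => [set x | M < `|x|]).

Definition kreiner_zimmer c u :=
  [/\ odd_fct u,
      solution c Num.sg u,
      (9 / 10 <= c ^+ 2 <= 1 -> r_star_bounds c u (257 / 1000) (43 / 100)) /\
      (83 / 100 <= c ^+ 2 <= 9 / 10 ->
         r_star_bounds c u (339 / 1000) (34 / 100)),
      [/\ (forall x, Num.sg (u x) = Num.sg x),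
          0 < u^`() 0 &
          (0 < limf_einf (fun x => `|u x|%:E) abs_infty)%E] &
      exists lambda theta : R,
        [/\ `|lambda| < 1, 0 <= theta < 2 * pi,
            u x - 1 - lambda * sin (k0 * x + theta) @[x --> +oo] --> 0 &
            u x + 1 - lambda * sin (k0 * x - theta) @[x --> -oo] --> 0]].

Definition odd_oscillation u :=
  [/\ H2loc u, odd_fct u &
   let D := [set x : R | 1 < `|x|] in
   let w0 x := u x - Num.sg x * cos (k0 * x) in
   exists w1 w2 : R -> R,
     [/\ weak_derivative D w0 w1, weak_derivative D w1 w2,
         L2 D (fun x => (1 + x ^+ 2) * w0 x),
         L2 D (fun x => (1 + x ^+ 2) * w1 x) &
         L2 D (fun x => (1 + x ^+ 2) * w2 x)]].

End travelling_waves.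

(* Main.v *)
Require Import Defs.
From mathcomp Require Import all_boot all_order all_algebra.
From mathcomp Require Import all_classical all_reals all_analysis.
From mathcomp Require Import measurable_realfun.
From mathcomp Require Import ring lra.
From mathcomp Require Import complex.
Set Implicit Arguments.
Unset Strict Implicit.
Unset Printing Implicit Defensive.
Import Order.TTheory GRing.Theory Num.Theory.
Import numFieldNormedType.Exports.
Local Open Scope ring_scope.
Local Open Scope classical_set_scope.

(** Write u = u_p + v with v odd. As u_p solves the equation with sgn in place
of psi', the function u solves the regularised equation as soon as L v = alpha
(psi'(u) - sgn), where L v = c^2 v'' - Delta_D v + alpha v. The functions
sin(k0 x) and cos(k0 x) lie in the kernel of L: a shift by 1 is a quarter of
their period and alpha + 2 = c^2 k0^2. So v is sought in the form gamma sin(k0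
x) - p, with L p = alpha (sgn - psi'(u)).

The operator L factors through the harmonic oscillator. Let p be odd and p'' +
k0^2 p = g, with g odd. The sum p(x+1) + p(x-1) does not see the solutions of
the homogeneous equation, and equals K * g for the nonnegative kernel K =
cos(k0 x) / k0 on [-1, 1], so that L p = c^2 g - K * g. The mass of K is 2 /
k0^2, which is below 1, and below c^2 for c close to 1. The equation for g,
namely c^2 g = alpha (sgn - psi'(u)) + K * g, can then be solved by contraction
([regularised_profile_exists]). The factor 1 / eps in the Lipschitz constant of
psi' does no harm. Indeed u_p is bounded below by a function min(C x, m) on the
half line ([linear_lower_bound]) and v is small enough for u to keep such a
bound, so psi'(u) differs from sgn only for |x| <= C eps; and since p gains a
derivative on g and vanishes at 0, a change of g moves p(x) by at most x times
the integral of the change, with x = O(eps) there. The norm of g combines an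
exponential decay with a peak of height 1 / s on an interval of length s^2 at
the origin, s^2 being proportional to eps; its integral stays bounded, the
forcing alpha (sgn - psi'(u)) has size O(s) in it, and the Lipschitz constant
of the forcing is O(s) as well.

The solution p is bounded, but it does not decay: normalised by p(0) = 0 and by
the absence of sin(k0 x) at infinity, it tends to - beta sgn(x) cos(k0 x),
where beta is the integral of sin(k0 y) g(y) over the half line divided by k0
([profile_decay]). This is where u_o enters: r = beta u_o + p is square
integrable, while u = u_p + beta u_o + gamma sin(k0 x) - r is still u_p + gamma
sin(k0 x) - p, whatever u_o is.

It remains to see that r is small in H^2. The function r is odd and integrable,
so its Fourier transform is a sine integral, and (1 + k^2) times this transform
is the sine transform of r - r''. A Bessel inequality for the sine transform
([bessel_sine]), which follows from the Schur test, gives ||r||^2 <= 32 ||r -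
r''||^2, with the H^2 norm on the left and the L^2 norm on the right
([H2norm_second_derivative]); and r - r'' is O(s) in L^2, because beta and g
are O(s) ([correction_H2norm_bound]). *)

(** * Derivatives and comparison of increments *)

Section pointwise_derivatives.
Context {R : realType}.
Implicit Types (f g : R -> R) (x : R).

Lemma is_derive_cvg f x d : is_derive x 1 f d -> {for x, continuous f}.
Proof.
by case=> df _; apply/differentiable_continuous/derivable1_diffP.
Qed.

Lemma is_derive_add f g x a b : is_derive x 1 f a -> is_derive x 1 g b ->
  is_derive x 1 (fun y => f y + g y) (a + b).
Proof. exact: is_deriveD. Qed.

Lemma is_derive_opp f x a : is_derive x 1 f a ->
  is_derive x 1 (fun y => - f y) (- a).
Proof. exact: is_deriveN. Qed.

Lemma is_derive_mul f g x a b : is_derive x 1 f a -> is_derive x 1 g b ->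
  is_derive x 1 (fun y => f y * g y) (a * g x + f x * b).
Proof.
move=> fa gb; apply: (is_derive_eq (is_deriveM fa gb)).
by rewrite /GRing.scale /=; ring.
Qed.

Lemma is_derive_comp f g x a b : is_derive x 1 g b -> is_derive (g x) 1 f a ->
  is_derive x 1 (fun y => f (g y)) (a * b).
Proof. by move=> gb fa; exact: is_derive1_comp. Qed.

Lemma is_derive_const (c x : R) : is_derive x 1 (fun=> c) 0.
Proof. exact: is_derive_cst. Qed.

Lemma is_derive_var x : is_derive x 1 (fun y : R => y) 1.
Proof. exact: is_derive_id. Qed.

Lemma is_derive_exp x : is_derive x 1 (@expR R) (expR x).
Proof. exact: is_derive_expR. Qed.

End pointwise_derivatives.

(** [derive] computes the derivative of an expression by the structural rules
and leaves the comparison with the expected value, usually a matter of [ring]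
or [field]; the derivatives of function variables are taken from the context.
*)
Ltac derive_rules :=
  lazymatch goal with
  | |- is_derive _ _ (fun _ => ?c) _ => apply: is_derive_const
  | |- is_derive _ _ (fun y => y) _ => apply: is_derive_var
  | |- is_derive _ _ (fun y => @?f y + @?g y) _ =>
      eapply (@is_derive_add _ f g); derive_rules
  | |- is_derive _ _ (fun y => - (@?f y)) _ =>
      eapply (@is_derive_opp _ f); derive_rules
  | |- is_derive _ _ (fun y => @?f y * @?g y) _ =>
      eapply (@is_derive_mul _ f g); derive_rules
  | |- is_derive _ _ (fun y => expR (@?g y)) _ =>
      eapply (@is_derive_comp _ (@expR _) g); [derive_rules|exact: is_derive_exp]
  | |- is_derive _ _ (fun y => sin (@?g y)) _ =>
      eapply (@is_derive_comp _ (@sin _) g); [derive_rules|exact: is_derive_sin]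
  | |- is_derive _ _ (fun y => cos (@?g y)) _ =>
      eapply (@is_derive_comp _ (@cos _) g); [derive_rules|exact: is_derive_cos]
  | |- is_derive _ _ (fun y => ?f y) _ => solve [eauto]
  | |- _ => solve [eauto]
  end.

Ltac derive := eapply is_derive_eq; [derive_rules|].

Section comparison.
Context {R : realType}.
Implicit Types (A E a e : R -> R).

Lemma nondecreasing_derive A a (x y : R) : x <= y ->
  (forall z, x <= z <= y -> is_derive z 1 A (a z)) ->
  (forall z, x <= z <= y -> 0 <= a z) -> A x <= A y.
Proof.
move=> xy dA a0.
have [||c] := @MVT_segment R A a x y xy.
- by move=> z /[!in_itv]/= /andP[/ltW xz /ltW zy]; apply: dA; rewrite xz zy.
- apply: derivable_within_continuous => z /[!in_itv]/= xzy.
  by have [] := dA z xzy.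
by rewrite in_itv/= => xcy yx; rewrite -subr_ge0 yx mulr_ge0 ?a0 ?subr_ge0.
Qed.

(** Comparing increments replaces the integral of a bound by an explicit
primitive of the bound, so that the estimates below involve no integral. *)
Lemma le_increment A a E e (x y : R) : x <= y ->
  (forall z, x <= z <= y -> is_derive z 1 A (a z)) ->
  (forall z, x <= z <= y -> is_derive z 1 E (e z)) ->
  (forall z, x <= z <= y -> `|a z| <= e z) -> `|A y - A x| <= E y - E x.
Proof.
move=> xy dA dE ae; rewrite ler_norml; apply/andP; split.
- have : E x + A x <= E y + A y.
    apply: (@nondecreasing_derive (fun z => E z + A z) (fun z => e z + a z)) => // z xzy.
      by apply: is_derive_add; [exact: dE|exact: dA].
    by have := ae z xzy; rewrite ler_norml => /andP[]; lra.
  by lra.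
- have : E x - A x <= E y - A y.
    apply: (@nondecreasing_derive (fun z => E z - A z) (fun z => e z - a z)) => // z xzy.
      by apply: is_derive_add; [exact: dE|apply: is_derive_opp; exact: dA].
    by have := ae z xzy; rewrite ler_norml => /andP[]; lra.
  by lra.
Qed.

End comparison.

Section antiderivative.
Context {R : realType}.
Local Notation mu := (@lebesgue_measure R).
Implicit Types f : R -> R.

(** The integral starts at -1 so that the fundamental theorem of calculus gives
a two-sided derivative at the origin too. *)
Definition antiderivative f (x : R) : R :=
  (\int[mu]_(t in `[-1, x]) f t) - (\int[mu]_(t in `[-1, 0]) f t).

Lemma antiderivative0 f : antiderivative f 0 = 0.
Proof. exact: subrr. Qed.

Lemma continuous_integrable_itv f (a b : R) : continuous f ->
  mu.-integrable `[a, b] (EFin \o f).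
Proof.
move=> cf; apply: continuous_compact_integrable; first exact: segment_compact.
exact: continuous_subspaceT.
Qed.

Lemma is_derive_antiderivative f (x : R) : continuous f -> 0 <= x ->
  is_derive x 1 (antiderivative f) (f x).
Proof.
move=> cf x0; rewrite -[f x]addr0.
apply: (@is_derive_add R (fun y => \int[mu]_(t in `[-1, y]) f t)
  (fun=> - (\int[mu]_(t in `[-1, 0]) f t))%R).

have [] := @continuous_FTC1_closed R f (-1) x (x + 1).
- by rewrite ltrDl.
- exact: continuous_integrable_itv.
- by rewrite (lt_le_trans _ x0).
- exact: cf.
by move=> df E; apply: DeriveDef; [exact: df|rewrite -derive1E; exact: E].
Qed.

End antiderivative.

Section constants.
Context {R : realType}.
Local Notation k0 := (@k0 R).

Lemma continuous_sin_scaled (k : R) : continuous (fun x => sin (k * x)).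
Proof. by move=> x; apply: continuous_comp; [exact: mulrl_continuous|exact: continuous_sin]. Qed.

Lemma continuous_cos_scaled (k : R) : continuous (fun x => cos (k * x)).
Proof. by move=> x; apply: continuous_comp; [exact: mulrl_continuous|exact: continuous_cos]. Qed.

Lemma norm_sin_le (x : R) : 0 <= x -> `|sin x| <= x.
Proof.
move=> x0; have := @le_increment R sin cos id (cst 1) 0 x x0.
rewrite sin0 !subr0; apply.
by move=> z _; exact: cos_max.
Qed.

Lemma cos_ge (x : R) : 0 <= x -> 1 - x ^+ 2 / 2 <= cos x.
Proof.
move=> x0.
have -> : cos x = 1 - sin (x / 2) ^+ 2 *+ 2.
  have -> : cos x = cos ((x / 2) *+ 2) by congr cos; lra.
  by rewrite cos_mulr2n cos2sin2; lra.
have := @norm_sin_le (x / 2); rewrite divr_ge0// => /(_ isT) h.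
have : sin (x / 2) ^+ 2 <= (x / 2) ^+ 2.
  by rewrite -[leLHS]real_normK ?num_real// ler_sqr ?nnegrE ?divr_ge0.
by lra.
Qed.

(** If k0 were below 3/2, the bound 1 - x^2/2 <= cos x at x = k0 / 2 would make
cos k0 positive by the double angle formula. *)
Lemma k0_ge : 3 / 2 <= k0.
Proof.
rewrite leNgt; apply/negP => k3.
have k1 : 1 <= k0 by exact: pihalf_ge1.
have : cos (k0 : R) = 0 by exact: cos_pihalf.
have -> : cos k0 = cos ((k0 / 2) *+ 2) by congr cos; lra.
rewrite cos_mulr2n.
have c1 : 1 - (k0 / 2) ^+ 2 / 2 <= cos (k0 / 2) by apply: cos_ge; lra.
(* 71/100 exceeds the square root of 1/2. *)
have c2 : 71 / 100 <= cos (k0 / 2) by apply: le_trans c1; nra.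
have : (71 / 100) ^+ 2 <= cos (k0 / 2) ^+ 2 by rewrite ler_sqr// nnegrE; lra.
by lra.
Qed.

Lemma k0_lt2 : k0 < 2.
Proof. exact: pihalf_lt2. Qed.

End constants.

(** * The weight and its tail *)

Section weights.
Context {R : realType}.
Implicit Types (s x : R).

(** The first term is the exponential decay of the profile, at a rate slow
enough not to spoil the contraction. The second one is at least 1 / s on [0,
s^2], the region where psi'(u) differs from the sign, but its integral is only
of order s. *)
Definition weight s x := expR (- (x / 20)) + s^-1 * expR (1 - x / s ^+ 2).

(** The integral of the weight over [x, +oo[. *)
Definition tail s x := 20 * expR (- (x / 20)) + s * expR (1 - x / s ^+ 2).

Lemma weight_gt0 s x : 0 < s -> 0 < weight s x.
Proof. by move=> s0; rewrite addr_gt0 ?mulr_gt0 ?expR_gt0 ?invr_gt0. Qed.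

Lemma tail_gt0 s x : 0 < s -> 0 < tail s x.
Proof. by move=> s0; rewrite addr_gt0 ?mulr_gt0 ?expR_gt0 ?ltr0n. Qed.

Lemma is_derive_tail s x : 0 < s -> is_derive x 1 (tail s) (- weight s x).
Proof.
move=> s0; rewrite /tail /weight; derive.
have : s != 0 by rewrite gt_eqF.
by move=> s1; field.
Qed.

Lemma cvg_tail s : 0 < s -> tail s x @[x --> +oo] --> 0.
Proof.
move=> s0.
have E (d : R) : 0 < d -> expR (- (x / d)) @[x --> +oo] --> 0.
  move=> d0; apply: (@cvg_comp _ _ _ (fun x => x / d) (fun x => expR (- x))); last first.
    exact: cvgr_expR.
  apply: gt0_cvgMly; first by rewrite invr_gt0.
  exact: cvg_id.
suff : tail s x @[x --> +oo] --> 20 * 0 + (s * expR 1) * 0 by rewrite !mulr0 addr0.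
apply: cvgD; first by apply: cvgMl_tmp; exact: E.
under eq_fun do rewrite expRD mulrA.
by apply: cvgMl_tmp; apply: E; rewrite exprn_gt0.
Qed.

Lemma tail0_le s : 0 < s <= 1 -> tail s 0 <= 20 + expR 1.
Proof.
move=> /andP[s0 s1]; rewrite /tail !mul0r oppr0 expR0 addr0 mulr1 lerD2l.
by rewrite -[leRHS]mul1r ler_wpM2r ?expR_ge0.
Qed.

Lemma weight_ge s x : 0 < s -> expR (- (x / 20)) <= weight s x.
Proof. by move=> s0; rewrite lerDl mulr_ge0 ?expR_ge0 ?invr_ge0 ?ltW. Qed.

Lemma weight_ge_near0 s x : 0 < s -> x <= s ^+ 2 -> s^-1 <= weight s x.
Proof.
move=> s0 xs; apply: (@le_trans _ _ (s^-1 * expR (1 - x / s ^+ 2))).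
  rewrite -{1}[s^-1]mulr1 ler_pM2l ?invr_gt0// -{1}expR0 ler_expR subr_ge0.
  by rewrite ler_pdivrMr ?exprn_gt0// mul1r.
by rewrite lerDr expR_ge0.
Qed.

Lemma weight_le_max s x : 0 < s -> 0 <= x -> weight s x <= weight s 0.
Proof.
move=> s0 x0; rewrite lerD//; first by rewrite ler_expR mul0r lerN2 divr_ge0.
rewrite ler_pM2l ?invr_gt0// ler_expR lerB// mul0r divr_ge0//.
by rewrite exprn_ge0 ?ltW.
Qed.

End weights.

Section primitives_with_limits.
Context {R : realType}.
Implicit Types (M s x y : R) (A a : R -> R).

Section dominated_primitive.
Variables (M s : R) (A a : R -> R).
Hypotheses (s0 : 0 < s)
  (dA : forall x, 0 <= x -> is_derive x 1 A (a x))
  (aM : forall x, 0 <= x -> `|a x| <= M * weight s x).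

Lemma primitive_increment x y : 0 <= x <= y ->
  `|A y - A x| <= M * (tail s x - tail s y).
Proof.
move=> /andP[x0 xy].
have -> : M * (tail s x - tail s y) = - (M * tail s y) - - (M * tail s x) by ring.
apply: (@le_increment _ A a (fun x => - (M * tail s x)) (fun x => M * weight s x)) => //.
- by move=> z /andP[xz _]; apply: dA; exact: le_trans xz.
- move=> z _; have dt := is_derive_tail z s0; derive.
  by ring.
- by move=> z /andP[xz _]; apply: aM; exact: le_trans xz.
Qed.

Lemma dominated_primitive_cvg : cvg (A x @[x --> +oo]).
Proof.
have M0 : 0 <= M.
  have := le_trans (normr_ge0 _) (aM (lexx 0)).
  by rewrite pmulr_lge0// weight_gt0.
apply: cauchy_cvg; apply: cauchy_exP => e e0.
have [N [Nr NT]] : \forall x \near +oo, tail s x < e / (M + 1).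
  apply: (@cvgr_lt _ _ _ _ _ 0); first exact: cvg_tail.
  by rewrite divr_gt0// ltr_wpDl.
pose y := Num.max 0 N + 1.
have yN : N < y by rewrite /y (@le_lt_trans _ _ (Num.max 0 N)) ?ltrDl// le_max lexx orbT.
have y0 : 0 <= y by rewrite /y addr_ge0// le_max lexx.
exists (A y); exists y; split; first exact: num_real.
move=> x /= yx; rewrite /ball/= distrC.
apply: le_lt_trans (@primitive_increment y x _) _; first by rewrite y0 ltW.
apply: (@le_lt_trans _ _ ((M + 1) * tail s y)).
  have := tail_gt0 x s0; have := tail_gt0 y s0; nra.
by rewrite mulrC -ltr_pdivlMr ?ltr_wpDl//; exact: NT.
Qed.

Lemma primitive_limit l x : A x @[x --> +oo] --> l -> 0 <= x ->
  `|A x - l| <= M * tail s x.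
Proof.
move=> Al x0.
have h : M * (tail s x - tail s y) - `|A x - A y| @[y --> +oo] -->
    M * (tail s x - 0) - `|A x - l|.
  apply: cvgB; last by apply: cvg_norm; apply: cvgB => //; exact: cvg_cst.
  by apply: cvgMl_tmp; apply: cvgB; [exact: cvg_cst|exact: cvg_tail].
rewrite -subr_ge0 -[tail s x]subr0 -(cvg_lim _ h)//.
apply: limr_ge; first by apply/cvg_ex; eexists; exact: h.
exists x; split; first exact: num_real.
by move=> y xy; rewrite subr_ge0 distrC primitive_increment// x0 ltW.
Qed.

End dominated_primitive.

End primitives_with_limits.

(** * The forced oscillator on the half line *)

Section oscillator.
Context {R : realType}.
Local Notation k0 := (@k0 R).
Implicit Types (M N s x y lC lS : R) (G AC AS : R -> R).

Lemma k0_gt0 : 0 < k0.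
Proof. by rewrite (lt_le_trans _ k0_ge)// divr_gt0. Qed.

Lemma cos_k0D1 x : cos (k0 * (x + 1)) = - sin (k0 * x).
Proof. by rewrite mulrDr mulr1 cosDpihalf. Qed.

Lemma sin_k0D1 x : sin (k0 * (x + 1)) = cos (k0 * x).
Proof. by rewrite mulrDr mulr1 sinDpihalf. Qed.

Lemma cos_k0B1 x : cos (k0 * (x - 1)) = sin (k0 * x).
Proof. by rewrite mulrBr mulr1 cosBpihalf. Qed.

Lemma sin_k0B1 x : sin (k0 * (x - 1)) = - cos (k0 * x).
Proof. by rewrite mulrBr mulr1 sinBpihalf. Qed.

Lemma cos_k0C x : cos (k0 * (1 - x)) = sin (k0 * x).
Proof. by rewrite mulrBr mulr1 cosB cos_pihalf sin_pihalf mul0r add0r mul1r. Qed.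

Lemma sin_k0C x : sin (k0 * (1 - x)) = cos (k0 * x).
Proof. by rewrite mulrBr mulr1 sinB cos_pihalf sin_pihalf mul0r subr0 mul1r. Qed.

Lemma cos_k0_ge0 x : -1 <= x <= 1 -> 0 <= cos (k0 * x).
Proof.
move=> /andP[x1 x2]; apply: cos_ge0_pihalf.
have k := k0_gt0; rewrite -/k0.
by apply/andP; split; nra.
Qed.

(** [AC] and [AS] are the integrals of cos(k0 y) G(y) and sin(k0 y) G(y) over
[0, x], and [lC], [lS] the integrals over the half line. They are the data in
the variation of constants formula for p'' + k0^2 p = G. *)
Definition primitives M s G AC AS lC lS :=
  [/\ AC 0 = 0 /\ AS 0 = 0,
      forall x, 0 <= x -> `|G x| <= M * weight s x,
      forall x, 0 <= x -> is_derive x 1 AC (cos (k0 * x) * G x),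
      forall x, 0 <= x -> is_derive x 1 AS (sin (k0 * x) * G x) &
      AC x @[x --> +oo] --> lC /\ AS x @[x --> +oo] --> lS].

Lemma norm_cosM (z w : R) : `|cos z * w| <= `|w|.
Proof. by rewrite normrM ler_piMl// cos_max. Qed.

Lemma norm_sinM (z w : R) : `|sin z * w| <= `|w|.
Proof. by rewrite normrM ler_piMl// sin_max. Qed.

Definition cos_primitive G := antiderivative (fun x => cos (k0 * x) * G x).
Definition sin_primitive G := antiderivative (fun x => sin (k0 * x) * G x).

Lemma primitivesP M s G : 0 < s -> continuous G ->
  (forall x, 0 <= x -> `|G x| <= M * weight s x) ->
  primitives M s G (cos_primitive G) (sin_primitive G)
    (lim (cos_primitive G x @[x --> +oo])) (lim (sin_primitive G x @[x --> +oo])).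
Proof.
move=> s0 cG GM.
have dC x : 0 <= x -> is_derive x 1 (cos_primitive G) (cos (k0 * x) * G x).
  apply: (@is_derive_antiderivative _ (fun x => cos (k0 * x) * G x)) => y.
  by apply: cvgM; [exact: continuous_cos_scaled|exact: cG].
have dS x : 0 <= x -> is_derive x 1 (sin_primitive G) (sin (k0 * x) * G x).
  apply: (@is_derive_antiderivative _ (fun x => sin (k0 * x) * G x)) => y.
  by apply: cvgM; [exact: continuous_sin_scaled|exact: cG].
split => //.
- by rewrite /cos_primitive /sin_primitive !antiderivative0.
- split.
  + apply: (@dominated_primitive_cvg _ M _ _ _ s0 dC) => x x0.
    by rewrite (le_trans (norm_cosM _ _))// GM.
  + apply: (@dominated_primitive_cvg _ M _ _ _ s0 dS) => x x0.
    by rewrite (le_trans (norm_sinM _ _))// GM.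
Qed.

Lemma primitivesB M1 M2 N s G1 AC1 AS1 lC1 lS1 G2 AC2 AS2 lC2 lS2 :
  primitives M1 s G1 AC1 AS1 lC1 lS1 -> primitives M2 s G2 AC2 AS2 lC2 lS2 ->
  (forall x, 0 <= x -> `|G1 x - G2 x| <= N * weight s x) ->
  primitives N s (fun x => G1 x - G2 x) (fun x => AC1 x - AC2 x)
    (fun x => AS1 x - AS2 x) (lC1 - lC2) (lS1 - lS2).
Proof.
move=> [[C10 S10] _ dC1 dS1 [lC1P lS1P]] [[C20 S20] _ dC2 dS2 [lC2P lS2P]] GN.
split => //.
- by rewrite C10 C20 S10 S20 !subrr.
- move=> x x0; have d1 := dC1 x x0; have d2 := dC2 x x0; derive; ring.
- move=> x x0; have d1 := dS1 x x0; have d2 := dS2 x x0; derive; ring.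
- by split; apply: cvgB.
Qed.

(** The solution of P'' + k0^2 P = G with P(0) = 0 whose sin(k0 x) component
tends to 0 at infinity. *)
Definition profile AC AS lC x :=
  (sin (k0 * x) * (AC x - lC) - cos (k0 * x) * AS x) / k0.

Definition profile1 AC AS lC x := cos (k0 * x) * (AC x - lC) + sin (k0 * x) * AS x.

Definition odd_extension (f : R -> R) x := Num.sg x * f `|x|.

Definition shift_sum (f : R -> R) x := odd_extension f (x + 1) + odd_extension f (x - 1).

Lemma profileB AC1 AS1 lC1 AC2 AS2 lC2 x :
  profile (fun x => AC1 x - AC2 x) (fun x => AS1 x - AS2 x) (lC1 - lC2) x =
  profile AC1 AS1 lC1 x - profile AC2 AS2 lC2 x.
Proof. by rewrite /profile; ring. Qed.

Section bounds.
Variables (M s : R) (G AC AS : R -> R) (lC lS : R).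
Hypotheses (s01 : 0 < s <= 1) (prim : primitives M s G AC AS lC lS).

Local Notation P := (profile AC AS lC).
Local Notation P1 := (profile1 AC AS lC).

Let s0 : 0 < s. Proof. by case/andP: s01. Qed.

Let C0 : AC 0 = 0. Proof. by case: prim => -[]. Qed.
Let S0 : AS 0 = 0. Proof. by case: prim => -[]. Qed.
Let dC x : 0 <= x -> is_derive x 1 AC (cos (k0 * x) * G x).
Proof. by case: prim => _ _ + _ _; apply. Qed.
Let dS x : 0 <= x -> is_derive x 1 AS (sin (k0 * x) * G x).
Proof. by case: prim => _ _ _ + _; apply. Qed.
Let GM x : 0 <= x -> `|G x| <= M * weight s x.
Proof. by case: prim => _ + _ _ _; apply. Qed.

Let cosGM x : 0 <= x -> `|cos (k0 * x) * G x| <= M * weight s x.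
Proof. by move=> x0; rewrite (le_trans (norm_cosM _ _))// GM. Qed.
Let sinGM x : 0 <= x -> `|sin (k0 * x) * G x| <= M * weight s x.
Proof. by move=> x0; rewrite (le_trans (norm_sinM _ _))// GM. Qed.

Lemma primitives_ge0 : 0 <= M.
Proof.
have := le_trans (normr_ge0 _) (GM (lexx 0)).
by rewrite pmulr_lge0// weight_gt0.
Qed.

Lemma cos_primitive_limit x : 0 <= x -> `|AC x - lC| <= M * tail s x.
Proof.
by case: prim => _ _ _ _ [+ _]; exact: (primitive_limit s0 dC cosGM).
Qed.

Lemma sin_primitive_limit x : 0 <= x -> `|AS x - lS| <= M * tail s x.
Proof.
by case: prim => _ _ _ _ [_ +]; exact: (primitive_limit s0 dS sinGM).
Qed.

Lemma sin_primitive_bound x : 0 <= x -> `|AS x| <= M * (tail s 0 - tail s x).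
Proof.
move=> x0; have := @primitive_increment _ M _ _ _ s0 dS sinGM 0 x.
by rewrite S0 subr0 lexx x0; exact.
Qed.

Lemma sin_limit_bound : `|lS| <= M * tail s 0.
Proof. by have := sin_primitive_limit (lexx 0); rewrite S0 sub0r normrN. Qed.

Lemma profile0 : P 0 = 0.
Proof. by rewrite /profile S0 mulr0 sin0 mul0r mulr0 subr0 mul0r. Qed.

Lemma is_derive_profile x : 0 <= x -> is_derive x 1 P (P1 x).
Proof.
move=> x0; have d1 := dC x0; have d2 := dS x0; rewrite /profile.
have k := k0_gt0; derive; rewrite /profile1.
by field; rewrite gt_eqF.
Qed.

Lemma is_derive_profile1 x : 0 <= x ->
  is_derive x 1 P1 (G x - k0 ^+ 2 * P x).
Proof.
move=> x0; have d1 := dC x0; have d2 := dS x0; rewrite /profile1 /profile.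
have k := k0_gt0; derive.
rewrite -[in RHS](mul1r (G x)) -[in RHS](cos2Dsin2 (k0 * x)).
by field; rewrite gt_eqF.
Qed.

Let amplitude_bound (u v x w1 w2 : R) : 0 <= x -> `|w1| <= 1 -> `|w2| <= 1 ->
  `|u| <= M * tail s x -> `|v| <= M * (tail s 0 - tail s x) ->
  `|w1 * u + w2 * v| <= M * tail s 0.
Proof.
move=> x0 w11 w21 uM vM; apply: le_trans (ler_normD _ _) _; rewrite !normrM.
have : `|w1| * `|u| <= `|u| by rewrite ler_piMl.
have : `|w2| * `|v| <= `|v| by rewrite ler_piMl.
by lra.
Qed.

Lemma profile_bound x : 0 <= x -> `|P x| <= M * tail s 0.
Proof.
move=> x0; rewrite /profile normrM normfV (gtr0_norm k0_gt0) ler_pdivrMr ?k0_gt0//.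
apply: (@le_trans _ _ (M * tail s 0)); last first.
  rewrite ler_peMr//; last by have := @k0_ge R; lra.
  by rewrite mulr_ge0 ?primitives_ge0// ltW// tail_gt0.
rewrite -mulNr; apply: (@amplitude_bound _ _ x) => //.
- exact: sin_max.
- by rewrite normrN cos_max.
- exact: cos_primitive_limit.
- exact: sin_primitive_bound.
Qed.

Lemma profile1_bound x : 0 <= x -> `|P1 x| <= M * tail s 0.
Proof.
move=> x0; apply: (@amplitude_bound _ _ x) => //.
- exact: cos_max.
- exact: sin_max.
- exact: cos_primitive_limit.
- exact: sin_primitive_bound.
Qed.

(** The derivative of P is bounded and P(0) = 0. Near the origin this is the
gain that absorbs the factor 1 / eps in the Lipschitz constant of the
regularised sign. *)
Lemma profile_linear_bound x : 0 <= x -> `|P x| <= M * tail s 0 * x.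
Proof.
move=> x0.
have := @le_increment _ P P1 (fun y => M * tail s 0 * y) (fun=> M * tail s 0) 0 x x0.
rewrite profile0 subr0 mulr0 subr0; apply.
- by move=> z /andP[z0 _]; exact: is_derive_profile.
- by move=> z _; derive; ring.
- by move=> z /andP[z0 _]; exact: profile1_bound.
Qed.

(** The limit profile has lost its sin(k0 x) component, so only a multiple of
cos(k0 x), fixed by P(0) = 0, survives at infinity. *)
Lemma profile_decay x : 0 <= x ->
  `|P x + lS / k0 * cos (k0 * x)| <= 2 * M * tail s x.
Proof.
move=> x0.
have k := k0_gt0.
have -> : P x + lS / k0 * cos (k0 * x) =
    (sin (k0 * x) * (AC x - lC) - cos (k0 * x) * (AS x - lS)) / k0.
  by rewrite /profile; field; rewrite gt_eqF.
have T0 : 0 <= M * tail s x.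
  by rewrite mulr_ge0 ?primitives_ge0// ltW// tail_gt0.
rewrite normrM normfV (gtr0_norm k) ler_pdivrMr//.
apply: (@le_trans _ _ (2 * M * tail s x)); last first.
  rewrite ler_peMr//; last by have := @k0_ge R; lra.
  by rewrite -mulrA mulr_ge0.
apply: le_trans (ler_normB _ _) _.
have := norm_sinM (k0 * x) (AC x - lC); have := norm_cosM (k0 * x) (AS x - lS).
have := cos_primitive_limit x0; have := sin_primitive_limit x0.
by lra.
Qed.

(** A piece of the integral of cos(k0 (x + w t)) G(t), w = 1 or -1, over a
window where the cosine is nonnegative. In the exponential part of the weight
the cosine is kept, since its exact integral decides the contraction; in the
peak the cosine is bounded by 1. *)
Let window_bound (w : R) (Q : R -> R) (u x y z : R) : 0 <= y <= z -> w ^+ 2 = 1 ->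
  (forall t, y <= t <= z -> -1 <= x + w * t <= 1) ->
  (forall t, y <= t <= z -> is_derive t 1 Q (cos (k0 * (x + w * t)) * G t)) ->
  (forall t, y <= t <= z -> expR (- (t / 20)) <= u) ->
  `|Q z - Q y| <= M * (u * w * (sin (k0 * (x + w * z)) - sin (k0 * (x + w * y))) / k0
    + s * (expR (1 - y / s ^+ 2) - expR (1 - z / s ^+ 2))).
Proof.
move=> /andP[y0 yz] w1 xw dQ eu.
have k := k0_gt0.
pose E t := M * (u * w * sin (k0 * (x + w * t)) / k0 - s * expR (1 - t / s ^+ 2)).
have -> : M * (u * w * (sin (k0 * (x + w * z)) - sin (k0 * (x + w * y))) / k0
    + s * (expR (1 - y / s ^+ 2) - expR (1 - z / s ^+ 2))) = E z - E y.
  by rewrite /E; ring.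
pose e t := M * (cos (k0 * (x + w * t)) * u + s^-1 * expR (1 - t / s ^+ 2)).
apply: (@le_increment _ Q _ E e _ _ yz dQ) => t tyz.
- rewrite /E /e; derive.
  have -> : cos (k0 * (x + w * t)) * u = w ^+ 2 * cos (k0 * (x + w * t)) * u.
    by rewrite w1 mul1r.
  by field; rewrite !gt_eqF.
- have t0 : 0 <= t by case/andP: tyz => yt _; exact: le_trans yt.
  rewrite normrM (ger0_norm (cos_k0_ge0 (xw t tyz))) /e.
  have M0 := primitives_ge0.
  have c0 := cos_k0_ge0 (xw t tyz); have c1 := cos_le1 (k0 * (x + w * t)).
  apply: (@le_trans _ _ (cos (k0 * (x + w * t)) * (M * weight s t))).
    by rewrite ler_wpM2l ?GM.
  rewrite mulrCA ler_wpM2l// /weight mulrDr lerD//.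
    by rewrite ler_wpM2l// eu.
  by rewrite ler_piMl// mulr_ge0 ?expR_ge0// invr_ge0 ltW.
Qed.

(** The sum of the two shifts is (1 / k0) times the integral of cos(k0 (x - y))
G(y) over [x - 1, x + 1], with G extended as an odd function; for x < 1 the
part of the window on the negative half line is folded back. Apart from the
terms in s and the factor exp(1/20), lost because the decay is evaluated at the
left end of the window, the constant is the mass 2 / k0^2 of the kernel. *)
Lemma shift_sum_bound x : 0 <= x ->
  `|shift_sum P x| <=
  M * (2 / k0 * expR (1 / 20) * (1 / k0 + s * expR 1)) * expR (- (x / 20)).
Proof.
move=> x0.
have k := k0_gt0; have [s2 s3] := andP s01; have M0 := primitives_ge0.
have inv_s : 1 <= s^-1 ^+ 2 by rewrite exprn_ege1// invf_ge1.
have split_exp : expR (1 / 20) * expR (- (x / 20)) = expR (- ((x - 1) / 20)).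
  by rewrite -expRD; congr expR; lra.
set u := expR (- ((x - 1) / 20)).
have u0 : 0 <= u by exact: expR_ge0.
have rhsE : M * (2 / k0 * expR (1 / 20) * (1 / k0 + s * expR 1)) * expR (- (x / 20)) =
    M * (2 / k0 + 2 * s * expR 1) * u / k0.
  by rewrite /u -split_exp; field; rewrite gt_eqF.
rewrite rhsE.
have e0 (t : R) : 0 <= t -> (x - 1 <= t) -> s * expR (1 - t / s ^+ 2) <= s * expR 1 * u.
  move=> t0 xt; rewrite -mulrA ler_pM2l// -expRD ler_expR lerD2l lerN2.
  apply: (@le_trans _ _ (t / 20)); first by rewrite ler_pM2r// invr_gt0.
  by rewrite -exprVn ler_wpM2l//; lra.
have eu (t : R) : x - 1 <= t -> expR (- (t / 20)) <= u.
  by move=> xt; rewrite ler_expR lerN2 ler_pM2r// invr_gt0.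
have tpos (t : R) : 0 <= s * expR (1 - t / s ^+ 2) by rewrite mulr_ge0 ?expR_ge0 ?ltW.
have x10 : 0 < x + 1 by rewrite ltr_wpDl.
rewrite /shift_sum /odd_extension (gtr0_sg x10) mul1r (gtr0_norm x10).
have sinN1 : sin (k0 * -1) = -1 by rewrite mulrN1 sinN sin_pihalf.
have sin1 : sin (k0 * 1) = 1 by rewrite mulr1 sin_pihalf.
pose Q (w t : R) := cos (k0 * x) * AC t - w * sin (k0 * x) * AS t.
have dQ (w t : R) : w = 1 \/ w = -1 -> 0 <= t ->
    is_derive t 1 (Q w) (cos (k0 * (x + w * t)) * G t).
  move=> w1 t0; have d1 := dC t0; have d2 := dS t0; rewrite /Q; derive.
  by case: w1 => ->; rewrite !(mulrDr, mul1r, mulN1r, mulrN) cosD ?cosN ?sinN; ring.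
have Q0 (w : R) : Q w 0 = 0 by rewrite /Q C0 S0 !mulr0 subr0.
pose bound w y z := M * (u * w * (sin (k0 * (x + w * z)) - sin (k0 * (x + w * y))) / k0
    + s * (expR (1 - y / s ^+ 2) - expR (1 - z / s ^+ 2))).
have Pnext : P (x + 1) = (Q (-1) (x + 1) - cos (k0 * x) * lC) / k0.
  by rewrite /profile cos_k0D1 sin_k0D1 /Q; ring.
have [x1|x1] := leP 1 x.
- have -> : Num.sg (x - 1) * P `|x - 1| = P (x - 1).
    rewrite [`|x - 1|]ger0_norm ?subr_ge0//.
    have [->|xn1] := eqVneq x 1; first by rewrite subrr profile0 mulr0.
    by rewrite gtr0_sg ?mul1r// subr_gt0 lt_neqAle eq_sym xn1.
  have -> : P (x + 1) + P (x - 1) = (Q (-1) (x + 1) - Q (-1) (x - 1)) / k0.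
    by rewrite Pnext /profile cos_k0B1 sin_k0B1 /Q; ring.
  rewrite normrM normfV (gtr0_norm k) ler_pM2r ?invr_gt0//.
  have h : `|Q (-1) (x + 1) - Q (-1) (x - 1)| <= bound (-1) (x - 1) (x + 1).
    apply: (@window_bound (-1) _ u x (x - 1) (x + 1)).
    + by apply/andP; lra.
    + by rewrite sqrrN expr1n.
    + by move=> t /andP[]; lra.
    + by move=> t /andP[t1 _]; apply: dQ; [right|lra].
    + by move=> t /andP[t1 _]; exact: eu.
  apply: le_trans h _; rewrite /bound -[leRHS]mulrA ler_wpM2l//.
  have -> : x + -1 * (x + 1) = -1 by ring.
  have -> : x + -1 * (x - 1) = 1 by ring.
  rewrite sinN1 sin1.
  have := e0 (x - 1); rewrite subr_ge0 x1 lexx => /(_ isT isT).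
  have := tpos (x + 1).
  have : 0 <= s * expR 1 * u by rewrite !mulr_ge0 ?expR_ge0 ?ltW.
  have -> : u * -1 * (-1 - 1) / k0 = 2 / k0 * u by ring.
  by lra.
- have -> : Num.sg (x - 1) * P `|x - 1| = - P (1 - x).
    by rewrite ltr0_sg ?subr_lt0// mulN1r distrC ger0_norm// subr_ge0 ltW.
  have -> : P (x + 1) - P (1 - x) = (Q (-1) (x + 1) - Q 1 (1 - x)) / k0.
    have -> : P (1 - x) = (Q 1 (1 - x) - cos (k0 * x) * lC) / k0.
      by rewrite /profile cos_k0C sin_k0C /Q; ring.
    by rewrite Pnext; ring.
  rewrite normrM normfV (gtr0_norm k) ler_pM2r ?invr_gt0//.
  have h1 : `|Q (-1) (x + 1) - Q (-1) 0| <= bound (-1) 0 (x + 1).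
    apply: (@window_bound (-1) _ u x 0 (x + 1)).
    + by apply/andP; lra.
    + by rewrite sqrrN expr1n.
    + by move=> t /andP[]; lra.
    + by move=> t /andP[t1 _]; apply: dQ; [right|lra].
    + by move=> t /andP[t1 _]; apply: eu; lra.
  have h2 : `|Q 1 (1 - x) - Q 1 0| <= bound 1 0 (1 - x).
    apply: (@window_bound 1 _ u x 0 (1 - x)).
    + by apply/andP; lra.
    + by rewrite expr1n.
    + by move=> t /andP[]; lra.
    + by move=> t /andP[t1 _]; apply: dQ; [left|lra].
    + by move=> t /andP[t1 _]; apply: eu; lra.
  rewrite Q0 subr0 in h1; rewrite Q0 subr0 in h2.
  apply: le_trans (ler_normB _ _) _; apply: le_trans (lerD h1 h2) _.
  rewrite /bound -mulrDr -[leRHS]mulrA ler_wpM2l//.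
  have -> : x + -1 * (x + 1) = -1 by ring.
  have -> : x + 1 * (1 - x) = 1 by ring.
  rewrite !mulr0 addr0 sinN1 sin1.
  have := e0 0; rewrite lexx subr_le0 (ltW x1) => /(_ isT isT).
  have := tpos (x + 1); have := tpos (1 - x).
  have -> : u * -1 * (-1 - sin (k0 * x)) / k0 = u / k0 + u * sin (k0 * x) / k0 by ring.
  have -> : u * 1 * (1 - sin (k0 * x)) / k0 = u / k0 - u * sin (k0 * x) / k0 by ring.
  have -> : (2 / k0 + 2 * s * expR 1) * u = 2 * (u / k0) + 2 * (s * expR 1 * u) by ring.
  by lra.
Qed.

End bounds.
End oscillator.

(** * Contractions in a weighted norm *)

Section weighted_contraction.
Context {R : realType}.
Implicit Types (W G : R -> R) (q D e : R).

(** Banach's fixed point theorem in the norm sup |G| / W, on a set closed in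
this norm and of finite diameter. The limit of the iterates is built pointwise,
by completeness of the real line. *)
Lemma weighted_contraction_fixpoint W (X : set (R -> R)) (T : (R -> R) -> R -> R)
    q D G0 : 0 <= q < 1 -> (forall x, 0 <= W x) -> 0 <= D -> X G0 ->
  (forall G, X G -> X (T G)) ->
  (forall G1 G2 N, X G1 -> X G2 -> 0 <= N ->
     (forall x, `|G1 x - G2 x| <= N * W x) ->
     forall x, `|T G1 x - T G2 x| <= q * N * W x) ->
  (forall G1 G2, X G1 -> X G2 -> forall x, `|G1 x - G2 x| <= D * W x) ->
  (forall (u : nat -> R -> R) G, (forall n, X (u n)) ->
     (forall e, 0 < e -> exists n, forall x, `|u n x - G x| <= e * W x) -> X G) ->
  exists2 G, X G & forall x, T G x = G x.
Proof.
move=> /andP[q0 q1] W0 D0 X0 XT lipT boundX closedX.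
pose u n := iter n T G0.
have Xu n : X (u n) by elim: n => //= n; exact: XT.
have uS n k x : `|u (n + k)%N x - u n x| <= q ^+ n * D * W x.
  elim: n x => [|n IHn] x; first by rewrite expr0 mul1r; exact: boundX.
  rewrite addSn /= exprS -(mulrA q); apply: lipT => //.
  by rewrite mulr_ge0// exprn_ge0.
have q_cvg0 (C : R) : q ^+ n * C @[n --> \oo] --> 0.
  rewrite -(mul0r C); apply: cvgMr_tmp; apply: cvg_expr.
  by rewrite ger0_norm.
have q_small (C e : R) : 0 < e -> exists n, q ^+ n * C < e.
  move=> e0; have [n _ nP] : \forall n \near \oo, q ^+ n * C < e.
    by apply: (@cvgr_lt _ _ _ _ _ 0).
  by exists n; exact: (nP n (leqnn n)).
have cvgu x : cvg (u n x @[n --> \oo]).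
  apply: cauchy_cvg; apply: cauchy_exP => e e0.
  have [n nP] := q_small (D * W x) e e0.
  exists (u n x); exists n => // m /= nm.
  rewrite /ball/= distrC -(subnKC nm) (le_lt_trans (uS _ _ _))//.
  by rewrite -mulrA.
pose G x := lim (u n x @[n --> \oo]).
have uG n x : `|u n x - G x| <= q ^+ n * D * W x.
  have h : `|u n x - u m x| @[m --> \oo] --> `|u n x - G x|.
    by apply: cvg_norm; apply: cvgB; [exact: cvg_cst|exact: cvgu].
  rewrite -(cvg_lim _ h)//; apply: limr_le.
    by apply/cvg_ex; eexists; exact: h.
  exists n => // m /= nm; rewrite distrC -(subnKC nm); exact: uS.
have XG : X G.
  apply: (closedX u) => // e e0; have [n nP] := q_small D e e0.
  by exists n => x; rewrite (le_trans (uG n x))// ler_wpM2r// ltW.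
exists G => // x; apply/eqP; rewrite -subr_eq0 -normr_le0.
apply/ler_addgt0Pl => e e0; rewrite addr0.
have [n nP] := q_small (2 * D * W x) e e0.
have h1 : `|T G x - u n.+1 x| <= q * (q ^+ n * D) * W x.
  rewrite distrC; apply: lipT => //; first by rewrite mulr_ge0// exprn_ge0.
have h2 := uG n.+1 x.
have -> : T G x - G x = (T G x - u n.+1 x) + (u n.+1 x - G x) by ring.
apply: le_trans (ler_normD _ _) _; apply: le_trans (ltW nP).
apply: le_trans (lerD h1 h2) _.
have -> : q * (q ^+ n * D) * W x + q ^+ n.+1 * D * W x = q * (q ^+ n * (2 * D * W x)).
  by rewrite exprS; ring.
rewrite ler_piMl ?(ltW q1)// mulr_ge0 ?exprn_ge0// mulr_ge0// mulr_ge0//.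
Qed.

End weighted_contraction.

(** * Odd and even extensions *)

Section extensions.
Context {R : realType}.
Implicit Types (f : R -> R) (x : R).

Lemma continuous_even_extension f : (forall x, 0 <= x -> {for x, continuous f}) ->
  continuous (fun x => f `|x|).
Proof.
move=> cf x; apply: (@continuous_comp _ _ _ (fun x : R => `|x|) f).
  exact: norm_continuous.
exact: cf.
Qed.

Lemma odd_extensionE f x : 0 < x -> odd_extension f x = f x.
Proof. by move=> x0; rewrite /odd_extension gtr0_sg// mul1r gtr0_norm. Qed.

Lemma odd_extensionN f x : odd_extension f (- x) = - odd_extension f x.
Proof. by rewrite /odd_extension sgrN normrN mulNr. Qed.

(** Only the origin needs an argument, and there the extension is squeezed by
the even one. *)
Lemma continuous_odd_extension f : f 0 = 0 ->
  (forall x, 0 <= x -> {for x, continuous f}) -> continuous (odd_extension f).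
Proof.
move=> f0 cf x; have ce := continuous_even_extension cf.
(* Away from 0 the extension agrees locally with f(|y|) up to a sign. *)
have [x0|x0|x0] := ltgtP x 0.
- have : (fun y => - f `|y|) y @[y --> x] --> - f `|x| by apply: cvgN; exact: ce.
  rewrite /continuous_at {2}/odd_extension ltr0_sg// mulN1r.
  apply: cvg_trans; apply: near_eq_cvg.
  near=> y; rewrite /odd_extension ltr0_sg ?mulN1r//.
  by near: y; exact: lt_nbhsl.
- have : (fun y => f `|y|) y @[y --> x] --> f `|x| by exact: ce.
  rewrite /continuous_at {2}/odd_extension gtr0_sg// mul1r.
  apply: cvg_trans; apply: near_eq_cvg.
  near=> y; rewrite /odd_extension gtr0_sg ?mul1r//.
  by near: y; exact: lt_nbhsr.
- rewrite x0 /continuous_at {2}/odd_extension sgr0 mul0r.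
  apply/cvgrPdist_le => e e0; have /cvgrPdist_le/(_ e e0) := ce 0.
  apply: filterS => y; rewrite normr0 f0 !sub0r !normrN.
  apply: le_trans; rewrite /odd_extension normrM ler_piMl// normr_sg.
  by case: (y != 0).
Unshelve. all: by end_near. Qed.

End extensions.

(** * Construction of the profile *)

Section regularised_profile.
Context {R : realType}.
Local Notation k0 := (@k0 R).
Implicit Types (a csq sl m s x : R) (G U Psi : R -> R).

Local Notation cos_limit G := (lim (cos_primitive G x @[x --> +oo])).
Local Notation sin_limit G := (lim (sin_primitive G x @[x --> +oo])).

Definition profile_of G := profile (cos_primitive G) (sin_primitive G)
  (cos_limit G).

Lemma expR_inv20 : expR (1 / 20) <= 20 / 19 :> R.
Proof.
have := expR_ge1Dx (- (1 / 20) : R); rewrite expRN.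
have e0 : 0 < expR (1 / 20) :> R by exact: expR_gt0.
rewrite -[leRHS]mul1r ler_pdivlMr// => h.
by rewrite ler_pdivlMr//; lra.
Qed.

Section contraction.
Variables (a csq sl m s : R) (Psi U : R -> R).
Hypotheses (csq_ge : 49 / 50 <= csq) (a_le : `|a| <= 2) (sl0 : 0 < sl).
Hypotheses (s01 : 0 < s <= 1)
  (s_small : s * (4 * (20 + expR 1) / sl + 3 * expR 1) <= 1 / 100)
  (s_sl : 250 * s * (20 + expR 1) <= sl) (s_m : 250 * s * (20 + expR 1) <= m)
  (s_eps : sl * s ^+ 2 <= m).
Hypotheses (cU : continuous U)
  (U_ge : forall x, 0 <= x -> Num.min (2 * sl * x) (2 * m) <= U x)
  (Psi_lip : forall x y, `|Psi x - Psi y| <= 2 / (sl * s ^+ 2) * `|x - y|)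
  (Psi1 : forall x, sl * s ^+ 2 <= x -> Psi x = 1)
  (Psi_bound : forall x, `|1 - Psi x| <= 3).

Let s0 : 0 < s. Proof. by case/andP: s01. Qed.
Let csq0 : 0 < csq. Proof. by rewrite (lt_le_trans _ csq_ge)// divr_gt0. Qed.
Let E0 : 0 < expR 1 :> R. Proof. exact: expR_gt0. Qed.
Let T0 := tail0_le s01.

(** The term alpha (sgn - psi'(u)) on the half line, for u = U - P. *)
Definition forcing G x := a * (1 - Psi (U x - profile_of G x)).

(** The equation c^2 G = forcing + shifts, solved for G and extended evenly to
the line. *)
Definition fixpoint_map G x := (forcing G `|x| + shift_sum (profile_of G) `|x|) / csq.

Let X : set (R -> R) :=
  [set G | continuous G /\ forall x, `|G x| <= 250 * s * weight s `|x|].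

Let primX G : X G -> primitives (250 * s) s G (cos_primitive G) (sin_primitive G)
    (cos_limit G) (sin_limit G).
Proof.
move=> [cG GM]; apply: primitivesP => // x x0.
by have := GM x; rewrite (ger0_norm x0).
Qed.

Let profile_cont G x : X G -> 0 <= x -> {for x, continuous (profile_of G)}.
Proof. by move=> XG x0; exact: is_derive_cvg (is_derive_profile (primX XG) x0). Qed.

Let Psi_cont : continuous Psi.
Proof.
move=> x; apply/cvgrPdist_le => e e0.
have L0 : 0 < 2 / (sl * s ^+ 2) by rewrite divr_gt0// mulr_gt0// exprn_gt0.
near=> y; apply: le_trans (Psi_lip _ _) _.
rewrite -ler_pdivlMl//; near: y.
by apply: cvgr_dist_le; [exact: cvg_id|rewrite mulr_gt0 ?invr_gt0].
Unshelve. all: by end_near. Qed.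

(** The profile is smaller than half of the lower bound of U, both near the
origin and far from it, so U - P keeps the other half. *)
Let displaced_ge G x : X G -> 0 <= x ->
  Num.min (sl * x) m <= U x - profile_of G x.
Proof.
move=> XG x0; have pr := primX XG.
have M0 := primitives_ge0 s01 pr.
have h1 := profile_bound s01 pr x0; have h2 := profile_linear_bound s01 pr x0.
have MT : 250 * s * tail s 0 <= 250 * s * (20 + expR 1) by rewrite ler_wpM2l.
have h3 : profile_of G x <= m.
  by apply: le_trans (ler_norm _) _; apply: le_trans h1 _; exact: le_trans MT s_m.
have h4 : profile_of G x <= sl * x.
  apply: le_trans (ler_norm _) _; apply: le_trans h2 _.
  by rewrite ler_wpM2r//; exact: le_trans MT s_sl.
have := U_ge x0; rewrite !ge_min => /orP[] h; apply/orP; [left|right]; lra.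
Qed.

Let forcing_far G x : X G -> s ^+ 2 <= x -> forcing G x = 0.
Proof.
move=> XG sx; rewrite /forcing Psi1 ?subrr ?mulr0//.
have x0 : 0 <= x by rewrite (le_trans _ sx)// exprn_ge0// ltW.
apply: le_trans (displaced_ge XG x0).
by rewrite le_min s_eps andbT ler_pM2l.
Qed.

Let X0 : X (fun=> 0).
Proof.
split; first by move=> x; exact: cvg_cst.
move=> x; rewrite normr0; apply: mulr_ge0; last by rewrite ltW// weight_gt0.
by apply: mulr_ge0; [exact: ler0n|exact: ltW].
Qed.

Let map_cont G : X G -> continuous (fixpoint_map G).
Proof.
move=> XG x; apply: cvgMr_tmp; apply: cvgD.
- apply: (@continuous_even_extension _ (forcing G)) => y y0.
  apply: cvgMl_tmp; apply: cvgB; first exact: cvg_cst.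
  apply: (@continuous_comp _ _ _ (fun z => U z - profile_of G z) Psi).
    by apply: cvgB; [exact: cU|exact: profile_cont].
  exact: Psi_cont.
- have co : continuous (odd_extension (profile_of G)).
    apply: continuous_odd_extension; first exact: (profile0 (primX XG)).
    by move=> y; exact: profile_cont.
  apply: (@continuous_even_extension _ (shift_sum (profile_of G))) => y y0.
  apply: (@cvgD _ _ _ _ _ (fun z => odd_extension (profile_of G) (z + 1))
    (fun z => odd_extension (profile_of G) (z - 1))).
  + apply: (@cvg_comp _ _ _ (fun z => z + 1) (odd_extension (profile_of G))
      (nbhs y) (nbhs (y + 1))); last exact: co.
    by apply: cvgD; [exact: cvg_id|exact: cvg_cst].
  + apply: (@cvg_comp _ _ _ (fun z => z - 1) (odd_extension (profile_of G))
      (nbhs y) (nbhs (y - 1))); last exact: co.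
    by apply: cvgB; [exact: cvg_id|exact: cvg_cst].
Qed.

Let profile_ofB G1 G2 N : X G1 -> X G2 ->
  (forall x, `|G1 x - G2 x| <= N * weight s `|x|) ->
  primitives N s (fun x => G1 x - G2 x)
    (fun x => cos_primitive G1 x - cos_primitive G2 x)
    (fun x => sin_primitive G1 x - sin_primitive G2 x)
    (cos_limit G1 - cos_limit G2)
    (sin_limit G1 - sin_limit G2).
Proof.
move=> X1 X2 GN; apply: primitivesB (primX X1) (primX X2) _ => x x0.
by have := GN x; rewrite (ger0_norm x0).
Qed.

(** On [0, s^2] the difference of the profiles is at most C N s^2, which
cancels the Lipschitz constant 2 / (sl s^2); the remaining constant is paid for
by the peak of the weight, at a gain of a factor s. *)
Let forcing_lip G1 G2 N x : X G1 -> X G2 ->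
  (forall x, `|G1 x - G2 x| <= N * weight s `|x|) -> 0 <= x ->
  `|forcing G1 x - forcing G2 x| <=
  s * (4 * (20 + expR 1) / sl) * N * weight s x.
Proof.
move=> X1 X2 GN x0; have pr := profile_ofB X1 X2 GN.
have N0 := primitives_ge0 s01 pr.
have w0 := ltW (weight_gt0 x s0).
have K0 : 0 <= 4 * (20 + expR 1) / sl.
  by apply: divr_ge0; [have := E0; lra|exact: ltW].
have [sx|xs] := leP (s ^+ 2) x.
  rewrite !forcing_far// subrr normr0; apply: mulr_ge0; last exact: w0.
  by apply: mulr_ge0 => //; apply: mulr_ge0; [exact: ltW|exact: K0].
have := profile_linear_bound s01 pr x0.
rewrite profileB -!/(profile_of _) => hP.
have -> : forcing G1 x - forcing G2 x =
    a * (Psi (U x - profile_of G2 x) - Psi (U x - profile_of G1 x)).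
  by rewrite /forcing; ring.
rewrite normrM.
have h1 := Psi_lip (U x - profile_of G2 x) (U x - profile_of G1 x).
have E : U x - profile_of G2 x - (U x - profile_of G1 x) =
  profile_of G1 x - profile_of G2 x by ring.
rewrite E in h1.
have hP' : `|profile_of G1 x - profile_of G2 x| <= N * (20 + expR 1) * s ^+ 2.
  apply: le_trans hP _; apply: ler_pM => //; last exact: ltW.
    by rewrite mulr_ge0// ltW// tail_gt0.
  by rewrite ler_wpM2l.
have ss : 0 < sl * s ^+ 2 by rewrite mulr_gt0// exprn_gt0.
have h2 : `|Psi (U x - profile_of G2 x) - Psi (U x - profile_of G1 x)| <=
    2 * (20 + expR 1) / sl * N.
  apply: le_trans h1 _.
  have -> : 2 * (20 + expR 1) / sl * N = 2 / (sl * s ^+ 2) * (N * (20 + expR 1) * s ^+ 2).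
    by field; rewrite !gt_eqF.
  by rewrite ler_wpM2l// divr_ge0// ltW.
apply: (@le_trans _ _ (2 * (2 * (20 + expR 1) / sl * N))).
  by apply: ler_pM.
have w : 1 <= s * weight s x.
  by rewrite mulrC -ler_pdivrMr// mul1r weight_ge_near0// ltW.
have -> : s * (4 * (20 + expR 1) / sl) * N * weight s x =
  2 * (2 * (20 + expR 1) / sl * N) * (s * weight s x) by ring.
rewrite ler_peMr//; have : 0 <= 4 * (20 + expR 1) / sl * N by exact: mulr_ge0.
by lra.
Qed.

(** The mass 2 / k0^2 of the kernel is at most 8 / 9, and 936/1000 bounds its
product with exp(1/20). *)
Let shift_lip G1 G2 N x : X G1 -> X G2 ->
  (forall x, `|G1 x - G2 x| <= N * weight s `|x|) -> 0 <= x ->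
  `|shift_sum (profile_of G1) x - shift_sum (profile_of G2) x| <=
  (s * (3 * expR 1) + 936 / 1000) * N * weight s x.
Proof.
move=> X1 X2 GN x0; have pr := profile_ofB X1 X2 GN.
have N0 := primitives_ge0 s01 pr.
have k32 := @k0_ge R; have k := @k0_gt0 R.
have -> : shift_sum (profile_of G1) x - shift_sum (profile_of G2) x =
    shift_sum (profile (fun x => cos_primitive G1 x - cos_primitive G2 x)
    (fun x => sin_primitive G1 x - sin_primitive G2 x)
    (cos_limit G1 - cos_limit G2)) x.
  by rewrite /shift_sum /odd_extension !profileB -!/(profile_of _); ring.
apply: le_trans (shift_sum_bound s01 pr x0) _.
have kV : k0^-1 <= 2 / 3.
  by rewrite -[leRHS]invrK lef_pV2 ?posrE// invfM invrK mulrC.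
have kV0 : 0 < k0^-1 by rewrite invr_gt0.
have w0 := weight_ge x s0.
have e0 : 0 < expR (- (x / 20)) :> R by exact: expR_gt0.
apply: (@le_trans _ _ (N * (s * (3 * expR 1) + 936 / 1000) * expR (- (x / 20)))).
  rewrite ler_pM2r// ler_wpM2l//.
  have E20 := expR_inv20; have E20_0 : 0 < expR (1 / 20) :> R by exact: expR_gt0.
  have h1 : 2 / k0 * expR (1 / 20) <= 4 / 3 * (20 / 19).
    by apply: ler_pM; [lra|exact: ltW|lra|].
  have h2 : 1 / k0 + s * expR 1 <= 2 / 3 + s * expR 1 by lra.
  have sE : 0 <= s * expR 1 by rewrite mulr_ge0// ltW.
  apply: (@le_trans _ _ (4 / 3 * (20 / 19) * (2 / 3 + s * expR 1))).
    apply: ler_pM => //; last by lra.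
    by rewrite mulr_ge0// ?ltW// mulr_gt0.
  by lra.
have K0 : 0 <= s * (3 * expR 1) + 936 / 1000 :> R.
  have : 0 <= s * expR 1 by rewrite mulr_ge0// ltW.
  by lra.
rewrite [_ * N]mulrC; apply: ler_wpM2l; last exact: w0.
by apply: mulr_ge0; [exact: N0|exact: K0].
Qed.

(** The ratio 97/100 times the least value 49/50 of c^2 is above 936/1000 by
more than 1/100, which leaves room for the terms of order s. *)
Let map_lip G1 G2 N : X G1 -> X G2 ->
  (forall x, `|G1 x - G2 x| <= N * weight s `|x|) ->
  forall x, `|fixpoint_map G1 x - fixpoint_map G2 x| <=
    97 / 100 * N * weight s `|x|.
Proof.
move=> X1 X2 GN x; have N0 := primitives_ge0 s01 (profile_ofB X1 X2 GN).
have h1 := forcing_lip X1 X2 GN (normr_ge0 x).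
have h2 := shift_lip X1 X2 GN (normr_ge0 x).
have -> : fixpoint_map G1 x - fixpoint_map G2 x =
  ((forcing G1 `|x| - forcing G2 `|x|) +
   (shift_sum (profile_of G1) `|x| - shift_sum (profile_of G2) `|x|)) / csq.
  by rewrite /fixpoint_map; ring.
rewrite normrM normfV (gtr0_norm csq0) ler_pdivrMr//.
apply: le_trans (ler_normD _ _) _; apply: le_trans (lerD h1 h2) _.
have -> : s * (4 * (20 + expR 1) / sl) * N * weight s `|x| +
  (s * (3 * expR 1) + 936 / 1000) * N * weight s `|x| =
  (s * (4 * (20 + expR 1) / sl + 3 * expR 1) + 936 / 1000) * (N * weight s `|x|) by ring.
have -> : 97 / 100 * N * weight s `|x| * csq = 97 / 100 * csq * (N * weight s `|x|) by ring.
apply: ler_wpM2r; last by (have h := s_small; have h' := csq_ge; lra).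
by apply: mulr_ge0; [exact: N0|exact: ltW (weight_gt0 _ s0)].
Qed.

Let map0 x : `|fixpoint_map (fun=> 0) x| <= 7 * s * weight s `|x|.
Proof.
have pr0 : primitives 0 s (fun=> 0) (cos_primitive (fun=> 0 : R))
    (sin_primitive (fun=> 0 : R))
    (cos_limit (fun=> 0 : R))
    (sin_limit (fun=> 0 : R)).
  apply: primitivesP => //; first by move=> y; exact: cvg_cst.
  by move=> y _; rewrite normr0 mul0r.
have sh0 : shift_sum (profile_of (fun=> 0)) `|x| = 0.
  by apply/eqP; rewrite -normr_le0; have := shift_sum_bound s01 pr0 (normr_ge0 x); rewrite !mul0r.
rewrite /fixpoint_map sh0 addr0 normrM normfV (gtr0_norm csq0) ler_pdivrMr//.
have w0 := weight_gt0 `|x| s0.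
have [sx|xs] := leP (s ^+ 2) `|x|.
  by rewrite forcing_far// normr0 !mulr_ge0// ltW.
have w : 1 <= s * weight s `|x|.
  by rewrite mulrC -ler_pdivrMr// mul1r weight_ge_near0// ltW.
rewrite /forcing normrM; apply: (@le_trans _ _ (2 * 3)); first by apply: ler_pM.
rewrite -mulrA -mulrA mulrA.
have : 1 * 1 <= s * weight s `|x| * (csq * 50 / 49) by apply: ler_pM => //; (have h := csq_ge; lra).
by lra.
Qed.

(** The ball of radius 250 s is preserved: 97/100 * 250 s + 7 s <= 250 s, where
7 s bounds the image of 0. *)
Lemma regularised_profile_fixpoint : exists2 G, X G & forall x, fixpoint_map G x = G x.
Proof.
apply: (@weighted_contraction_fixpoint _ (fun x => weight s `|x|) X fixpoint_map
  (97 / 100) (500 * s) (fun=> 0)).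
- by apply/andP; lra.
- by move=> x; rewrite ltW ?weight_gt0.
- by apply: mulr_ge0; [exact: ler0n|exact: ltW].
- exact: X0.
- move=> G XG; split; first exact: map_cont.
  move=> x; have := @map_lip G (fun=> 0) (250 * s) XG X0.
  have GM y : `|G y - 0| <= 250 * s * weight s `|y|.
    by rewrite subr0; case: XG => _; exact.
  move=> /(_ GM x) h1; have h2 := map0 x.
  have -> : fixpoint_map G x =
    (fixpoint_map G x - fixpoint_map (fun=> 0) x) + fixpoint_map (fun=> 0) x by ring.
  apply: le_trans (ler_normD _ _) _; apply: le_trans (lerD h1 h2) _.
  have w0 : 0 <= s * weight s `|x| by rewrite mulr_ge0// ltW// weight_gt0.
  by lra.
- by move=> G1 G2 N X1 X2 _; exact: map_lip.
- move=> G1 G2 [_ G1M] [_ G2M] x; apply: le_trans (ler_normB _ _) _.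
  by have := G1M x; have := G2M x; lra.
- move=> u G Xu uG; split.
    move=> x; apply/cvgrPdist_le => e e0.
    have w0 := weight_gt0 0 s0.
    have [n nP] := uG (e / 3 / weight s 0) (divr_gt0 (divr_gt0 e0 (ltr0n _ 3)) w0).
    have unG y : `|u n y - G y| <= e / 3.
      apply: le_trans (nP y) _; rewrite -[leRHS](@divfK _ (weight s 0)) ?gt_eqF//.
      rewrite ler_wpM2l ?weight_le_max//.
      by rewrite ltW// !divr_gt0.
    have := (Xu n).1 x => /cvgrPdist_le/(_ (e / 3)) h.
    have {}h := h (divr_gt0 e0 (ltr0n _ 3)).
    apply: filterS h => y h.
    have -> : G x - G y = (u n x - u n y) - (u n x - G x) + (u n y - G y) by ring.
    apply: le_trans (ler_normD _ _) _.
    have := ler_normB (u n x - u n y) (u n x - G x).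
    have := unG x; have := unG y; lra.
  move=> x; apply/ler_addgt0Pl => e e0.
  have w0 := weight_gt0 `|x| s0.
  have [n nP] := uG (e / weight s `|x|) (divr_gt0 e0 w0).
  have := nP x; rewrite divfK ?gt_eqF// => h.
  have -> : G x = u n x - (u n x - G x) by ring.
  apply: le_trans (ler_normB _ _) _.
  by have := (Xu n).2 x; lra.
Qed.

End contraction.

(** Here sl is a lower bound of the slope of the wave at the origin and eps =
sl s^2. The bound s0 depends on sl and m only, not on the wave U itself. *)
Lemma regularised_profile_exists sl m : 0 < sl -> 0 < m ->
  exists2 s0, 0 < s0 & forall s, 0 < s <= s0 -> s <= 1 /\
  forall a csq Psi U, 49 / 50 <= csq -> `|a| <= 2 -> continuous U ->
  (forall x, 0 <= x -> Num.min (2 * sl * x) (2 * m) <= U x) ->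
  (forall x y, `|Psi x - Psi y| <= 2 / (sl * s ^+ 2) * `|x - y|) ->
  (forall x, sl * s ^+ 2 <= x -> Psi x = 1) ->
  (forall x, `|1 - Psi x| <= 3) ->
  exists G AC AS lC lS, [/\ continuous G, primitives (250 * s) s G AC AS lC lS &
    forall x, 0 <= x -> let P := profile AC AS lC in
      csq * G x = a * (1 - Psi (U x - P x)) + shift_sum P x].
Proof.
move=> sl0 m0; have E0 : 0 < expR 1 :> R by exact: expR_gt0.
pose C := 4 * (20 + expR 1) / sl + 3 * expR 1 : R.
have C0 : 0 < C by rewrite addr_gt0 ?mulr_gt0// ?invr_gt0// addr_gt0.
pose D := 250 * (20 + expR 1) : R.
have D0 : 0 < D by apply: mulr_gt0; [exact: ltr0n|exact: addr_gt0].
pose s0 := Num.min 1 (Num.min (1 / 100 / C) (Num.min (sl / D) (Num.min (m / D) (m / sl)))).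
exists s0.
  by rewrite /s0 !lt_min ltr01 !divr_gt0.
move=> s /andP[s_gt0]; rewrite /s0 !le_min => /andP[s1 /andP[sC /andP[sD1 /andP[sD2 sm]]]].
split => // a csq Psi U csq_ge a2 cU U_ge Psi_lip Psi1 Psi3.
have := @regularised_profile_fixpoint a csq sl m s Psi U csq_ge a2 sl0.
case.
- by rewrite s_gt0.
- by move: sC; rewrite ler_pdivlMr.
- by move: sD1; rewrite ler_pdivlMr// /D; lra.
- by move: sD2; rewrite ler_pdivlMr// /D; lra.
- move: sm; rewrite ler_pdivlMr// mulrC; apply: le_trans.
  by rewrite ler_pM2l// ler_piMr// ltW.
- exact: cU.
- exact: U_ge.
- exact: Psi_lip.
- exact: Psi1.
- exact: Psi3.
move=> G [cG GM] fixG.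
have := @primitivesP _ (250 * s) s G s_gt0 cG.
case.
  by move=> x x0; have := GM x; rewrite (ger0_norm x0).
move=> c0 GM' dC dS lims.
exists G, (cos_primitive G), (sin_primitive G).
exists (cos_limit G), (sin_limit G).
split => // x x0.
have csq0 : 0 < csq by rewrite (lt_le_trans _ csq_ge)// divr_gt0.
by rewrite -fixG /fixpoint_map (ger0_norm x0) mulrCA divff ?mulr1// gt_eqF.
Qed.

End regularised_profile.

(** * Exchange of integrals against a bounded kernel *)

Section fubini_kernel.
Context {R : realType}.
Local Notation mu := (@lebesgue_measure R).
Implicit Types (a b f g q : R -> R).

Lemma integrable_mul_bounded f g (C : R) : mu.-integrable setT (EFin \o f) ->
  measurable_fun setT g -> (forall x, `|g x| <= C) ->
  mu.-integrable setT (EFin \o (fun x => f x * g x)).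
Proof.
move=> fi mg gC.
have := @integrableMr _ _ _ mu _ measurableT g (EFin \o f) mg.
rewrite (_ : _ \* _ = EFin \o (fun x => (f x * g x)%R))%E; last first.
  by apply/funext => x /=; rewrite -EFinM mulrC.
apply => //; exists C; split; first exact: num_real.
by move=> c Cc x _ /=; apply: le_trans (gC x) _; exact: ltW.
Qed.

Section kernel.
Variables (a b : R -> R) (K : R * R -> R) (C : R).
Hypotheses (ai : mu.-integrable setT (EFin \o a))
  (bi : mu.-integrable setT (EFin \o b))
  (mK : measurable_fun setT K) (KC : forall z, `|K z| <= C).

Let f (z : R * R) := (a z.1 * b z.2 * K z)%:E.

Let ma : measurable_fun setT a.
Proof. by apply/measurable_EFinP; case/integrableP: ai. Qed.

Let mb : measurable_fun setT b.
Proof. by apply/measurable_EFinP; case/integrableP: bi. Qed.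

Let mK1 x : measurable_fun setT (fun y => K (x, y)).
Proof. by apply: measurableT_comp mK _; exact: pair1_measurable. Qed.

Let mK2 y : measurable_fun setT (fun x => K (x, y)).
Proof. by apply: measurableT_comp mK _; exact: pair2_measurable. Qed.

Let mf : measurable_fun setT f.
Proof.
apply/measurable_EFinP; apply: measurable_funM => //.
by apply: measurable_funM; exact: measurableT_comp.
Qed.

Lemma integrable_kernel : (mu \x mu)%E.-integrable setT f.
Proof.
apply: (proj2 (integrable12ltyP mu mu mf)).
have C0 : 0 <= C by exact: le_trans (KC (0, 0)).
have afin : (\int[mu]_x `|(a x)%:E| < +oo)%E by case/integrableP: ai.
have bfin : (\int[mu]_y `|(b y)%:E| < +oo)%E by case/integrableP: bi.
have B0 : (0 <= \int[mu]_y `|(b y)%:E|)%E by exact: integral_ge0.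
have ma' : measurable_fun setT (fun x => `|(a x)%:E|%E).
  by apply: measurableT_comp => //; exact/measurable_EFinP.
have mb' : measurable_fun setT (fun x => `|(b x)%:E|%E).
  by apply: measurableT_comp => //; exact/measurable_EFinP.
apply: (@le_lt_trans _ _ (\int[mu]_x (`|(a x)%:E| * (C%:E * \int[mu]_y `|(b y)%:E|)))%E).
  apply: ge0_le_integral => //.
  - by move=> x _; exact: integral_ge0.
  - have mabs : measurable_fun setT (fun z => `|f z|%E) by exact: measurableT_comp.
    have := (@measurable_fun_fubini_tonelli_F _ _ _ _ _ mu _ mabs (fun z => abse_ge0 (f z))). exact.
  - by apply: emeasurable_funM => //; exact: measurable_cst.
  move=> x _; rewrite -(ge0_integralZl mu measurableT mb')//.
  rewrite -(ge0_integralZl mu measurableT (measurable_funeM C%:E mb'))//; last first.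
    by move=> y _; rewrite mule_ge0// lee_fin.
  apply: ge0_le_integral => //.
  - apply: measurableT_comp => //; apply: (measurableT_comp mf).
    exact: pair1_measurable.
  - by apply: measurable_funeM; exact: measurable_funeM.
  - move=> y _; rewrite /f /= !normrM lee_fin -mulrA ler_wpM2l//.
    by rewrite mulrC ler_wpM2r.
rewrite ge0_integralZr//; last by rewrite mule_ge0// lee_fin.
by rewrite lte_mul_pinfty ?ge0_fin_numE ?lte_mul_pinfty// ?integral_ge0// mule_ge0 ?lee_fin.
Qed.

Lemma integrable_kernel_section x : mu.-integrable setT (EFin \o (fun y => b y * K (x, y))).
Proof. exact: (integrable_mul_bounded bi). Qed.

Lemma integrable_kernel_section2 y : mu.-integrable setT (EFin \o (fun x => a x * K (x, y))).
Proof. exact: (integrable_mul_bounded ai). Qed.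

Let sectionF x : (\int[mu]_y f (x, y))%E = (a x * \int[mu]_y (b y * K (x, y)))%:E.
Proof.
rewrite EFinM /Rintegral fineK; last exact: integrable_fin_num (integrable_kernel_section x).
rewrite -integralZl//; last exact: integrable_kernel_section.
by apply: eq_integral => y _; rewrite /f /= -EFinM mulrA.
Qed.

Let sectionG y : (\int[mu]_x f (x, y))%E = (b y * \int[mu]_x (a x * K (x, y)))%:E.
Proof.
rewrite EFinM /Rintegral fineK; last exact: integrable_fin_num (integrable_kernel_section2 y).
rewrite -integralZl//; last exact: integrable_kernel_section2.
by apply: eq_integral => x _; rewrite /f /= -EFinM mulrCA mulrA.
Qed.

Lemma integrable_kernel_transform :
  mu.-integrable setT (EFin \o (fun x => a x * \int[mu]_y (b y * K (x, y)))).
Proof.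
have := integrable_fubini_F integrable_kernel.
by apply: eq_integrable => // x _; rewrite /fubini_F sectionF.
Qed.

(** With a and b integrable and K bounded, a(x) b(y) K(x, y) is integrable on
the plane. *)
Lemma Fubini_kernel :
  \int[mu]_x (a x * \int[mu]_y (b y * K (x, y))) =
  \int[mu]_y (b y * \int[mu]_x (a x * K (x, y))).
Proof.
rewrite /Rintegral; congr fine.
under eq_integral do rewrite -/(Rintegral _ _ _) -sectionF.
under [RHS]eq_integral do rewrite -/(Rintegral _ _ _) -sectionG.
exact: Fubini integrable_kernel.
Qed.

End kernel.
End fubini_kernel.

(** * A kernel of Fejer type *)

Section fejer_kernel.
Context {R : realType}.
Local Notation mu := (@lebesgue_measure R).
Implicit Types (L k t x y : R).

(** A weight on [-L, L] which is at least 3/4 on the half interval and vanishes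
at the ends, so that its cosine transform is integrable; the indicator function
would lead to the Dirichlet kernel, which is not. *)
Definition bump L k := 1 - (k / L) ^+ 2.

Lemma continuous_bump L : continuous (bump L).
Proof.
move=> k; apply: cvgB; first exact: cvg_cst.
by apply: cvgM; apply: cvgMr_tmp; exact: cvg_id.
Qed.

Lemma bump_itv L k : 0 < L -> - L <= k <= L -> 0 <= bump L k <= 1.
Proof.
move=> L0 /andP[k1 k2].
rewrite subr_ge0 gerBl sqr_ge0 andbT -[leRHS](expr1n _ 2).
rewrite -real_normK ?num_real// ler_sqr ?nnegrE//.
by rewrite normrM normfV (gtr0_norm L0) ler_pdivrMr// mul1r ler_norml k1.
Qed.

Definition bump_cos L t := \int[mu]_(k in `[- L, L]) (bump L k * cos (k * t)).

Definition kernel_bound L t := 16 * (L / (1 + (L * t) ^+ 2)).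

Lemma continuous_cosM (t : R) : continuous (fun k : R => cos (k * t)).
Proof.
by move=> k; apply: continuous_comp; [exact: mulrr_continuous|exact: continuous_cos].
Qed.

Lemma continuous_bump_cos L t : continuous (fun k => bump L k * cos (k * t)).
Proof. by move=> k; apply: cvgM; [exact: continuous_bump|exact: continuous_cosM]. Qed.

Lemma bump_cos_le L t : 0 < L -> `|bump_cos L t| <= 2 * L.
Proof.
move=> L0; have iB : mu.-integrable `[- L, L] (EFin \o (fun k => bump L k * cos (k * t))).
  by apply: continuous_integrable_itv; exact: continuous_bump_cos.
rewrite /bump_cos (le_trans (le_normr_Rintegral _ iB))//.
apply: (@le_trans _ _ (\int[mu]_(k in `[- L, L]) 1)).
  apply: le_Rintegral => //.
  - exact: integrable_norm.
  - by apply: continuous_integrable_itv => k; exact: cvg_cst.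
  move=> k /=; rewrite in_itv/= => kL; rewrite normrM.
  have /andP[b0 b1] := bump_itv L0 kL.
  by rewrite (ger0_norm b0) mulr_ile1 ?normr_ge0 ?cos_max.
rewrite Rintegral_cst// mul1r /= lebesgue_measure_itv/= lte_fin.
by rewrite ifT /=; lra.
Qed.

Lemma bump_cosE L t : 0 < L -> t != 0 ->
  bump_cos L t = 4 * sin (L * t) / (L ^+ 2 * t ^+ 3) - 4 * cos (L * t) / (L * t ^+ 2).
Proof.
move=> L0 t0.
pose F k := bump L k * sin (k * t) / t - 2 * k / L ^+ 2 * cos (k * t) / t ^+ 2
  + 2 / L ^+ 2 * sin (k * t) / t ^+ 3.
have dF k : is_derive k 1 F (bump L k * cos (k * t)).
  rewrite /F /bump; under eq_fun do rewrite expr2; derive.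
  by field; rewrite t0 gt_eqF.
rewrite /bump_cos /Rintegral.
rewrite (@continuous_FTC2 _ (fun k => bump L k * cos (k * t)) F).
- rewrite /= /F /bump.
  rewrite !mulNr sinN cosN sqrrN divff ?gt_eqF//.
  by field; rewrite t0 gt_eqF.
- by rewrite gtrN.
- exact/continuous_subspaceT/continuous_bump_cos.
- split.
  + by move=> x _; have [] := dF x.
  + by apply: cvg_at_right_filter; exact: is_derive_cvg (dF _).
  + by apply: cvg_at_left_filter; exact: is_derive_cvg (dF _).
- by move=> x _; rewrite derive1E; have [_ ->] := dF x.
Qed.

(** For |L t| <= 1 the trivial bound 2 L is used, beyond it the explicit
formula. *)
Lemma bump_cos_bound L t : 0 < L -> `|bump_cos L t| <= kernel_bound L t.
Proof.
move=> L0; rewrite /kernel_bound.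
have D0 : 0 < 1 + (L * t) ^+ 2 by rewrite ltr_pwDl// sqr_ge0.
have [u1|u1] := leP ((L * t) ^+ 2) 1.
  apply: le_trans (bump_cos_le t L0) _.
  rewrite mulrA ler_pdivlMr//; nra.
have t0 : t != 0.
  by apply: contraTneq u1 => ->; rewrite mulr0 expr0n/= -leNgt.
rewrite bump_cosE//.
set u := L * t in u1 *.
have u0 : u != 0 by rewrite mulf_neq0// gt_eqF.
have -> : 4 * sin u / (L ^+ 2 * t ^+ 3) - 4 * cos u / (L * t ^+ 2) =
  4 * L / u ^+ 2 * (sin u / u - cos u).
  by rewrite /u; field; rewrite t0 gt_eqF.
have un : 1 <= `|u|.
  rewrite -(@ler_pXn2r _ 2)// ?nnegrE// expr1n real_normK ?num_real//.
  exact: ltW.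
have h : `|sin u / u - cos u| <= 2.
  apply: le_trans (ler_normB _ _) _.
  have := cos_max u; have : `|sin u / u| <= 1.
    rewrite normrM normfV ler_pdivrMr ?(lt_le_trans _ un)// mul1r.
    exact: le_trans (sin_max u) un.
  by lra.
have U0 : 0 < u ^+ 2 by rewrite exprn_even_gt0.
rewrite normrM ger0_norm; last by rewrite divr_ge0 ?ltW// mulr_gt0.
apply: (@le_trans _ _ (4 * L / u ^+ 2 * 2)).
  by rewrite ler_wpM2l// divr_ge0 ?ltW// mulr_gt0.
have -> : 4 * L / u ^+ 2 * 2 = L * (8 / u ^+ 2) by ring.
have -> : 16 * (L / (1 + u ^+ 2)) = L * (16 / (1 + u ^+ 2)) by ring.
rewrite ler_wpM2l ?(ltW L0)// ler_pdivrMr// mulrAC ler_pdivlMr//.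
by lra.
Qed.

Lemma continuous_kernel_bound L : continuous (kernel_bound L).
Proof.
move=> t; apply: cvgMl_tmp; apply: cvgMl_tmp; apply: cvgV.
  by rewrite gt_eqF// ltr_pwDl// sqr_ge0.
apply: cvgD; first exact: cvg_cst.
by apply: cvgM; apply: cvgMl_tmp; exact: cvg_id.
Qed.

Lemma kernel_bound_ge0 L t : 0 <= L -> 0 <= kernel_bound L t.
Proof.
move=> L0; rewrite /kernel_bound; apply: mulr_ge0; first exact: ler0n.
by rewrite divr_ge0// addr_ge0// sqr_ge0.
Qed.

Lemma kernel_boundN L t : kernel_bound L (- t) = kernel_bound L t.
Proof. by rewrite /kernel_bound mulrN sqrrN. Qed.

Lemma integral_inv_oneDsqr : (\int[mu]_x ((oneDsqr x)^-1)%:E = (pi : R)%:E)%E.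
Proof.
rewrite ge0_symfun_integralT.
- rewrite (_ : [set x | _] = `[0, +oo[%classic :> set R); last first.
    by apply/seteqP; split => x /=; rewrite in_itv/= andbT.
  by rewrite integral0y_oneDsqr -EFinM; congr (_%:E); field.
- by move=> x; rewrite invr_ge0 ltW// (lt_le_trans ltr01)// oneDsqr_ge1.
- exact: continuous_oneDsqrV.
- by move=> x /=; rewrite /oneDsqr sqrrN.
Qed.

Lemma integral_kernel_bound L x : 0 < L ->
  (\int[mu]_y (kernel_bound L (y - x))%:E = (16 * pi)%:E)%E.
Proof.
move=> L0; pose F y := (y - x) * L.
have dF y : is_derive y 1 F L by rewrite /F; derive; ring.
have F1 : F^`()%classic = cst L.
  by apply/funext => y; rewrite derive1E; have [_ ->] := dF y.
have := @increasing_ge0_integration_by_substitutionT R F (fun x => (oneDsqr x)^-1).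
rewrite F1 integral_inv_oneDsqr => h.
have {}h : (pi%:E = \int[mu]_y ((oneDsqr (F y))^-1 * L)%:E)%E.
  apply: h.
  - by move=> y z yz; rewrite /F ltr_pM2r// ltrD2r.
  - by move=> y; exact: cvg_cst.
  - exact: is_cvg_cst.
  - exact: is_cvg_cst.
  - by move=> y; have [] := dF y.
  - apply: gt0_cvgMlNy => //; apply: cvg_addrr_Ny.
  - apply: gt0_cvgMly => //; apply: cvg_addrr.
  - exact: continuous_oneDsqrV.
  - by move=> y; rewrite invr_ge0 ltW// (lt_le_trans ltr01)// oneDsqr_ge1.
rewrite EFinM h -ge0_integralZl//.
- apply: eq_integral => y _; rewrite -EFinM /kernel_bound /oneDsqr /F.
  by rewrite [L / _]mulrC [L * _]mulrC.
- apply/measurable_EFinP; apply: measurable_funM => //.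
  apply: (@continuous_measurable_fun _ (fun y => (oneDsqr (F y))^-1)) => y.
  apply: (@cvg_comp _ _ _ F (fun z => (oneDsqr z)^-1) (nbhs y) (nbhs (F y))).
    exact: is_derive_cvg (dF y).
  exact: continuous_oneDsqrV.
- move=> y _; rewrite lee_fin mulr_ge0// ?ltW// invr_gt0.
Qed.


End fejer_kernel.

(** * The Schur test *)

Section schur.
Context {R : realType}.
Local Notation mu := (@lebesgue_measure R).

(** By 2 |q(x) q(y)| <= q(x)^2 + q(y)^2, each half integrated first in the
variable that does not occur in it. *)
Lemma schur_test (k : R * R -> R) (A : R) (q : R -> R) :
  measurable_fun setT k -> (forall z, 0 <= k z) -> measurable_fun setT q ->
  0 <= A ->
  (forall x, \int[mu]_y (k (x, y))%:E <= A%:E)%E ->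
  (forall y, \int[mu]_x (k (x, y))%:E <= A%:E)%E ->
  (\int[mu]_x \int[mu]_y (`|q x| * `|q y| * k (x, y))%:E <=
   A%:E * \int[mu]_x (q x ^+ 2)%:E)%E.
Proof.
move=> mk k0 mq A0 kA1 kA2.
pose g1 (z : R * R) := (2^-1 * q z.1 ^+ 2 * k z)%:E.
pose g2 (z : R * R) := (2^-1 * q z.2 ^+ 2 * k z)%:E.
have mq1 : measurable_fun setT (fun z : R * R => q z.1) by exact: measurableT_comp.
have mq2 : measurable_fun setT (fun z : R * R => q z.2) by exact: measurableT_comp.
have mg1 : measurable_fun setT g1.
  apply/measurable_EFinP; apply: measurable_funM => //.
  by apply: measurable_funM => //; exact: measurable_funX.
have mg2 : measurable_fun setT g2.
  apply/measurable_EFinP; apply: measurable_funM => //.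
  by apply: measurable_funM => //; exact: measurable_funX.
have half_sqr_ge0 x : 0 <= 2^-1 * q x ^+ 2 by rewrite mulr_ge0 ?sqr_ge0.
have g10 z : (0 <= g1 z)%E by rewrite lee_fin mulr_ge0.
have g20 z : (0 <= g2 z)%E by rewrite lee_fin mulr_ge0.
have mgx1 x : measurable_fun setT (fun y => g1 (x, y)).
  by apply: (measurableT_comp mg1); exact: pair1_measurable.
have mgx2 x : measurable_fun setT (fun y => g2 (x, y)).
  by apply: (measurableT_comp mg2); exact: pair1_measurable.
have mky y : measurable_fun setT (fun x => (k (x, y))%:E).
  apply/measurable_EFinP; apply: (measurableT_comp mk); exact: pair2_measurable.
have mkx x : measurable_fun setT (fun y => (k (x, y))%:E).
  apply/measurable_EFinP; apply: (measurableT_comp mk); exact: pair1_measurable.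
pose h (z : R * R) := (`|q z.1| * `|q z.2| * k z)%:E.
have mabs : measurable_fun setT h.
  apply/measurable_EFinP; apply: measurable_funM => //.
  by apply: measurable_funM; exact: measurableT_comp.
have mabsx x : measurable_fun setT (fun y => h (x, y)).
  by apply: (measurableT_comp mabs); exact: pair1_measurable.
have mqq : measurable_fun setT (fun x => (q x ^+ 2)%:E).
  by apply/measurable_EFinP; exact: measurable_funX.
have I1 : (\int[mu]_x \int[mu]_y g1 (x, y) <= (2^-1 * A)%:E * \int[mu]_x (q x ^+ 2)%:E)%E.
  rewrite -ge0_integralZl//; last 2 first.
  - by move=> x _; rewrite lee_fin sqr_ge0.
  - by rewrite lee_fin mulr_ge0.
  apply: ge0_le_integral => //.
  - by move=> x _; exact: integral_ge0.
  - have := @measurable_fun_fubini_tonelli_F _ _ _ _ _ mu _ mg1 g10; exact.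
  - exact: measurable_funeM.
  move=> x _; rewrite /g1 /=.
  under eq_integral do rewrite EFinM.
  rewrite (ge0_integralZl mu measurableT (mkx x))//; last 2 first.
  - by move=> y _; rewrite lee_fin.
  - by rewrite lee_fin.
  apply: (@le_trans _ _ ((2^-1 * q x ^+ 2)%:E * A%:E)%E).
    by rewrite lee_wpmul2l// lee_fin.
  by rewrite -!EFinM lee_fin; lra.
have I2 : (\int[mu]_x \int[mu]_y g2 (x, y) <= (2^-1 * A)%:E * \int[mu]_x (q x ^+ 2)%:E)%E.
  rewrite (@fubini_tonelli _ _ _ _ _ mu mu g2 mg2 g20) -ge0_integralZl//; last 2 first.
  - by move=> x _; rewrite lee_fin sqr_ge0.
  - by rewrite lee_fin mulr_ge0.
  apply: ge0_le_integral => //.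
  - by move=> x _; exact: integral_ge0.
  - have := @measurable_fun_fubini_tonelli_G _ _ _ _ _ mu _ mg2 g20; exact.
  - exact: measurable_funeM.
  move=> y _; rewrite /g2 /=.
  under eq_integral do rewrite EFinM.
  rewrite (ge0_integralZl mu measurableT (mky y))//; last 2 first.
  - by move=> x _; rewrite lee_fin.
  - by rewrite lee_fin.
  apply: (@le_trans _ _ ((2^-1 * q y ^+ 2)%:E * A%:E)%E).
    by rewrite lee_wpmul2l// lee_fin.
  by rewrite -!EFinM lee_fin; lra.
apply: (@le_trans _ _ (\int[mu]_x (\int[mu]_y g1 (x, y) + \int[mu]_y g2 (x, y)))%E).
  apply: ge0_le_integral => //.
  - by move=> x _; apply: integral_ge0 => y _; rewrite lee_fin !mulr_ge0.
  - have := @measurable_fun_fubini_tonelli_F _ _ _ _ _ mu _ mabs; apply => z.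
    by rewrite lee_fin !mulr_ge0.
  - apply: emeasurable_funD.
    + have := @measurable_fun_fubini_tonelli_F _ _ _ _ _ mu _ mg1 g10; exact.
    + have := @measurable_fun_fubini_tonelli_F _ _ _ _ _ mu _ mg2 g20; exact.
  move=> x _; rewrite -ge0_integralD//; [|exact: mgx1|exact: mgx2].
  apply: ge0_le_integral => //.
  - by move=> y _; rewrite lee_fin !mulr_ge0.
  - exact: mabsx.
  - by apply: emeasurable_funD; [exact: mgx1|exact: mgx2].
  move=> y _; rewrite /g1 /g2 /= -EFinD lee_fin -mulrDl ler_wpM2r//.
  have := sqr_ge0 (`|q x| - `|q y|).
  have := real_normK (num_real (q x)); have := real_normK (num_real (q y)).
  by nra.
rewrite ge0_integralD//.
- apply: le_trans (leeD I1 I2) _.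
  rewrite -ge0_muleDl ?lee_fin ?mulr_ge0// -EFinD.
  by rewrite (_ : 2^-1 * A + 2^-1 * A = A)//; lra.
- by move=> x _; exact: integral_ge0.
- have := @measurable_fun_fubini_tonelli_F _ _ _ _ _ mu _ mg1 g10; exact.
- by move=> x _; exact: integral_ge0.
- have := @measurable_fun_fubini_tonelli_F _ _ _ _ _ mu _ mg2 g20; exact.
Qed.

End schur.

(** * A Bessel inequality for the sine transform *)

Section bessel.
Context {R : realType}.
Local Notation mu := (@lebesgue_measure R).
Implicit Types (q : R -> R) (k x y : R).

Definition sine_transform q (k : R) := \int[mu]_x (q x * sin (k * x)).

Lemma measurable_sin : measurable_fun setT (@sin R).
Proof. by apply: continuous_measurable_fun; exact: continuous_sin. Qed.

Lemma measurable_sinM : measurable_fun setT (fun z : R * R => sin (z.1 * z.2)).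
Proof. by apply: measurableT_comp; [exact: measurable_sin|exact: measurable_funM]. Qed.

Lemma sinM_max (z : R * R) : `|sin (z.1 * z.2)| <= 1.
Proof. exact: sin_max. Qed.

Lemma measurable_sine_transform q : mu.-integrable setT (EFin \o q) ->
  measurable_fun setT (sine_transform q).
Proof.
move=> qi; pose g (k : R) := (oneDsqr k)^-1.
have g0 k : 0 < g k by rewrite invr_gt0 (lt_le_trans ltr01)// oneDsqr_ge1.
have mg : measurable_fun setT g.
  by apply: continuous_measurable_fun; exact: continuous_oneDsqrV.
have gi : mu.-integrable setT (EFin \o g).
  apply/integrableP; split; first exact/measurable_EFinP.
  under eq_integral => k _ do rewrite /= ger0_norm ?(ltW (g0 k))//.
  by rewrite integral_inv_oneDsqr ltry.
have := integrable_kernel_transform gi qi measurable_sinM sinM_max.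
move=> /integrableP[/measurable_EFinP h _].
rewrite (_ : sine_transform q =
  (fun k => (g k * \int[mu]_y (q y * sin (k * y))) * oneDsqr k)).
  apply: measurable_funM => //; apply: continuous_measurable_fun.
  exact: continuous_oneDsqr.
by apply/funext => k; rewrite /sine_transform /g mulrAC mulVf ?mul1r//.
Qed.

Section inequality.
Variables (q : R -> R) (L : R).
Hypotheses (qi : mu.-integrable setT (EFin \o q)) (L0 : 0 < L).

Local Notation S := (sine_transform q).

Let W : R -> R := bump L \_ `[- L, L].

Let W_itv k : 0 <= W k <= 1.
Proof.
rewrite /W patchE; case: ifPn => [|_]; last by rewrite lexx ler01.
by rewrite inE/= in_itv/=; exact: bump_itv.
Qed.

Let Wi : mu.-integrable setT (EFin \o W).
Proof.
rewrite /W -restrict_EFin; apply/integrable_restrict => //; rewrite setTI.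
by apply: continuous_integrable_itv; exact: continuous_bump.
Qed.

Let mq : measurable_fun setT q.
Proof. by apply/measurable_EFinP; case/integrableP: qi. Qed.

Let sinM (z : R * R) := sin (z.1 * z.2).

Let msinM : measurable_fun setT sinM.
Proof. exact: measurable_sinM. Qed.

Let sinM1 z : `|sinM z| <= 1. Proof. exact: sin_max. Qed.

Let WSi : mu.-integrable setT (EFin \o (fun k => W k * S k)).
Proof. exact: (integrable_kernel_transform Wi qi msinM sinM1). Qed.

(** The weighted inner product of sin(k x) and sin(k y). *)
Let kernel (x y : R) := \int[mu]_k (W k * (sin (k * y) * sin (k * x))).

Let kernelE (x y : R) : kernel x y = 2^-1 * (bump_cos L (x - y) - bump_cos L (x + y)).
Proof.
rewrite /bump_cos -RintegralB//; last 2 first.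
  by apply: continuous_integrable_itv; exact: continuous_bump_cos.
  by apply: continuous_integrable_itv; exact: continuous_bump_cos.
rewrite -RintegralZl//; last first.
  apply: continuous_integrable_itv => k; apply: cvgB; exact: continuous_bump_cos.
rewrite /kernel [RHS]Rintegral_mkcond; apply: eq_Rintegral => k _.
rewrite /W !patchE; case: ifPn => _; last by rewrite mul0r.
by rewrite (mulrBr k) (mulrDr k) cosB cosD; field.
Qed.

Let majorant (z : R * R) :=
  2^-1 * (kernel_bound L (z.1 - z.2) + kernel_bound L (z.1 + z.2)).

Let kernel_le (x y : R) : `|kernel x y| <= majorant (x, y).
Proof.
rewrite kernelE normrM ger0_norm ?invr_ge0// ler_wpM2l ?invr_ge0//.
apply: le_trans (ler_normB _ _) _.
by apply: lerD; exact: bump_cos_bound.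
Qed.

Let measurable_kernel_bound : measurable_fun setT (kernel_bound L).
Proof. by apply: continuous_measurable_fun; exact: continuous_kernel_bound. Qed.

Let m_majorant : measurable_fun setT majorant.
Proof.
apply: measurable_funM => //; apply: measurable_funD.
- by apply: measurableT_comp => //; exact: measurable_funB.
- by apply: measurableT_comp => //; exact: measurable_funD.
Qed.

Let majorant_ge0 z : 0 <= majorant z.
Proof. by rewrite mulr_ge0 ?invr_ge0// addr_ge0// kernel_bound_ge0// ltW. Qed.

Let m_shift (x : R) : measurable_fun setT (fun y => (kernel_bound L (y - x))%:E).
Proof.
apply/measurable_EFinP; apply: measurableT_comp => //; exact: measurable_funB.
Qed.

Let majorant_int (x : R) : (\int[mu]_y (majorant (x, y))%:E <= (16 * pi)%:E)%E.
Proof.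
have K0 t := kernel_bound_ge0 t (ltW L0).
rewrite /majorant/=; under eq_integral => y _.
  rewrite -(kernel_boundN L (x - y)) opprB (_ : x + y = y - - x); last by rewrite opprK addrC.
  rewrite EFinM EFinD; over.
rewrite ge0_integralZl//; last 2 first.
- exact: (emeasurable_funD (m_shift x) (m_shift (- x))).
- by move=> y _; rewrite -EFinD lee_fin addr_ge0.
rewrite ge0_integralD//; last 4 first.
- by move=> y _; rewrite lee_fin.
- exact: m_shift.
- by move=> y _; rewrite lee_fin.
- exact: m_shift.
rewrite !integral_kernel_bound// -EFinD -EFinM lee_fin; lra.
Qed.

Let majorantC (x y : R) : majorant (x, y) = majorant (y, x).
Proof. by rewrite /majorant/= -(kernel_boundN L (x - y)) opprB addrC [y + x]addrC addrC. Qed.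

Let sin_prodM x (z : R * R) := sin (z.1 * z.2) * sin (z.1 * x).

Let m_sin_prodM x : measurable_fun setT (sin_prodM x).
Proof.
apply: measurable_funM; first exact: measurable_sinM.
apply: measurableT_comp; first exact: measurable_sin.
by apply: measurable_funM => //; exact: measurable_cst.
Qed.

Let sin_prodM1 x z : `|sin_prodM x z| <= 1.
Proof. by rewrite normrM mulr_ile1 ?sin_max. Qed.

Let inner_transform (x : R) : \int[mu]_k (W k * S k * sin (k * x)) =
  \int[mu]_y (q y * kernel x y).
Proof.
rewrite -(Fubini_kernel Wi qi (m_sin_prodM x) (sin_prodM1 x)).
apply: eq_Rintegral => k _; rewrite -mulrA; congr (_ * _).
rewrite /S -RintegralZr//.
  by apply: eq_Rintegral => y _; rewrite /sin_prodM/= mulrA.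
exact: (integrable_kernel_section qi msinM sinM1 k).
Qed.

(** Exchanging the integrals twice turns the weighted square of the transform
into a quadratic form in q, whose kernel is the cosine transform of the weight.
*)
Let transform_identity : \int[mu]_k (W k * S k * S k) =
  \int[mu]_x (q x * \int[mu]_y (q y * kernel x y)).
Proof.
rewrite (Fubini_kernel WSi qi msinM sinM1).
by apply: eq_Rintegral => x _; rewrite -inner_transform.
Qed.

Let m_swap : measurable_fun setT (fun z : R * R => sin (z.2 * z.1)).
Proof. by apply: measurableT_comp; [exact: measurable_sin|exact: measurable_funM]. Qed.

Let q_inner_int : mu.-integrable setT
  (EFin \o (fun x => q x * \int[mu]_y (q y * kernel x y))).
Proof.
have := integrable_kernel_transform qi WSi m_swap (fun z => sin_max _).
by apply: eq_integrable => // x _ /=; rewrite -inner_transform.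
Qed.

Let q_kernel_int (x : R) : mu.-integrable setT (EFin \o (fun y => q y * kernel x y)).
Proof.
have mm : measurable_fun setT (fun z : R * R => sin (z.2 * z.1) * sin (z.2 * x)).
  apply: measurable_funM => //.
  by apply: measurableT_comp; [exact: measurable_sin|exact: measurable_funM].
have mm1 (z : R * R) : `|sin (z.2 * z.1) * sin (z.2 * x)| <= 1.
  by rewrite normrM mulr_ile1 ?sin_max.
exact: (integrable_kernel_transform qi Wi mm mm1).
Qed.

Let majorised (x : R) : (`|q x * \int[mu]_y (q y * kernel x y)|%:E <=
  \int[mu]_y (`|q x| * `|q y| * majorant (x, y))%:E)%E.
Proof.
have mmx : measurable_fun setT (fun y => majorant (x, y)).
  by apply: (measurableT_comp m_majorant); exact: pair1_measurable.
have mabs : measurable_fun setT (fun y => (`|q y| * majorant (x, y))%:E).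
  apply/measurable_EFinP; apply: measurable_funM => //.
  exact: measurableT_comp.
rewrite normrM EFinM EFin_normr_Rintegral//.
apply: (@le_trans _ _ (`|q x|%:E * \int[mu]_y (`|q y| * majorant (x, y))%:E)%E).
  rewrite lee_wpmul2l ?lee_fin//.
  apply: le_trans (le_abse_integral _ _ _) _ => //.
    by case/integrableP: (q_kernel_int x).
  apply: ge0_le_integral => //.
  - apply: measurableT_comp => //; by case/integrableP: (q_kernel_int x).
  - move=> y _; rewrite lee_fin normrM ler_wpM2l//; exact: kernel_le.
rewrite -ge0_integralZl//.
- by under eq_integral do rewrite -EFinM mulrA.
- by move=> y _; rewrite lee_fin mulr_ge0.
Qed.

(** The L^1 norms of the rows of the kernel are at most 16 pi for every L, by
scaling invariance; hence a bound uniform in L. *)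
Lemma bessel_sine_bump :
  (\int[mu]_k (W k * sine_transform q k ^+ 2)%:E <=
   (16 * pi)%:E * \int[mu]_x (q x ^+ 2)%:E)%E.
Proof.
have WSSi := integrable_kernel_transform WSi qi msinM sinM1.
have -> : (\int[mu]_k (W k * sine_transform q k ^+ 2)%:E =
    (\int[mu]_k (W k * S k * S k)%R)%:E)%E.
  rewrite /Rintegral fineK ?(integrable_fin_num _ WSSi)//.
  by apply: eq_integral => k _; rewrite expr2 mulrA.
rewrite transform_identity.
apply: (@le_trans _ _ (`|\int[mu]_x (q x * \int[mu]_y (q y * kernel x y))|%:E)).
  by rewrite lee_fin ler_norm.
rewrite EFin_normr_Rintegral//.
apply: le_trans (le_abse_integral _ _ _) _ => //.
  by case/integrableP: q_inner_int.
have pi0 : 0 <= 16 * pi :> R by rewrite mulr_ge0// pi_ge0.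
have := schur_test m_majorant majorant_ge0 mq pi0 majorant_int.
have majorant_int2 (y : R) : (\int[mu]_x (majorant (x, y))%:E <= (16 * pi)%:E)%E.
  by under eq_integral do rewrite majorantC; exact: majorant_int.
move=> /(_ majorant_int2); apply: le_trans.
apply: ge0_le_integral => //.
- by apply: measurableT_comp => //; case/integrableP: q_inner_int.
- pose h (z : R * R) := (`|q z.1| * `|q z.2| * majorant z)%:E.
  have mh : measurable_fun setT h.
    apply/measurable_EFinP; apply: measurable_funM => //.
    have mnq : measurable_fun setT (fun x => `|q x|) by exact: measurableT_comp.
    apply: measurable_funM.
      exact: (measurableT_comp mnq measurable_fst).
    exact: (measurableT_comp mnq measurable_snd).
  have h0 z : (0 <= h z)%E.
    by rewrite lee_fin; apply: mulr_ge0; [exact: mulr_ge0|exact: majorant_ge0].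
  have := @measurable_fun_fubini_tonelli_F _ _ _ _ _ mu _ mh h0; exact.
- by move=> x _ /=; exact: majorised.
Qed.

(** On the half interval the weight is at least 3/4, hence at least 1/4. *)
Lemma bessel_sine : (\int[mu]_(k in `[(- (L / 2))%R, (L / 2)%R]) (sine_transform q k ^+ 2)%:E <=
   (64 * pi)%:E * \int[mu]_x (q x ^+ 2)%:E)%E.
Proof.
have mS := measurable_sine_transform qi.
have mW : measurable_fun setT W.
  by apply/measurable_EFinP; case/integrableP: Wi.
have W0 k : 0 <= W k by case/andP: (W_itv k).
have mWS : measurable_fun setT (fun k => (W k * sine_transform q k ^+ 2)%:E).
  apply/measurable_EFinP; apply: measurable_funM; first exact: mW.
  exact: measurable_funX.
have WS0 k : (0 <= (W k * sine_transform q k ^+ 2)%:E)%E.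
  by rewrite lee_fin; apply: mulr_ge0; [exact: W0|exact: sqr_ge0].
have h : (\int[mu]_(k in `[(- (L / 2))%R, (L / 2)%R]) (sine_transform q k ^+ 2)%:E <=
    4%:E * \int[mu]_k (W k * sine_transform q k ^+ 2)%:E)%E.
  have four0 : (0 <= 4%:E :> \bar R)%E by rewrite lee_fin; exact: ler0n.
  rewrite -(ge0_integralZl mu measurableT mWS (fun k _ => WS0 k) four0).
  rewrite [leLHS]integral_mkcond; apply: ge0_le_integral.
  - exact: measurableT.
  - by move=> k _; rewrite patchE; case: ifPn => _; rewrite ?lee_fin ?sqr_ge0.
  - apply/(measurable_restrictT _ _).1; first exact: measurable_itv.
    by apply/measurable_EFinP; apply: measurable_funTS; exact: measurable_funX.
  - exact: measurable_funeM.
  move=> k _; rewrite patchE; case: ifPn => [|_]; last first.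
    by apply: mule_ge0; [exact: four0|exact: WS0].
  rewrite inE/= in_itv/= => /andP[k1 k2].
  rewrite -EFinM lee_fin mulrA; apply: ler_peMl; first exact: sqr_ge0.
  rewrite /W patchE ifT; last by rewrite inE/= in_itv/=; lra.
  rewrite /bump.
  have : (k / L) ^+ 2 <= (2^-1) ^+ 2.
    rewrite -real_normK ?num_real// ler_sqr ?nnegrE// normrM normfV (gtr0_norm L0).
    by rewrite ler_pdivrMr// ler_norml; lra.
  by lra.
apply: le_trans h _.
apply: (@le_trans _ _ (4%:E * ((16 * pi)%:E * \int[mu]_x (q x ^+ 2)%:E))%E).
  by apply: lee_wpmul2l; [rewrite lee_fin; exact: ler0n|exact: bessel_sine_bump].
by rewrite muleA -EFinM (_ : 4 * (16 * pi) = 64 * pi); last by ring.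
Qed.

End inequality.
End bessel.

(** * Square integrable functions *)

Section square_integrable.
Context {R : realType}.
Local Notation mu := (@lebesgue_measure R).
Implicit Types (f g : R -> R) (D : set R) (rho : R).

Lemma poweR2_normr (x : R) : (`|x%:E| `^ 2%:R = (x ^+ 2)%:E)%E.
Proof. by rewrite abse_EFin poweR_EFin powR_mulrn// real_normK ?num_real. Qed.

Lemma Lnorm2_sqr f : ('N[mu]_2%:E[EFin \o f] `^ 2%:R = \int[mu]_x (f x ^+ 2)%:E)%E.
Proof.
rewrite poweR_Lnorm ?pnatr_eq0//.
by apply: eq_integral => x _; rewrite -poweR2_normr.
Qed.

Lemma Lnorm2_lt f rho : 0 < rho ->
  (\int[mu]_x (f x ^+ 2)%:E < (rho ^+ 2)%:E)%E -> ('N[mu]_2%:E[EFin \o f] < rho%:E)%E.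
Proof.
move=> rho0; rewrite -Lnorm2_sqr; apply: contraTT; rewrite -!leNgt => h.
rewrite (_ : (rho ^+ 2)%:E = (rho%:E `^ 2%:R)%E).
  by apply: gt0_ler_poweR => //; rewrite in_itv/= ?Lnorm_ge0 ?leey ?lee_fin ?(ltW rho0).
by rewrite poweR_EFin powR_mulrn// ltW.
Qed.

Lemma L2T f : L2 setT f <->
  measurable_fun setT f /\ (\int[mu]_x (f x ^+ 2)%:E < +oo)%E.
Proof.
rewrite /L2 patch_setT -Lnorm2_sqr; split.
- case/andP; rewrite !inE/= /finite_norm => mf nf; split => //.
  exact: poweR_lty.
- move=> [mf nf]; apply/andP; rewrite !inE/= /finite_norm; split => //.
  by apply: lty_poweRy nf; rewrite pnatr_eq0.
Qed.

Lemma L2_restrict D f : L2 D f <-> L2 setT (f \_ D).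
Proof. by rewrite /L2 patch_setT. Qed.

End square_integrable.

(** * A cutoff function *)

Section quadratic_remainder.
Context {R : realType}.

(** Differentiates t |t| at all points at once, the origin included. *)
Lemma is_derive_quadratic_remainder (f : R -> R) (x d : R) :
  (forall h, `|f (x + h) - f x - d * h| <= h ^+ 2) -> is_derive x 1 f d.
Proof.
move=> fx.
have H : h^-1 *: (f (h *: 1 + x) - f x) @[h --> 0^'] --> d.
  apply/cvgrPdist_le => e e0; near=> h.
  have h0 : h != 0 by near: h; exact: nbhs_dnbhs_neq.
  have -> : d - h^-1 *: (f (h *: 1 + x) - f x) = - (h^-1 * (f (x + h) - f x - d * h)).
    by rewrite /GRing.scale /= mulr1 [h + x]addrC; field.
  rewrite normrN normrM normfV ler_pdivrMl ?normr_gt0//.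
  apply: le_trans (fx h) _.
  rewrite -real_normK ?num_real// expr2 ler_wpM2l//.
  near: h; apply: dnbhs0_le; exact: e0.
apply: DeriveDef; first by apply/cvg_ex; exists d.
exact: (cvg_lim _ H).
Unshelve. all: by end_near. Qed.

Lemma is_derive_mul_norm (x : R) : is_derive x 1 (fun t : R => t * `|t|) (2 * `|x|).
Proof.
apply: is_derive_quadratic_remainder => h.
rewrite ler_norml; apply/andP.
have sq := sqr_ge0 (x + h).
case: (ler0P (x + h)) => h1; case: (ler0P x) => h2.
- by split; nra.
- have p : 0 <= x * (- (x + h) - h) by apply: mulr_ge0; lra.
  by split; nra.
- have p : 0 <= (- x) * (x + h + h) by apply: mulr_ge0; lra.
  by split; nra.
- by split; nra.
Qed.

End quadratic_remainder.

Section cutoff.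
Context {R : realType}.
Implicit Types (x t : R).

(** [ramp3] is the cube of the positive part, a C^2 function, written with an
absolute value so that it can be differentiated without distinguishing cases;
[ramp2] and [ramp1] are its derivatives. *)
Definition ramp3 t := (t ^+ 3 + t * (t * `|t|)) / 2.
Definition ramp2 t := 3 * (t ^+ 2 + t * `|t|) / 2.
Definition ramp1 t := 3 * (t + `|t|).

Lemma is_derive_ramp3 t : is_derive t 1 ramp3 (ramp2 t).
Proof.
pose g t : R := t * `|t|; have d : is_derive t 1 g _ := is_derive_mul_norm t.
rewrite /ramp3 /ramp2; under eq_fun do rewrite !exprS expr0 mulr1 -/(g _).
by derive; rewrite /g; field.
Qed.

Lemma is_derive_ramp2 t : is_derive t 1 ramp2 (ramp1 t).
Proof.
pose g t : R := t * `|t|; have d : is_derive t 1 g _ := is_derive_mul_norm t.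
rewrite /ramp2 /ramp1; under eq_fun do rewrite expr2 -/(g _).
by derive; field.
Qed.

Lemma continuous_ramp1 : continuous ramp1.
Proof.
move=> t; apply: cvgMl_tmp; apply: cvgD; first exact: cvg_id.
exact: norm_continuous.
Qed.

Lemma ramp_le0 t : t <= 0 -> [/\ ramp3 t = 0, ramp2 t = 0 & ramp1 t = 0].
Proof. by move=> t0; rewrite /ramp3 /ramp2 /ramp1 ler0_norm//; split; field. Qed.

Lemma ramp3_ge0 t : 0 <= t -> ramp3 t = t ^+ 3.
Proof. by move=> t0; rewrite /ramp3 ger0_norm//; field. Qed.

Definition cutoff_arg x := (9 - x ^+ 2) / 5.
(** For |x| <= 2 the inner ramp is at least 1 and the outer one vanishes; for
|x| >= 3 the inner ramp vanishes and the outer one equals 1. *)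
Definition cutoff x := 1 - ramp3 (1 - ramp3 (cutoff_arg x)).
Definition cutoff1 x :=
  ramp2 (1 - ramp3 (cutoff_arg x)) * (ramp2 (cutoff_arg x) * (- 2 * x / 5)).
Definition cutoff2 x :=
  - (ramp1 (1 - ramp3 (cutoff_arg x)) * (ramp2 (cutoff_arg x) * (- 2 * x / 5)) *
    (ramp2 (cutoff_arg x) * (- 2 * x / 5))) +
  ramp2 (1 - ramp3 (cutoff_arg x)) *
    (ramp1 (cutoff_arg x) * (- 2 * x / 5) ^+ 2 - ramp2 (cutoff_arg x) * (2 / 5)).

Lemma is_derive_cutoff_arg x : is_derive x 1 cutoff_arg (- 2 * x / 5).
Proof. by rewrite /cutoff_arg; under eq_fun do rewrite expr2; derive; field. Qed.

Lemma is_derive_ramp_cutoff_arg x :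
  is_derive x 1 (fun x => 1 - ramp3 (cutoff_arg x))
    (- (ramp2 (cutoff_arg x) * (- 2 * x / 5))).
Proof.
have d := is_derive_comp (is_derive_cutoff_arg x) (is_derive_ramp3 (cutoff_arg x)).
rewrite -[X in is_derive _ _ _ X]add0r.
exact: (is_derive_add (is_derive_const 1 x) (is_derive_opp d)).
Qed.

Lemma is_derive_cutoff x : is_derive x 1 cutoff (cutoff1 x).
Proof.
have d := is_derive_comp (is_derive_ramp_cutoff_arg x) (is_derive_ramp3 _).
apply: is_derive_eq (is_derive_add (is_derive_const 1 x) (is_derive_opp d)) _.
by rewrite /cutoff1; ring.
Qed.

Lemma is_derive_cutoff1 x : is_derive x 1 cutoff1 (cutoff2 x).
Proof.
have d1 := is_derive_comp (is_derive_ramp_cutoff_arg x) (is_derive_ramp2 _).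
have d2 := is_derive_comp (is_derive_cutoff_arg x) (is_derive_ramp2 _).
have d3 : is_derive x 1 (fun x : R => - 2 * x / 5) (- 2 / 5) by derive; field.
apply: is_derive_eq (is_derive_mul d1 (is_derive_mul d2 d3)) _.
by rewrite /cutoff2 expr2; field.
Qed.

Lemma cutoff_near x : `|x| <= 2 -> [/\ cutoff x = 1, cutoff1 x = 0 & cutoff2 x = 0].
Proof.
move=> x2; have y1 : 1 <= cutoff_arg x.
  have : x ^+ 2 <= 2 ^+ 2 by rewrite -real_normK ?num_real// ler_sqr ?nnegrE.
  by rewrite /cutoff_arg; lra.
have y3 : 1 - ramp3 (cutoff_arg x) <= 0.
  by rewrite ramp3_ge0 ?(le_trans ler01)// subr_le0 exprn_ege1.
have [r3 r2 r1] := ramp_le0 y3.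
by rewrite /cutoff /cutoff1 /cutoff2 r3 r2 r1 !mul0r subr0 oppr0 addr0.
Qed.

Lemma cutoff_far x : 3 <= `|x| -> [/\ cutoff x = 0, cutoff1 x = 0 & cutoff2 x = 0].
Proof.
move=> x3; have y0 : cutoff_arg x <= 0.
  have : 3 ^+ 2 <= x ^+ 2 by rewrite -[leRHS]real_normK ?num_real// ler_sqr ?nnegrE.
  by rewrite /cutoff_arg; lra.
have [r3 r2 r1] := ramp_le0 y0.
rewrite /cutoff /cutoff1 /cutoff2 r3 r2 r1 subr0 !(mul0r, mulr0, subr0, oppr0, addr0).
by rewrite ramp3_ge0// expr1n subrr.
Qed.

Lemma continuous_cutoff2 : continuous cutoff2.
Proof.
move=> x.
have ca : {for x, continuous cutoff_arg} := is_derive_cvg (is_derive_cutoff_arg x).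
have cr := is_derive_cvg (is_derive_ramp_cutoff_arg x).
have cx : (- 2 * x / 5) @[x --> x] --> - 2 * x / 5.
  by apply: cvgMr_tmp; apply: cvgMl_tmp; exact: cvg_id.
have c2 : (ramp2 (cutoff_arg x)) @[x --> x] --> ramp2 (cutoff_arg x).
  exact: (cvg_comp _ _ ca (is_derive_cvg (is_derive_ramp2 _))).
have c1 : (ramp1 (cutoff_arg x)) @[x --> x] --> ramp1 (cutoff_arg x).
  exact: (cvg_comp _ _ ca (@continuous_ramp1 _)).
have c2' := cvg_comp _ _ cr (is_derive_cvg (is_derive_ramp2 (1 - ramp3 (cutoff_arg x)))).
have c1' := cvg_comp _ _ cr (@continuous_ramp1 (1 - ramp3 (cutoff_arg x))).
apply: cvgD.
  apply: cvgN; apply: cvgM; last by apply: cvgM.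
  by apply: cvgM; [exact: c1'|apply: cvgM].
apply: cvgM; first exact: c2'.
apply: cvgB; last by apply: cvgMr_tmp.
by apply: cvgM => //; apply: cvgM.
Qed.

Lemma continuous_bounded_support (f : R -> R) (M : R) : continuous f ->
  (forall x, M <= `|x| -> f x = 0) -> exists C, forall x, `|f x| <= C.
Proof.
move=> cf f0; pose N := Num.max M 0.
have N0 : - N <= N by rewrite ge0_cp// le_max lexx orbT.
have [c _ cM] := @EVT_max R (fun x => `|f x|) _ _ N0
  (continuous_subspaceT (fun x => cvg_norm (cf x))).
exists `|f c| => x.
have [xN|xN] := leP `|x| N.
  by apply: cM; rewrite in_itv/= -ler_norml.
by rewrite f0 ?normr0// ltW// (le_lt_trans _ xN)// le_max lexx.
Qed.

End cutoff.

(** * Limits of integrals *)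

Section limits_of_integrals.
Context {R : realType}.
Local Notation mu := (@lebesgue_measure R).

Lemma Rintegral_dominated_cvg (f_ : nat -> R -> R) (f g : R -> R) :
  (forall n, measurable_fun setT (f_ n)) -> measurable_fun setT f ->
  (forall x, f_ n x @[n --> \oo] --> f x) -> mu.-integrable setT (EFin \o g) ->
  (forall n x, `|f_ n x| <= g x) ->
  \int[mu]_x f_ n x @[n --> \oo] --> \int[mu]_x f x.
Proof.
move=> mf_ mf cf gi fg.
have [] := @dominated_convergence _ _ _ mu setT measurableT
  (fun n => EFin \o f_ n) (EFin \o f) (EFin \o g) _ _ _ gi _.
- by move=> n; apply/measurable_EFinP; exact: mf_.
- by apply/measurable_EFinP; exact: mf.
- by apply/aeW => x _; apply/fine_cvgP; split; [exact: nearW|exact: cf].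
- by apply/aeW => x n _ /=; rewrite lee_fin.
move=> fi _ h; apply: fine_cvg; rewrite fineK; last exact: integrable_fin_num fi.
exact: h.
Qed.

Lemma ge0_le_integral_itv (f : R -> R) (A : \bar R) : measurable_fun setT f ->
  (forall x, 0 <= f x) ->
  (forall n : nat, \int[mu]_(x in `[(- n%:R)%R, n%:R%R]) (f x)%:E <= A)%E ->
  (\int[mu]_x (f x)%:E <= A)%E.
Proof.
move=> mf f0 fA.
pose F (n : nat) : set R := `[(- n%:R)%R, n%:R%R].
have FT : \bigcup_n F n = setT.
  apply/seteqP; split => // x _; have [n xn] : exists n : nat, `|x| <= n%:R.
    by exists (Num.bound `|x|); apply: ltW; exact: archi_boundP.
  by exists n => //=; rewrite /F/= in_itv/= -ler_norml.
have h : (\int[mu]_(x in F n) (f x)%:E)%E @[n --> \oo] -->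
    (\int[mu]_(x in \bigcup_n F n) (f x)%:E)%E.
  apply: ge0_nondecreasing_set_cvg_integral.
  - move=> n m nm; rewrite subsetEset => x; rewrite /F/= !in_itv/= => /andP[xn nx].
    have nm' : n%:R <= m%:R :> R by rewrite ler_nat.
    by rewrite (le_trans _ xn) ?lerN2// (le_trans nx).
  - by move=> n; exact: measurable_itv.
  - by move=> n; apply/measurable_EFinP; exact: measurable_funTS.
  - by move=> n x _; rewrite lee_fin.
rewrite FT in h.
rewrite -(cvg_lim _ h)//; apply: lime_le; first by apply/cvg_ex; eexists; exact: h.
by apply: nearW => n; exact: fA.
Qed.

Lemma cvge0_poweR2 (u : nat -> \bar R) : (forall n, 0 <= u n)%E -> u n @[n --> \oo] --> 0%E ->
  (u n `^ 2%:R)%E @[n --> \oo] --> 0%E.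
Proof.
move=> u_ge0 /fine_cvgP[ufin u0].
apply/fine_cvgP; split.
  by near=> n; apply: fin_num_poweR; near: n.
rewrite [X in _ --> X](_ : _ = (0 : R) * 0); last by rewrite mul0r.
have : (fine \o u) n * (fine \o u) n @[n --> \oo] --> (0 : R) * 0 by apply: cvgM.
apply: cvg_trans; apply: near_eq_cvg; near=> n.
by rewrite /= fine_poweR powR_mulrn ?fine_ge0// expr2.
Unshelve. all: by end_near. Qed.

End limits_of_integrals.

(** * The sine transform of a second derivative *)

Section second_derivative_transform.
Context {R : realType}.
Local Notation mu := (@lebesgue_measure R).
Implicit Types (k x : R).

(** Two integrations by parts at once, with C^2 test functions: the form in
which a second derivative enters the sine transform. *)
Definition weak_second_derivative (r r2 : R -> R) :=
  forall phi phi1 phi2 : R -> R,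
    (forall x, is_derive x 1 phi (phi1 x)) ->
    (forall x, is_derive x 1 phi1 (phi2 x)) -> continuous phi2 ->
    (exists M, forall x, M <= `|x| -> phi x = 0) ->
    \int[mu]_x (r x * phi2 x) = \int[mu]_x (r2 x * phi x).

Variables (r r2 : R -> R).
Hypotheses (ri : mu.-integrable setT (EFin \o r))
  (r2i : mu.-integrable setT (EFin \o r2)).

Definition sine_window (e k x : R) := cutoff (e * x) * sin (k * x).
Definition sine_window1 (e k x : R) :=
  e * cutoff1 (e * x) * sin (k * x) + k * (cutoff (e * x) * cos (k * x)).
Definition sine_window2 (e k x : R) :=
  e ^+ 2 * cutoff2 (e * x) * sin (k * x) + 2 * e * k * (cutoff1 (e * x) * cos (k * x))
  - k ^+ 2 * (cutoff (e * x) * sin (k * x)).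

Lemma is_derive_scaled (f : R -> R) (e x d : R) : is_derive (e * x) 1 f d ->
  is_derive x 1 (fun x => f (e * x)) (e * d).
Proof.
move=> fd; have h : is_derive x 1 (fun x : R => e * x) e by derive; ring.
by apply: is_derive_eq (is_derive_comp h fd) _; rewrite mulrC.
Qed.

Lemma is_derive_sine_window (e k x : R) :
  is_derive x 1 (sine_window e k) (sine_window1 e k x).
Proof.
have d1 := is_derive_scaled (is_derive_cutoff (e * x)).
have d2 := is_derive_scaled (is_derive_sin (k * x)).
by apply: is_derive_eq (is_derive_mul d1 d2) _; rewrite /sine_window1; ring.
Qed.

Lemma is_derive_sine_window1 (e k x : R) :
  is_derive x 1 (sine_window1 e k) (sine_window2 e k x).
Proof.
have d0 := is_derive_scaled (is_derive_cutoff (e * x)).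
have d1 := is_derive_scaled (is_derive_cutoff1 (e * x)).
have ds := is_derive_scaled (is_derive_sin (k * x)).
have dc := is_derive_scaled (is_derive_cos (k * x)).
have h1 := is_derive_mul (is_derive_mul (is_derive_const e x) d1) ds.
have h2 := is_derive_mul (is_derive_const k x) (is_derive_mul d0 dc).
by apply: is_derive_eq (is_derive_add h1 h2) _; rewrite /sine_window2; ring.
Qed.

Lemma continuous_sine_window2 (e k : R) : continuous (sine_window2 e k).
Proof.
move=> x.
have cc0 := is_derive_cvg (is_derive_scaled (is_derive_cutoff (e * x))).
have cc1 := is_derive_cvg (is_derive_scaled (is_derive_cutoff1 (e * x))).
have cs := is_derive_cvg (is_derive_scaled (is_derive_sin (k * x))).
have cc := is_derive_cvg (is_derive_scaled (is_derive_cos (k * x))).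
have ex : e * z @[z --> x] --> e * x by apply: cvgMl_tmp; exact: cvg_id.
have cc2 : cutoff2 (e * z) @[z --> x] --> cutoff2 (e * x).
  exact: (cvg_comp _ _ ex (@continuous_cutoff2 _ (e * x))).
apply: cvgB.
  apply: cvgD; last by apply: cvgMl_tmp; apply: cvgM.
  by apply: cvgM => //; apply: cvgMl_tmp.
by apply: cvgMl_tmp; apply: cvgM.
Qed.

Lemma cutoff_bounds : exists C : R,
  [/\ forall x, `|cutoff x| <= C, forall x, `|cutoff1 x| <= C &
      forall x, `|cutoff2 x| <= C].
Proof.
have c0 : continuous (@cutoff R) by move=> x; exact: is_derive_cvg (is_derive_cutoff x).
have c1 : continuous (@cutoff1 R) by move=> x; exact: is_derive_cvg (is_derive_cutoff1 x).
have [C0 h0] := continuous_bounded_support c0 (fun x h => let: And3 p _ _ := cutoff_far h in p).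
have [C1 h1] := continuous_bounded_support c1 (fun x h => let: And3 _ p _ := cutoff_far h in p).
have [C2 h2] := continuous_bounded_support (@continuous_cutoff2 R)
  (fun x h => let: And3 _ _ p := cutoff_far h in p).
exists (Num.max C0 (Num.max C1 C2)); split => x; rewrite !le_max.
- by rewrite h0.
- by rewrite h1 orbT.
- by rewrite h2 !orbT.
Qed.

Hypothesis weak : weak_second_derivative r r2.

Let mr : measurable_fun setT r.
Proof. by apply/measurable_EFinP; case/integrableP: ri. Qed.
Let mr2 : measurable_fun setT r2.
Proof. by apply/measurable_EFinP; case/integrableP: r2i. Qed.

Lemma continuous_bounded_integrable (f g : R -> R) (C : R) :
  mu.-integrable setT (EFin \o f) -> continuous g -> (forall x, `|g x| <= C) ->
  mu.-integrable setT (EFin \o (fun x => f x * g x)).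
Proof.
move=> fi cg gC; apply: integrable_mul_bounded fi _ gC.
exact: continuous_measurable_fun.
Qed.

(** Test with cutoff(e x) sin(k x), whose second derivative is - k^2 sin(k x)
plus bounded terms that vanish pointwise as e tends to 0, and pass to the limit
by dominated convergence, r and r2 being integrable. *)
Lemma sine_transform_second_derivative k :
  k ^+ 2 * sine_transform r k = - sine_transform r2 k.
Proof.
have [C [h0 h1 h2]] := cutoff_bounds.
have C0 : 0 <= C := le_trans (normr_ge0 _) (h0 0).
pose e (n : nat) : R := n.+1%:R^-1.
have e0 n : 0 < e n by rewrite invr_gt0.
have e1 n : e n <= 1 by rewrite invf_le1// ler1n.
pose B := C * (1 + 2 * `|k| + k ^+ 2).
have B0 : 0 <= B by rewrite mulr_ge0// !addr_ge0 ?sqr_ge0// mulr_ge0.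
have CB : C <= B by rewrite ler_peMr// -addrA lerDl addr_ge0 ?sqr_ge0// mulr_ge0.
have wB n x : `|sine_window (e n) k x| <= C.
  by rewrite normrM -[C]mulr1 ler_pM// sin_max.
have w2B n x : `|sine_window2 (e n) k x| <= B.
  have t1 : `|e n ^+ 2 * cutoff2 (e n * x) * sin (k * x)| <= C.
    have ee : `|e n ^+ 2| <= 1.
      by rewrite normrX (ger0_norm (ltW (e0 n))) exprn_ile1// ltW.
    rewrite normrM -[leRHS]mulr1; apply: ler_pM => //; last exact: sin_max.
    by rewrite normrM -[leRHS]mul1r; apply: ler_pM.
  have t2 : `|2 * e n * k * (cutoff1 (e n * x) * cos (k * x))| <= 2 * `|k| * C.
    rewrite normrM; apply: ler_pM => //.
      rewrite !normrM ler_wpM2r// (ger0_norm (_ : 0 <= 2))// (ger0_norm (ltW (e0 n))).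
      by have := e1 n; lra.
    by rewrite normrM -[leRHS]mulr1 ler_pM// cos_max.
  have t3 : `|k ^+ 2 * (cutoff (e n * x) * sin (k * x))| <= k ^+ 2 * C.
    rewrite normrM (ger0_norm (sqr_ge0 _)) ler_wpM2l ?sqr_ge0//; exact: wB.
  apply: le_trans (ler_normB _ _) _.
  apply: (@le_trans _ _ (C + 2 * `|k| * C + k ^+ 2 * C)).
    by apply: lerD => //; apply: le_trans (ler_normD _ _) _; exact: lerD.
  by rewrite /B; rewrite le_eqVlt; apply/orP; left; apply/eqP; ring.
have cw n : continuous (sine_window (e n) k).
  by move=> x; exact: is_derive_cvg (is_derive_sine_window _ _ _).
have iw n : mu.-integrable setT (EFin \o (fun x => r2 x * sine_window (e n) k x)).
  exact: continuous_bounded_integrable r2i (cw n) (wB n).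
have iw2 n : mu.-integrable setT (EFin \o (fun x => r x * sine_window2 (e n) k x)).
  exact: continuous_bounded_integrable ri (@continuous_sine_window2 _ _) (w2B n).
have zero n : \int[mu]_x (r x * sine_window2 (e n) k x - r2 x * sine_window (e n) k x) = 0.
  rewrite RintegralB//; apply/eqP; rewrite subr_eq0; apply/eqP.
  apply: weak (is_derive_sine_window _ _) (is_derive_sine_window1 _ _)
    (@continuous_sine_window2 _ _) _.
  exists (3 / e n) => x; rewrite ler_pdivrMr// => h.
  have ex3 : 3 <= `|e n * x| by rewrite normrM (gtr0_norm (e0 n)) mulrC.
  by have [z0 _ _] := cutoff_far ex3; rewrite /sine_window z0 mul0r.
have csin := @continuous_sin_scaled R k.
have ir : mu.-integrable setT (EFin \o (fun x => r x * sin (k * x))).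
  exact: continuous_bounded_integrable ri csin (fun x => sin_max _).
have ir2 : mu.-integrable setT (EFin \o (fun x => r2 x * sin (k * x))).
  exact: continuous_bounded_integrable r2i csin (fun x => sin_max _).
have lim : \int[mu]_x ((- k ^+ 2) * (r x * sin (k * x)) - r2 x * sin (k * x)) = 0.
  have h : \int[mu]_x (r x * sine_window2 (e n) k x - r2 x * sine_window (e n) k x)
      @[n --> \oo] -->
    \int[mu]_x ((- k ^+ 2) * (r x * sin (k * x)) - r2 x * sin (k * x)).
    apply: (@Rintegral_dominated_cvg _ _ _ (fun x => B * (`|r x| + `|r2 x|))).
    - move=> n; apply: measurable_funB; apply/measurable_EFinP.
        by case/integrableP: (iw2 n).
      by case/integrableP: (iw n).
    - apply: measurable_funB; last by apply/measurable_EFinP; case/integrableP: ir2.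
      apply: measurable_funM => //.
      by apply/measurable_EFinP; case/integrableP: ir.
    - move=> x; apply: cvg_near_cst; near=> n.
      have xn : `|e n * x| <= 2.
        rewrite normrM (gtr0_norm (e0 n)) /e ler_pdivrMl//.
        have : `|x| <= n%:R.
          apply: (@le_trans _ _ (Num.bound `|x|)%:R).
            by apply: ltW; exact: archi_boundP.
          by rewrite ler_nat; near: n; exact: nbhs_infty_ge.
        by rewrite -natr1; have := ler0n R n; lra.
      have [z0 z1 z2] := cutoff_near xn.
      by rewrite /sine_window2 /sine_window z0 z1 z2; ring.
    - have hs : mu.-integrable setT (fun x => (`|r x|%:E + `|r2 x|%:E)%E).
        by apply: integrableD => //; exact: integrable_norm.
      exact: (integrableZl measurableT B hs).
    - move=> n x; apply: le_trans (ler_normB _ _) _; rewrite !normrM mulrDr.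
      apply: lerD; rewrite mulrC; apply: ler_wpM2r => //.
      by rewrite -normrM; exact: le_trans (wB n x) CB.
  rewrite -(cvg_lim _ h)//; under eq_fun do rewrite zero.
  exact: lim_cst.
have irZ : mu.-integrable setT (EFin \o (fun x => (- k ^+ 2) * (r x * sin (k * x)))).
  exact: (integrableZl measurableT (- k ^+ 2) ir).
rewrite RintegralB// RintegralZl// in lim.
by move: lim; rewrite -/(sine_transform r k) -/(sine_transform r2 k) => lim; lra.
Unshelve. all: by end_near. Qed.

Lemma sine_transformB k :
  sine_transform (fun x => r x - r2 x) k = sine_transform r k - sine_transform r2 k.
Proof.
have csin := @continuous_sin_scaled R k.
rewrite /sine_transform -RintegralB//.
- by apply: eq_Rintegral => x _; rewrite mulrBl.
- exact: continuous_bounded_integrable ri csin (fun x => sin_max _).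
- exact: continuous_bounded_integrable r2i csin (fun x => sin_max _).
Qed.

(** (1 + k^2) times the transform of r is the transform of r - r2, to which the
Bessel inequality applies on every bounded interval. *)
Lemma weighted_sine_transform_bound :
  (\int[mu]_k (((1 + k ^+ 2) * sine_transform r k) ^+ 2)%:E <=
   (64 * pi)%:E * \int[mu]_x ((r x - r2 x) ^+ 2)%:E)%E.
Proof.
have qi : mu.-integrable setT (EFin \o (fun x => r x - r2 x)).
  by have := integrableB measurableT ri r2i.
have E k : (1 + k ^+ 2) * sine_transform r k = sine_transform (fun x => r x - r2 x) k.
  by rewrite sine_transformB mulrDl mul1r sine_transform_second_derivative.
under eq_integral do rewrite E.
apply: ge0_le_integral_itv.
- by apply: measurable_funX; exact: measurable_sine_transform.
- by move=> k; exact: sqr_ge0.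
move=> n; case: n => [|n].
  rewrite oppr0 set_itv1 integral_set1; apply: mule_ge0.
    by rewrite lee_fin; apply: mulr_ge0; [exact: ler0n|exact: pi_ge0].
  by apply: integral_ge0 => x _; rewrite lee_fin sqr_ge0.
have L0 : 0 < 2 * n.+1%:R :> R by rewrite mulr_gt0.
have := bessel_sine qi L0.
by rewrite mulrAC divff ?mul1r// pnatr_eq0.
Qed.

End second_derivative_transform.

(** * The Fourier transform of an odd function *)

Section fourier_of_odd.
Context {R : realType}.
Local Notation mu := (@lebesgue_measure R).
Implicit Types (k x : R).

Variable r : R -> R.
Hypotheses (ri : mu.-integrable setT (EFin \o r)) (cr : continuous r)
  (oddr : odd_fct r).

Let a : R := Num.sqrt (2 * pi).

Let a0 : 0 < a.
Proof. by rewrite sqrtr_gt0 mulr_gt0// pi_gt0. Qed.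

Let window (N : nat) : set R := `[- N%:R, N%:R].

Let truncated_sine N k := \int[mu]_(x in window N) (r x * sin (k * x)).

Lemma truncated_cosine0 (N : nat) k :
  \int[mu]_(x in `[- N%:R, N%:R]) (r x * cos (k * x)) = 0.
Proof.
pose G x := r x * cos (k * x).
have cG : continuous G by move=> x; apply: cvgM; [exact: cr|exact: continuous_cos_scaled].
have N0 : - N%:R <= N%:R :> R by rewrite ge0_cp// ler0n.
have := @integration_by_substitution_oppr R G (- N%:R) (N%:R) N0.
rewrite opprK => /(_ (continuous_subspaceT cG)) h.
have e : \int[mu]_(x in `[- N%:R, N%:R]) G x = \int[mu]_(x in `[- N%:R, N%:R]) (- G x).
  rewrite /Rintegral h; congr fine; apply: eq_integral => x _ /=.
  by rewrite /G oddr mulrN cosN mulNr.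
have iG : mu.-integrable `[- N%:R, N%:R] (EFin \o G) by exact: continuous_integrable_itv.
have e2 : \int[mu]_(x in `[- N%:R, N%:R]) (- G x) = - \int[mu]_(x in `[- N%:R, N%:R]) G x.
  under eq_Rintegral do rewrite -mulN1r.
  by rewrite RintegralZl// mulN1r.
have z (t : R) : t = - t -> t = 0.
  by move/eqP; rewrite -addr_eq0 -mulr2n mulrn_eq0 => /eqP.
exact: z (etrans e e2).
Qed.

Let restricted N : R -> R := r \_ (window N).

Let restricted_int N : mu.-integrable setT (EFin \o restricted N).
Proof.
rewrite /restricted /window -restrict_EFin; apply/integrable_restrict => //; rewrite setTI.
exact: continuous_integrable_itv.
Qed.

Let truncated_sineE N k : truncated_sine N k = sine_transform (restricted N) k.
Proof.
rewrite /truncated_sine /sine_transform Rintegral_mkcond; apply: eq_Rintegral => x _.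
by rewrite /restricted !patchE; case: ifPn => // _; rewrite mul0r.
Qed.

Let measurable_truncated N : measurable_fun setT (truncated_sine N).
Proof.
rewrite (_ : truncated_sine N = sine_transform (restricted N)).
  exact: measurable_sine_transform.
by apply/funext => k; exact: truncated_sineE.
Qed.

Let truncated_cvg k : truncated_sine N k @[N --> \oo] --> sine_transform r k.
Proof.
have mr : measurable_fun setT r by apply: continuous_measurable_fun.
have ms : measurable_fun setT (fun x => sin (k * x)).
  by apply: continuous_measurable_fun; exact: continuous_sin_scaled.
under eq_fun do rewrite truncated_sineE.
apply: (@Rintegral_dominated_cvg _ (fun N x => restricted N x * sin (k * x)) _ (fun x => `|r x|)).
- move=> N; apply: measurable_funM => //.
  by apply/measurable_EFinP; case/integrableP: (restricted_int N).
- exact: measurable_funM.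
- move=> x; apply: cvg_near_cst; near=> N.
  rewrite /restricted patchE ifT// inE /window/= in_itv/= -ler_norml.
  apply: (@le_trans _ _ (Num.bound `|x|)%:R); first by apply: ltW; exact: archi_boundP.
  by rewrite ler_nat; near: N; exact: nbhs_infty_ge.
- exact: integrable_norm.
- move=> N x; rewrite normrM -[leRHS]mulr1; apply: ler_pM => //; last exact: sin_max.
  by rewrite /restricted patchE; case: ifPn => // _; rewrite normr0.
Unshelve. all: by end_near. Qed.

Let truncated_fourierE N k : truncated_fourier r N k = (0 -i* (truncated_sine N k / a))%C.
Proof. by rewrite /truncated_fourier truncated_cosine0 mul0r. Qed.

Lemma normc_sqr (z : R[i]) : Normc.normc z ^+ 2 = complex.Re z ^+ 2 + complex.Im z ^+ 2.
Proof. by case: z => x y /=; rewrite sqr_sqrtr// addr_ge0 ?sqr_ge0. Qed.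

Section identification.
Variable h : R -> R[i].
Hypothesis hF : is_fourier r h.

Let mRe : measurable_fun setT (fun k => complex.Re (h k)).
Proof. by case: hF => /L2T[]. Qed.
Let mIm : measurable_fun setT (fun k => complex.Im (h k)).
Proof. by case: hF => _ /L2T[]. Qed.

Let defect N k := complex.Re (h k) ^+ 2 + (complex.Im (h k) + truncated_sine N k / a) ^+ 2.

Let defectE N k : Normc.normc (truncated_fourier r N k - h k)%R ^+ 2 = defect N k.
Proof.
rewrite normc_sqr truncated_fourierE /defect; case: (h k) => x y /=.
by ring.
Qed.

Let defect_cvg0 : (\int[mu]_k (defect N k)%:E)%E @[N --> \oo] --> 0%E.
Proof.
case: hF => _ _ h0.
have := cvge0_poweR2 (fun N => Lnorm_ge0 _ _ _) h0.
apply: cvg_trans; apply: near_eq_cvg; apply: nearW => N.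
by rewrite Lnorm2_sqr; apply: eq_integral => k _; rewrite defectE.
Qed.

(** The squared distance from h(k) to the expected value of the transform,
which is - i times the sine transform over the square root of 2 pi. *)
Let limit_defect k := complex.Re (h k) ^+ 2 + (complex.Im (h k) + sine_transform r k / a) ^+ 2.

Let mdefect N : measurable_fun setT (fun k => (defect N k)%:E).
Proof.
apply/measurable_EFinP; apply: measurable_funD; apply: measurable_funX => //.
by apply: measurable_funD => //; exact: measurable_funM.
Qed.

Let mlimit_defect : measurable_fun setT (fun k => (limit_defect k)%:E).
Proof.
apply/measurable_EFinP; apply: measurable_funD; apply: measurable_funX => //.
apply: measurable_funD => //; apply: measurable_funM => //.
exact: measurable_sine_transform.
Qed.

(** The truncated transforms converge pointwise to the sine transform, since r
is integrable, and to h in L^2: by Fatou's lemma the two limits agree. *)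
Let limit_defect0 : (\int[mu]_k (limit_defect k)%:E = 0)%E.
Proof.
apply/eqP; rewrite eq_le integral_ge0 ?andbT; last first.
  by move=> k _; rewrite lee_fin addr_ge0 ?sqr_ge0.
have E k : limn_einf (fun N => (defect N k)%:E) = (limit_defect k)%:E.
  apply: (cvg_limn_einf_sup _).1; apply/fine_cvgP; split; first exact: nearW.
  apply: cvgD; first exact: cvg_cst.
  under eq_fun do rewrite expr2.
  have c : complex.Im (h k) + truncated_sine N k / a @[N --> \oo] -->
      complex.Im (h k) + sine_transform r k / a.
    by apply: cvgD; [exact: cvg_cst|apply: cvgMr_tmp; exact: truncated_cvg].
  by rewrite expr2; apply: cvgM.
have -> : (\int[mu]_k (limit_defect k)%:E =
    \int[mu]_k limn_einf (fun N => (defect N k)%:E))%E.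
  by apply: eq_integral => k _; rewrite E.
rewrite -(cvg_limn_einf_sup defect_cvg0).1.
apply: (fatou mu measurableT mdefect) => N k _.
by rewrite lee_fin addr_ge0 ?sqr_ge0.
Qed.

Lemma fourier_modulus :
  {ae mu, forall k, Normc.normc (h k) ^+ 2 = (sine_transform r k / a) ^+ 2}.
Proof.
have ld0 k : 0 <= limit_defect k by rewrite addr_ge0 ?sqr_ge0.
have : ae_eq mu setT (fun k => (limit_defect k)%:E) (cst 0%E).
  apply/(ae_eq_integral_abs mu measurableT mlimit_defect).
  by under eq_integral do rewrite gee0_abs ?lee_fin//.
apply: filterS => k /(_ I)/= /eqP; rewrite eqe.
rewrite /limit_defect paddr_eq0 ?sqr_ge0// !sqrf_eq0 => /andP[/eqP e1 /eqP e2].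
rewrite normc_sqr e1 expr0n add0r.
by move/eqP: e2; rewrite addr_eq0 => /eqP ->; rewrite sqrrN.
Qed.

End identification.

(** Either [fourier r] is a transform, and its modulus is given almost
everywhere by [fourier_modulus], or it is the default value 0, for which the
bound is trivial. *)
Lemma H2norm_sine_transform : measurable_fun setT (H2_weighted_fourier r) /\
  (\int[mu]_k (H2_weighted_fourier r k ^+ 2)%:E <=
   (2 * pi)^-1%:E * \int[mu]_k (((1 + k ^+ 2) * sine_transform r k) ^+ 2)%:E)%E.
Proof.
have c0 : (0 <= (2 * pi)^-1%:E :> \bar R)%E.
  by rewrite lee_fin invr_ge0 mulr_ge0// pi_ge0.
have mpoly : measurable_fun setT (fun k : R => 1 + k ^+ 2).
  by apply: measurable_funD => //; exact: measurable_funX.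
rewrite /H2_weighted_fourier /fourier; case: xgetP => [h _ hF|_]; last first.
  split.
    apply: measurable_funM => //; exact: measurable_cst.
  have n0 : Normc.normc (0 : R[i]) = 0 by rewrite /= expr0n/= addr0 sqrtr0.
  rewrite (_ : (fun k => (((1 + k ^+ 2) * Normc.normc (0 : R[i])) ^+ 2)%:E) = cst 0%E).
    rewrite integral_cst// mul0e; apply: mule_ge0 => //; apply: integral_ge0 => k _.
    by rewrite lee_fin sqr_ge0.
  by apply/funext => k; rewrite n0 mulr0 expr0n.
have [Re_h Im_h _] := hF.
have mnorm : measurable_fun setT (fun k => Normc.normc (h k)).
  rewrite (_ : (fun k => _) =
    (fun k => Num.sqrt (complex.Re (h k) ^+ 2 + complex.Im (h k) ^+ 2))); last first.
    by apply/funext => k; case: (h k).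
  have msqrt : measurable_fun setT (@Num.sqrt R).
    by apply: continuous_measurable_fun; exact: sqrt_continuous.
  apply: (measurableT_comp msqrt).
  by apply: measurable_funD; apply: measurable_funX; [case/L2T: Re_h|case/L2T: Im_h].
split; first exact: measurable_funM.
have mS := measurable_sine_transform ri.
have mw : measurable_fun setT (fun k => (((1 + k ^+ 2) * sine_transform r k) ^+ 2)%:E).
  by apply/measurable_EFinP; apply: measurable_funX; exact: measurable_funM.
rewrite -ge0_integralZl//; last by move=> k _; rewrite lee_fin sqr_ge0.
rewrite le_eqVlt; apply/orP; left; apply/eqP; apply: ae_eq_integral => //.
- by apply/measurable_EFinP; apply: measurable_funX; exact: measurable_funM.
- exact: measurable_funeM.
move: (fourier_modulus hF).
apply: (@filterS _ _ (ae_filter_ringOfSetsType mu)) => k hk _.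
rewrite -EFinM; congr (_%:E).
rewrite exprMn hk exprMn exprVn sqr_sqrtr ?mulr_ge0 ?pi_ge0// exprMn.
by ring.
Qed.

End fourier_of_odd.

Section H2_bound.
Context {R : realType}.
Local Notation mu := (@lebesgue_measure R).

(** 32 is 64 pi divided by the factor 2 pi of the unitary normalisation. *)
Lemma H2norm_second_derivative (r r2 : R -> R) :
  mu.-integrable setT (EFin \o r) -> mu.-integrable setT (EFin \o r2) ->
  continuous r -> odd_fct r -> weak_second_derivative r r2 ->
  measurable_fun setT (H2_weighted_fourier r) /\
  (\int[mu]_k (H2_weighted_fourier r k ^+ 2)%:E <=
   32%:E * \int[mu]_x ((r x - r2 x) ^+ 2)%:E)%E.
Proof.
move=> ri r2i cr oddr weak.
have [mw h] := H2norm_sine_transform ri cr oddr; split => //.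
apply: le_trans h _.
have pi2 : 0 < 2 * pi :> R by rewrite mulr_gt0// pi_gt0.
have -> : 32%:E = ((2 * pi)^-1%:E * (64 * pi)%:E)%E :> \bar R.
  rewrite -EFinM; congr (_%:E).
  have pn : pi != 0 :> R by rewrite gt_eqF ?pi_gt0.
  by move: (pi : R) pn => p pn; field.
rewrite -muleA; apply: lee_wpmul2l; first by rewrite lee_fin invr_ge0 ltW.
exact: weighted_sine_transform_bound.
Qed.

End H2_bound.

(** * Integration by parts across the origin *)

Section piecewise_integration_by_parts.
Context {R : realType}.
Local Notation mu := (@lebesgue_measure R).
Implicit Types (f g h : R -> R) (a b x M : R).

Lemma within_continuous_itv f a b : (forall x, a <= x <= b -> {for x, continuous f}) ->
  {within `[a, b], continuous f}.
Proof.
move=> cf; apply: continuous_in_subspaceT => x; rewrite inE/= in_itv/=.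
exact: cf.
Qed.

Lemma within_continuous_integrable f a b :
  (forall x, a <= x <= b -> {for x, continuous f}) ->
  mu.-integrable `[a, b] (EFin \o f).
Proof.
move=> cf; apply: continuous_compact_integrable; first exact: segment_compact.
exact: within_continuous_itv.
Qed.

Lemma is_derive_LRcontinuous f f1 a b :
  (forall x, a <= x <= b -> is_derive x 1 f (f1 x)) -> a < b ->
  derivable_oo_LRcontinuous f a b.
Proof.
move=> df ab; split.
- move=> x; rewrite in_itv/= => /andP[ax xb].
  by have [] : is_derive x 1 f (f1 x) by apply: df; rewrite !ltW.
- by apply: cvg_at_right_filter; apply: is_derive_cvg (df a _); rewrite lexx ltW.
- by apply: cvg_at_left_filter; apply: is_derive_cvg (df b _); rewrite lexx ltW.
Qed.

Lemma integration_by_parts_itv f f1 g g1 a b : a < b ->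
  (forall x, a <= x <= b -> is_derive x 1 f (f1 x)) ->
  (forall x, a <= x <= b -> {for x, continuous f1}) ->
  (forall x, a <= x <= b -> is_derive x 1 g (g1 x)) ->
  (forall x, a <= x <= b -> {for x, continuous g1}) ->
  \int[mu]_(x in `[a, b]) (f x * g1 x) =
  (f b * g b - f a * g a) - \int[mu]_(x in `[a, b]) (f1 x * g x).
Proof.
move=> ab df cf1 dg cg1; apply: Rintegration_by_parts => //.
- exact: within_continuous_itv.
- exact: is_derive_LRcontinuous df ab.
- move=> x; rewrite in_itv/= => /andP[ax xb]; rewrite derive1E.
  by have [_ ->] : is_derive x 1 f (f1 x) by apply: df; rewrite !ltW.
- exact: within_continuous_itv.
- exact: is_derive_LRcontinuous dg ab.
- move=> x; rewrite in_itv/= => /andP[ax xb]; rewrite derive1E.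
  by have [_ ->] : is_derive x 1 g (g1 x) by apply: dg; rewrite !ltW.
Qed.

Lemma is_derive_unique f x a b : is_derive x 1 f a -> is_derive x 1 f b -> a = b.
Proof. by move=> [_ <-] [_ <-]. Qed.

Lemma derivative_support g g1 M : (forall x, is_derive x 1 g (g1 x)) ->
  (forall x, M <= `|x| -> g x = 0) -> forall x, M < `|x| -> g1 x = 0.
Proof.
move=> dg g0 x Mx; apply: is_derive_unique (dg x) _.
have h : is_derive x 1 (fun=> 0 : R) 0 by exact: is_derive_const.
apply: (near_eq_is_derive _ h).
near=> y; rewrite g0//; near: y.
have : (fun y : R => `|y|) @ x --> `|x| by exact: norm_continuous.
by move=> /cvgrPdist_lt /(_ (`|x| - M)); rewrite subr_gt0 => /(_ Mx);
  apply: filterS => y /=; rewrite ltr_norml => /andP[_]; lra.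
Unshelve. all: by end_near. Qed.

Lemma Rintegral_support h (D : set R) : (forall x, ~ D x -> h x = 0) ->
  \int[mu]_x h x = \int[mu]_(x in D) h x.
Proof.
move=> h0; rewrite [RHS]Rintegral_mkcond; congr (Rintegral _ _ _); apply/funext => x.
by rewrite patchE; case: ifPn => // /negP xD; apply: h0 => Dx; apply: xD; rewrite inE.
Qed.

Lemma Rintegral_split0 h hm hp M : 0 < M -> measurable_fun setT h ->
  (forall x, M < `|x| -> h x = 0) ->
  (forall x, 0 < x -> h x = hp x) -> (forall x, x < 0 -> h x = hm x) ->
  (forall x, 0 <= x <= M -> {for x, continuous hp}) ->
  (forall x, - M <= x <= 0 -> {for x, continuous hm}) ->
  \int[mu]_x h x = \int[mu]_(x in `[- M, 0]) hm x + \int[mu]_(x in `[0, M]) hp x.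
Proof.
move=> M0 mh h0 hhp hhm cp cm.
have ip := within_continuous_integrable cp.
have im := within_continuous_integrable cm.
have im' : mu.-integrable `[- M, 0[ (EFin \o hm).
  by apply: integrableS im => //; apply: subset_itvl; rewrite bnd_simp.
rewrite -(Rintegral_itv_bndo_bndc im').
rewrite [X in X + _]Rintegral_mkcond [X in _ + X]Rintegral_mkcond.
have ip2 : mu.-integrable setT (EFin \o (hp \_ `[0, M])).
  by rewrite -restrict_EFin; apply/integrable_restrict => //; rewrite setTI.
have im2 : mu.-integrable setT (EFin \o (hm \_ `[- M, 0[)).
  by rewrite -restrict_EFin; apply/integrable_restrict => //; rewrite setTI.
rewrite -RintegralD//; congr fine; apply: ae_eq_integral => //.
- exact/measurable_EFinP.
- apply/measurable_EFinP; apply: measurable_funD; apply/measurable_EFinP.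
    by case/integrableP: im2.
  by case/integrableP: ip2.
exists [set 0]; split; first exact: measurable_set1.
  exact: lebesgue_measure_set1.
move=> x /=; apply: contra_notP => /eqP x0 _.
congr (_%:E); rewrite !patchE !mem_setE !in_itv/=.
have [x_gt0|x_lt0|x_eq0] := ltgtP x 0; last by rewrite x_eq0 eqxx in x0.
- rewrite /= ?andbF ?andbT ?addr0.
  case: ifPn => [_|]; first exact: hhm.
  rewrite -ltNge => xM; apply: h0; rewrite ltr0_norm//; lra.
- rewrite /= ?andbF ?andbT ?add0r.
  case: ifPn => [_|]; first exact: hhp.
  by rewrite -ltNge => xM; apply: h0; rewrite gtr0_norm.
Qed.

Section piecewise.
Variables (f f1 fm fm1 fp fp1 : R -> R).
Hypotheses (mf : measurable_fun setT f) (mf1 : measurable_fun setT f1)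
  (dfp : forall x, 0 <= x -> is_derive x 1 fp (fp1 x))
  (cfp : forall x, 0 <= x -> {for x, continuous fp1})
  (dfm : forall x, x <= 0 -> is_derive x 1 fm (fm1 x))
  (cfm : forall x, x <= 0 -> {for x, continuous fm1})
  (f_p : forall x, 0 < x -> f x = fp x /\ f1 x = fp1 x)
  (f_m : forall x, x < 0 -> f x = fm x /\ f1 x = fm1 x).

(** The functions f and f1 are given by C^1 branches on the two half lines. The
boundary terms at the origin cancel if f has no jump there or if the test
function vanishes there. *)
Lemma integration_by_parts_piecewise g g1 :
  (forall x, is_derive x 1 g (g1 x)) -> continuous g1 ->
  (exists M, forall x, M <= `|x| -> g x = 0) -> (fp 0 - fm 0) * g 0 = 0 ->
  \int[mu]_x (f x * g1 x) = - \int[mu]_x (f1 x * g x).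
Proof.
move=> dg cg1 [M0 gM0] jump.
pose M := Num.max M0 0 + 1.
have M_gt0 : 0 < M by rewrite ltr_wpDl// le_max lexx orbT.
have MM0 : M0 <= M.
  by apply: (@le_trans _ _ (Num.max M0 0)); rewrite ?le_max ?lexx// lerDl.
have gM x : M <= `|x| -> g x = 0 by move=> Mx; apply: gM0; exact: le_trans Mx.
have g1M := derivative_support dg gM.
have cg : continuous g by move=> x; exact: is_derive_cvg (dg x).
rewrite (@Rintegral_split0 (fun x => f x * g1 x) (fun x => fm x * g1 x) (fun x => fp x * g1 x) M)//.
- rewrite (@Rintegral_split0 (fun x => f1 x * g x) (fun x => fm1 x * g x) (fun x => fp1 x * g x) M)//.
  + have NM0 : - M < 0 by rewrite oppr_lt0.
    have dfm' x : - M <= x <= 0 -> is_derive x 1 fm (fm1 x).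
      by move=> /andP[_ x0]; exact: dfm.
    have dfp' x : 0 <= x <= M -> is_derive x 1 fp (fp1 x).
      by move=> /andP[x0 _]; exact: dfp.
    have cfm' x : - M <= x <= 0 -> {for x, continuous fm1}.
      by move=> /andP[_ x0]; exact: cfm.
    have cfp' x : 0 <= x <= M -> {for x, continuous fp1}.
      by move=> /andP[x0 _]; exact: cfp.
    rewrite (integration_by_parts_itv NM0 dfm' cfm' (fun x _ => dg x) (fun x _ => cg1 x)).
    rewrite (integration_by_parts_itv M_gt0 dfp' cfp' (fun x _ => dg x) (fun x _ => cg1 x)).
    have gp : g M = 0 by apply: gM; rewrite ger0_norm// ltW.
    have gm : g (- M) = 0 by apply: gM; rewrite normrN ger0_norm// ltW.
    rewrite gp gm.
    by move: jump; lra.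
  + by apply: measurable_funM => //; exact: continuous_measurable_fun.
  + by move=> x Mx; rewrite gM ?mulr0// ltW.
  + by move=> x x0; have [_ ->] := f_p x0.
  + by move=> x x0; have [_ ->] := f_m x0.
  + by move=> x /andP[x0 _]; apply: cvgM; [exact: cfp|exact: cg].
  + by move=> x /andP[_ x0]; apply: cvgM; [exact: cfm|exact: cg].
- by apply: measurable_funM => //; exact: continuous_measurable_fun.
- by move=> x Mx; rewrite g1M ?mulr0.
- by move=> x x0; have [-> _] := f_p x0.
- by move=> x x0; have [-> _] := f_m x0.
- by move=> x /andP[x0 _]; apply: cvgM; [exact: is_derive_cvg (dfp x0)|exact: cg1].
- by move=> x /andP[_ x0]; apply: cvgM; [exact: is_derive_cvg (dfm x0)|exact: cg1].
Qed.

End piecewise.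
End piecewise_integration_by_parts.

(** * Local integrability and weak derivatives *)

Section local_integrability.
Context {R : realType}.
Local Notation mu := (@lebesgue_measure R).
Implicit Types (f g h phi : R -> R) (K D : set R) (x M : R).

Lemma compact_sub_itv K : compact K -> exists M, K `<=` `[- M, M].
Proof.
move=> cK; have [M [_ MK]] := compact_bounded cK.
exists (M + 1) => x Kx /=; rewrite in_itv/= -ler_norml.
by apply: MK => //; rewrite ltrDl.
Qed.

Lemma continuous_integrable_compact g K : continuous g -> compact K ->
  mu.-integrable K (EFin \o g).
Proof.
move=> cg cK; apply: continuous_compact_integrable => //.
exact: continuous_subspaceT.
Qed.

Lemma dominated_locally_integrable f g : measurable_fun setT f -> continuous g ->
  (forall x, `|f x| <= g x) -> locally_integrable setT f.
Proof.
move=> mf cg fg; split => //; first exact: openT.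
move=> K _ cK; have mK := compact_measurable cK.
have /integrableP[_] := continuous_integrable_compact cg cK.
apply: le_lt_trans; apply: ge0_le_integral => //=.
- apply/measurable_EFinP; apply: measurableT_comp => //; exact: measurable_funTS.
- apply/measurable_EFinP; apply: measurableT_comp => //; apply: measurable_funTS.
  exact: continuous_measurable_fun.
- by move=> x _; rewrite lee_fin (le_trans (fg x))// ler_norm.
Qed.

Lemma measurable_restricted f K : measurable K -> measurable_fun setT f ->
  measurable_fun setT (f \_ K).
Proof.
move=> mK mf; have := measurable_restrictT f mK; case=> + _; apply.
exact: measurable_funTS.
Qed.

Lemma dominated_L2loc f g : measurable_fun setT f -> continuous g ->
  (forall x, `|f x| <= g x) -> L2loc f.
Proof.
move=> mf cg fg K cK; have mK := compact_measurable cK.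
apply/L2_restrict/L2T; split; first exact: measurable_restricted.
have cg2 : continuous (fun x => g x ^+ 2).
  by move=> x; under eq_fun do rewrite expr2; apply: cvgM; exact: cg.
have /integrableP[_] := continuous_integrable_compact cg2 cK.
apply: le_lt_trans.
rewrite [leRHS]integral_mkcond; apply: ge0_le_integral => //.
- by move=> x _; rewrite lee_fin sqr_ge0.
- apply/measurable_EFinP; apply: measurable_funX.
  exact: measurable_restricted.
- have mg2 : measurable_fun setT (fun x => `|g x ^+ 2|).
    by apply: measurableT_comp => //; exact: continuous_measurable_fun.
  have := measurable_restricted mK mg2 => /measurable_EFinP.
  by rewrite restrict_EFin.
- move=> x _; rewrite !patchE; case: ifPn => _; last by rewrite expr0n.
  rewrite lee_fin ger0_norm ?sqr_ge0// -[leLHS]real_normK ?num_real//.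
  by rewrite ler_sqr ?nnegrE// (le_trans _ (fg x)).
Qed.

Lemma locally_integrable_restrict f D K : locally_integrable D f -> compact K ->
  K `<=` D -> mu.-integrable setT (EFin \o (f \_ K)).
Proof.
move=> [mf oD fi] cK KD; have mK := compact_measurable cK.
rewrite -restrict_EFin; apply/integrable_restrict => //; rewrite setTI.
apply/integrableP; split; last exact: fi.
apply/measurable_EFinP; apply: (measurable_funS _ KD mf); exact: open_measurable.
Qed.

Lemma integrable_mul_compact_support f g M : locally_integrable setT f ->
  continuous g -> (forall x, M < `|x| -> g x = 0) ->
  mu.-integrable setT (EFin \o (fun x => f x * g x)).
Proof.
move=> fl cg g0; pose K : set R := `[- M, M].
have cK : compact K by exact: segment_compact.
have fK := locally_integrable_restrict fl cK (subsetT K).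
have [C gC] : exists C, forall x, `|g x| <= C.
  have [C CP] := compact_bounded (continuous_compact (continuous_subspaceT cg) cK).
  exists (Num.max 0 (C + 1)) => x; have [xM|xM] := leP `|x| M; last first.
    by rewrite g0// normr0 le_max lexx.
  rewrite le_max; apply/orP; right.
  case: CP => Cr CP; apply: (CP (C + 1)); first by rewrite ltrDl.
  by exists x => //=; rewrite /K/= in_itv/= -ler_norml.
have mg : measurable_fun setT g by exact: continuous_measurable_fun.
have := integrable_mul_bounded fK mg gC.
apply: eq_integrable => // x _ /=; congr (_%:E).
rewrite patchE; case: ifPn => // xK.
rewrite g0 ?mulr0// ltNge; apply: contra xK => xM.
by rewrite inE/K/= in_itv/= -ler_norml.
Qed.

Lemma measurable_sg : measurable_fun setT (@Num.sg R).
Proof.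
rewrite (_ : @Num.sg R = (fun x => if x == 0 then 0 else if x < 0 then -1 else 1)).
  apply: measurable_fun_ifT => //; first exact: measurable_fun_eqr.
  by apply: measurable_fun_ifT => //; exact: measurable_fun_ltr.
by apply/funext => x; case: sgrP.
Qed.

Lemma norm_sg_le (x y : R) : `|Num.sg x * y| <= `|y|.
Proof. by rewrite normrM ler_piMl// normr_sg; case: (x != 0). Qed.

End local_integrability.

Section weak_derivatives.
Context {R : realType}.
Local Notation mu := (@lebesgue_measure R).
Implicit Types (f g h phi : R -> R) (K D : set R) (x M : R).

Lemma weak_derivativeP D f g phi phi1 K : weak_derivative D f g ->
  (forall x, is_derive x 1 phi (phi1 x)) -> continuous phi1 ->
  compact K -> K `<=` D -> (forall x, ~ K x -> phi x = 0) ->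
  \int[mu]_(x in D) (f x * phi1 x) = - \int[mu]_(x in D) (g x * phi x).
Proof.
move=> [_ _ fg] dphi cphi1 cK KD phi0.
have e : phi^`()%classic = phi1.
  by apply/funext => x; rewrite derive1E; have [_ ->] := dphi x.
rewrite -fg; last by exists K.
  by rewrite e.
by split; [move=> x; have [] := dphi x|rewrite e].
Qed.

(** In this form test functions come with an explicit derivative and a bound
for the support. *)
Lemma weak_derivativeTP f g phi phi1 : weak_derivative setT f g ->
  (forall x, is_derive x 1 phi (phi1 x)) -> continuous phi1 ->
  (exists M, forall x, M <= `|x| -> phi x = 0) ->
  \int[mu]_x (f x * phi1 x) = - \int[mu]_x (g x * phi x).
Proof.
move=> fg dphi cphi1 [M phi0].
apply: (@weak_derivativeP _ _ _ _ _ `[- M, M]) fg dphi cphi1 _ _ _ => //.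
  exact: segment_compact.
move=> x /negP; rewrite /= in_itv/= -ler_norml -ltNge => /ltW; exact: phi0.
Qed.

Lemma weak_derivativeTI f g : locally_integrable setT f -> locally_integrable setT g ->
  (forall phi phi1, (forall x, is_derive x 1 phi (phi1 x)) -> continuous phi1 ->
    (exists M, forall x, M <= `|x| -> phi x = 0) ->
    \int[mu]_x (f x * phi1 x) = - \int[mu]_x (g x * phi x)) ->
  weak_derivative setT f g.
Proof.
move=> fl gl H; split => // phi [dphi cphi] [K [cK _ phi0]].
apply: H => //.
  by move=> x; apply: DeriveDef; [exact: dphi|rewrite derive1E].
have [M KM] := compact_sub_itv cK; exists (M + 1) => x Mx; apply: phi0 => /KM.
by rewrite /= in_itv/= -ler_norml => xM; lra.
Qed.

Lemma weak_derivativeD f1 f2 g1 g2 : weak_derivative setT f1 g1 ->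
  weak_derivative setT f2 g2 ->
  weak_derivative setT (fun x => f1 x + f2 x) (fun x => g1 x + g2 x).
Proof.
move=> w1 w2; have [f1l g1l _] := w1; have [f2l g2l _] := w2.
apply: weak_derivativeTI.
- exact: (locally_integrableD f1l f2l).
- exact: (locally_integrableD g1l g2l).
move=> phi phi1 dphi cphi1 [M phi0].
have cphi : continuous phi by move=> x; exact: is_derive_cvg (dphi x).
have phi0' x : M < `|x| -> phi x = 0 by move=> /ltW; exact: phi0.
have phi10 := derivative_support dphi phi0.
under eq_Rintegral do rewrite mulrDl.
under [in RHS]eq_Rintegral do rewrite mulrDl.
have i1 := integrable_mul_compact_support f1l cphi1 phi10.
have i2 := integrable_mul_compact_support f2l cphi1 phi10.
have j1 := integrable_mul_compact_support g1l cphi phi0'.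
have j2 := integrable_mul_compact_support g2l cphi phi0'.
rewrite (RintegralD measurableT i1 i2) (RintegralD measurableT j1 j2).
rewrite (weak_derivativeTP w1 dphi cphi1) ?(weak_derivativeTP w2 dphi cphi1); [|by exists M..].
by rewrite opprD.
Qed.

Lemma L2locD f g : L2loc f -> L2loc g -> L2loc (fun x => f x + g x).
Proof.
move=> fl gl K cK.
have /L2_restrict/L2T[mf If] := fl K cK; have /L2_restrict/L2T[mg Ig] := gl K cK.
apply/L2_restrict/L2T.
have -> : (fun x => f x + g x) \_ K = (fun x => (f \_ K) x + (g \_ K) x).
  by apply/funext => x; rewrite !patchE; case: ifPn => // _; rewrite addr0.
split; first exact: measurable_funD.
have mf2 : measurable_fun setT (fun x => ((f \_ K) x ^+ 2)%:E).
  by apply/measurable_EFinP; exact: measurable_funX.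
have mg2 : measurable_fun setT (fun x => ((g \_ K) x ^+ 2)%:E).
  by apply/measurable_EFinP; exact: measurable_funX.
apply: (@le_lt_trans _ _ (2%:E * (\int[mu]_x ((f \_ K) x ^+ 2)%:E +
    \int[mu]_x ((g \_ K) x ^+ 2)%:E))%E).
  rewrite -ge0_integralD//; last 2 first.
  - by move=> x _; rewrite lee_fin sqr_ge0.
  - by move=> x _; rewrite lee_fin sqr_ge0.
  rewrite -ge0_integralZl//; last 2 first.
  - exact: emeasurable_funD.
  - by move=> x _; rewrite -EFinD lee_fin addr_ge0 ?sqr_ge0.
  apply: ge0_le_integral => //.
  - by move=> x _; rewrite lee_fin sqr_ge0.
  - by apply/measurable_EFinP; apply: measurable_funX; exact: measurable_funD.
  - by apply: measurable_funeM; exact: emeasurable_funD.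
  move=> x _; rewrite -EFinD -EFinM lee_fin.
  have := sqr_ge0 ((f \_ K) x - (g \_ K) x); nra.
by apply: lte_mul_pinfty => //; exact: lte_add_pinfty.
Qed.

Lemma H2loc_withD u u1 u2 v v1 v2 : H2loc_with u u1 u2 -> H2loc_with v v1 v2 ->
  H2loc_with (fun x => u x + v x) (fun x => u1 x + v1 x) (fun x => u2 x + v2 x).
Proof.
move=> [cu Lu [Lu1 Lu2] wu wu1] [cv Lv [Lv1 Lv2] wv wv1]; split.
- by move=> x; apply: cvgD; [exact: cu|exact: cv].
- exact: L2locD.
- by split; exact: L2locD.
- exact: weak_derivativeD.
- exact: weak_derivativeD.
Qed.

End weak_derivatives.

(** * Odd extensions in the local Sobolev space *)

Section odd_extension_H2loc.
Context {R : realType}.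
Local Notation mu := (@lebesgue_measure R).
Implicit Types (x : R) (phi : R -> R).

Variables (Q Q1 Q2 : R -> R).
Hypotheses (Q0 : Q 0 = 0) (dQ : forall x, 0 <= x -> is_derive x 1 Q (Q1 x))
  (dQ1 : forall x, 0 <= x -> is_derive x 1 Q1 (Q2 x))
  (cQ2 : forall x, 0 <= x -> {for x, continuous Q2}).

Let q := odd_extension Q.
Let q1 (x : R) := Q1 `|x|.
Let q2 := odd_extension Q2.

Let cq : continuous q.
Proof. by apply: continuous_odd_extension => // x x0; exact: is_derive_cvg (dQ x0). Qed.

Let cq1 : continuous q1.
Proof. by apply: continuous_even_extension => x x0; exact: is_derive_cvg (dQ1 x0). Qed.

Let cabs2 : continuous (fun x : R => Q2 `|x|).
Proof. exact: continuous_even_extension. Qed.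

Let mq2 : measurable_fun setT q2.
Proof.
apply: measurable_funM; first exact: measurable_sg.
exact: continuous_measurable_fun.
Qed.

Let is_derive_reflect (f f1 : R -> R) (x : R) :
  (forall x, 0 <= x -> is_derive x 1 f (f1 x)) -> x <= 0 ->
  is_derive x 1 (fun y => f (- y)) (- f1 (- x)).
Proof.
move=> df x0; have d : is_derive (- x) 1 f (f1 (- x)) by apply: df; rewrite oppr_ge0.
have dN : is_derive x 1 (fun y : R => - y) (-1) by derive.
by apply: is_derive_eq (is_derive_comp dN d) _; rewrite mulrN1.
Qed.

Let continuous_reflect (f : R -> R) (x : R) :
  (forall x, 0 <= x -> {for x, continuous f}) -> x <= 0 ->
  {for x, continuous (fun y => f (- y))}.
Proof.
move=> cf x0; apply: (@cvg_comp _ _ _ (fun y : R => - y) f (nbhs x) (nbhs (- x))).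
  exact: opp_continuous.
by apply: cf; rewrite oppr_ge0.
Qed.

(** No jump at the origin because Q(0) = 0. *)
Lemma odd_extension_derivative phi phi1 :
  (forall x, is_derive x 1 phi (phi1 x)) -> continuous phi1 ->
  (exists M, forall x : R, M <= `|x| -> phi x = 0) ->
  \int[mu]_x (odd_extension Q x * phi1 x) = - \int[mu]_x (Q1 `|x| * phi x).
Proof.
move=> dphi cphi1 phi0.
apply: (@integration_by_parts_piecewise _ q q1 (fun x => - Q (- x)) (fun x => Q1 (- x)) Q Q1) => //.
- exact: continuous_measurable_fun.
- exact: continuous_measurable_fun.
- by move=> x x0; exact: is_derive_cvg (dQ1 x0).
- move=> x x0; rewrite -[Q1 (- x)]opprK; apply: is_derive_opp.
  exact: is_derive_reflect.
- move=> x x0; apply: continuous_reflect => // y y0; exact: is_derive_cvg (dQ1 y0).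
- by move=> x x0; rewrite /q /q1 odd_extensionE// gtr0_norm.
- by move=> x x0; rewrite /q /q1 /odd_extension ltr0_sg// mulN1r ltr0_norm.
- by rewrite oppr0 Q0 oppr0 subrr mul0r.
Qed.

(** No jump at the origin because the extension is even. *)
Lemma even_extension_derivative phi phi1 :
  (forall x, is_derive x 1 phi (phi1 x)) -> continuous phi1 ->
  (exists M, forall x : R, M <= `|x| -> phi x = 0) ->
  \int[mu]_x (Q1 `|x| * phi1 x) = - \int[mu]_x (odd_extension Q2 x * phi x).
Proof.
move=> dphi cphi1 phi0.
apply: (@integration_by_parts_piecewise _ q1 q2 (fun x => Q1 (- x)) (fun x => - Q2 (- x)) Q1 Q2) => //.
- exact: continuous_measurable_fun.
- by move=> x x0; exact: is_derive_reflect.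
- move=> x x0; apply: cvgN; exact: continuous_reflect.
- by move=> x x0; rewrite /q2 /q1 odd_extensionE// gtr0_norm.
- by move=> x x0; rewrite /q2 /q1 /odd_extension ltr0_sg// mulN1r ltr0_norm.
- by rewrite oppr0 subrr mul0r.
Qed.

Let dom_self (f : R -> R) : continuous f ->
  [/\ measurable_fun setT f, continuous (fun x => `|f x|) &
      forall x, `|f x| <= `|f x| ].
Proof.
move=> cf; split => //; first exact: continuous_measurable_fun.
by move=> x; apply: cvg_norm; exact: cf.
Qed.

Lemma H2loc_odd_extension :
  H2loc_with (odd_extension Q) (fun x => Q1 `|x|) (odd_extension Q2).
Proof.
have [mq cqn qn] := dom_self cq; have [mq1 cqn1 qn1] := dom_self cq1.
have [_ cqn2 _] := dom_self cabs2.
have qn2 x : `|q2 x| <= `|Q2 `|x| | by exact: norm_sg_le.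
split.
- exact: cq.
- exact: dominated_L2loc mq cqn qn.
- by split; [exact: dominated_L2loc mq1 cqn1 qn1|exact: dominated_L2loc mq2 cqn2 qn2].
- apply: weak_derivativeTI odd_extension_derivative.
    exact: dominated_locally_integrable mq cqn qn.
  exact: dominated_locally_integrable mq1 cqn1 qn1.
- apply: weak_derivativeTI even_extension_derivative.
    exact: dominated_locally_integrable mq1 cqn1 qn1.
  exact: dominated_locally_integrable mq2 cqn2 qn2.
Qed.

End odd_extension_H2loc.

(** * Functions both integrable and square integrable *)

Section integrable_and_square_integrable.
Context {R : realType}.
Local Notation mu := (@lebesgue_measure R).
Implicit Types (f g : R -> R) (x a c : R) (D K : set R).

(** The class in which the sine transform is an absolutely convergent integral
and the Bessel inequality has content. *)
Definition L1L2 f := mu.-integrable setT (EFin \o f) /\ (\int[mu]_x (f x ^+ 2)%:E < +oo)%E.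

Lemma L1L2_measurable f : L1L2 f -> measurable_fun setT f.
Proof. by case=> /integrableP[/measurable_EFinP]. Qed.

Lemma L1L2_dominated f g : measurable_fun setT f -> (forall x, `|f x| <= g x) ->
  L1L2 g -> L1L2 f.
Proof.
move=> mf fg [gi g2]; split.
  apply: le_integrable gi => //; first exact/measurable_EFinP.
  by move=> x _ /=; rewrite lee_fin (le_trans (fg x))// ler_norm.
apply: le_lt_trans g2; apply: ge0_le_integral => //.
- by move=> x _; rewrite lee_fin sqr_ge0.
- by apply/measurable_EFinP; exact: measurable_funX.
- apply/measurable_EFinP; apply: measurable_funX.
  by apply/measurable_EFinP; case/integrableP: gi.
- move=> x _; rewrite lee_fin -[leLHS]real_normK ?num_real//.
  by rewrite ler_sqr ?nnegrE// (le_trans _ (fg x)).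
Qed.

Lemma L1L2Z c f : L1L2 f -> L1L2 (fun x => c * f x).
Proof.
move=> Lf; have mf := L1L2_measurable Lf; case: Lf => fi f2; split.
  exact: (integrableZl measurableT c fi).
have -> : (\int[mu]_x ((c * f x) ^+ 2)%:E = (c ^+ 2)%:E * \int[mu]_x (f x ^+ 2)%:E)%E.
  rewrite -ge0_integralZl//.
  - by apply: eq_integral => x _; rewrite -EFinM exprMn.
  - by apply/measurable_EFinP; exact: measurable_funX.
  - by move=> x _; rewrite lee_fin sqr_ge0.
  - by rewrite lee_fin sqr_ge0.
apply: lte_mul_pinfty => //; rewrite lee_fin; exact: sqr_ge0.
Qed.

Lemma sqr_integralD f g : measurable_fun setT f -> measurable_fun setT g ->
  (\int[mu]_x ((f x + g x) ^+ 2)%:E <=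
   2%:E * (\int[mu]_x (f x ^+ 2)%:E + \int[mu]_x (g x ^+ 2)%:E))%E.
Proof.
move=> mf mg.
have mf2 : measurable_fun setT (fun x => (f x ^+ 2)%:E).
  by apply/measurable_EFinP; exact: measurable_funX.
have mg2 : measurable_fun setT (fun x => (g x ^+ 2)%:E).
  by apply/measurable_EFinP; exact: measurable_funX.
rewrite -ge0_integralD//; last 2 first.
- by move=> x _; rewrite lee_fin sqr_ge0.
- by move=> x _; rewrite lee_fin sqr_ge0.
rewrite -ge0_integralZl//; last 2 first.
- exact: emeasurable_funD.
- by move=> x _; rewrite -EFinD lee_fin addr_ge0 ?sqr_ge0.
apply: ge0_le_integral => //.
- by move=> x _; rewrite lee_fin sqr_ge0.
- by apply/measurable_EFinP; apply: measurable_funX; exact: measurable_funD.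
- by apply: measurable_funeM; exact: emeasurable_funD.
move=> x _; rewrite -EFinD -EFinM lee_fin.
have := sqr_ge0 (f x - g x); nra.
Qed.

Lemma L1L2D f g : L1L2 f -> L1L2 g -> L1L2 (fun x => f x + g x).
Proof.
move=> Lf Lg; have mf := L1L2_measurable Lf; have mg := L1L2_measurable Lg.
case: Lf => fi f2; case: Lg => gi g2; split; first exact: (integrableD measurableT fi gi).
apply: le_lt_trans (sqr_integralD mf mg) _.
by apply: lte_mul_pinfty => //; exact: lte_add_pinfty.
Qed.

Lemma L1L2_mul_bounded f g c : L1L2 f -> measurable_fun setT g ->
  (forall x, `|g x| <= c) -> L1L2 (fun x => g x * f x).
Proof.
move=> Lf mg gc; have mf := L1L2_measurable Lf.
have c0 : 0 <= c := le_trans (normr_ge0 _) (gc 0).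
have Ln : L1L2 (fun x => `|f x|).
  case: Lf => fi f2; split; first exact: integrable_norm.
  rewrite (_ : (fun x => (`|f x| ^+ 2)%:E) = (fun x => (f x ^+ 2)%:E))//.
  by apply/funext => x; rewrite real_normK ?num_real.
apply: L1L2_dominated (L1L2Z c Ln); first exact: measurable_funM.
by move=> x; rewrite normrM ler_wpM2r.
Qed.

Lemma L1L2_restrict_compact f K : L2loc f -> locally_integrable setT f -> compact K ->
  L1L2 (f \_ K).
Proof.
move=> fl2 fl cK; split; first exact: (locally_integrable_restrict fl cK (subsetT K)).
by have /L2_restrict/L2T[_] := fl2 K cK.
Qed.

Lemma continuous_exp_scaled a : continuous (fun x => expR (- (x / a))).
Proof.
move=> x; have d : is_derive x 1 (fun x => expR (- (x / a))) (- (expR (- (x / a)) / a)).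
  by derive; ring.
exact: is_derive_cvg d.
Qed.

Lemma integral_exp_norm a : 0 < a ->
  (\int[mu]_x (expR (- (`|x| / a)))%:E = (2 * a)%:E)%E.
Proof.
move=> a0; rewrite ge0_symfun_integralT.
- rewrite (_ : [set x | _] = `[0, +oo[%classic :> set R); last first.
    by apply/seteqP; split => x /=; rewrite in_itv/= andbT.
  rewrite EFinM; congr (_ * _)%E.
  pose F x := - (a * expR (- (x / a))).
  have dF x : is_derive x 1 F (expR (- (x / a))).
    by rewrite /F; derive; field; rewrite gt_eqF.
  have cF : continuous F by move=> x; exact: is_derive_cvg (dF x).
  have ce : continuous (fun x => expR (- (x / a))).
    exact: continuous_exp_scaled.
  transitivity (\int[mu]_(x in `[0%R, +oo[) (expR (- (x / a)))%:E)%E.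
    apply: eq_integral => x; rewrite inE/= in_itv/= andbT => x0.
    by rewrite ger0_norm.
  rewrite (@ge0_continuous_FTC2y _ _ F 0 0).
  + by rewrite /F mul0r oppr0 expR0 mulr1 -EFinB sub0r opprK.
  + by move=> x _; exact: expR_ge0.
  + exact: continuous_subspaceT.
  + rewrite /F -[X in _ --> X]oppr0 -[X in _ --> - X](mulr0 a).
    apply: cvgN; apply: cvgMl_tmp.
    apply: (@cvg_comp _ _ _ (fun x => x / a) (fun x => expR (- x))); last first.
      exact: cvgr_expR.
    by apply: gt0_cvgMly; [rewrite invr_gt0|exact: cvg_id].
  + by move=> x _; have [] := dF x.
  + by apply: cvg_at_right_filter; exact: cF.
  + by move=> x _; rewrite derive1E; have [_ ->] := dF x.
- by move=> x; exact: expR_ge0.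
- move=> x; apply: (@continuous_even_extension _ (fun x => expR (- (x / a)))) => y _.
  exact: continuous_exp_scaled.
- by move=> x /=; rewrite normrN.
Qed.

Lemma L1L2_exp_norm a : 0 < a -> L1L2 (fun x => expR (- (`|x| / a))).
Proof.
move=> a0; split.
  apply/integrableP; split.
    apply/measurable_EFinP; apply: continuous_measurable_fun.
    apply: (@continuous_even_extension _ (fun x => expR (- (x / a)))) => y _.
    exact: continuous_exp_scaled.
  under eq_integral do rewrite /= ger0_norm ?expR_ge0//.
  by rewrite integral_exp_norm// ltry.
have E x : expR (- (`|x| / a)) ^+ 2 = expR (- (`|x| / (a / 2))).
  by rewrite expr2 -expRD; congr expR; field; rewrite gt_eqF.
under eq_integral do rewrite E.
by rewrite integral_exp_norm ?ltry// divr_gt0.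
Qed.

(** With F = (1 + x^2) f, the function |f| = |F| / (1 + x^2) is at most F^2 + 1
/ (1 + x^2). *)
Lemma L1L2_weighted f D : measurable D -> L2 D (fun x => (1 + x ^+ 2) * f x) ->
  L1L2 (f \_ D).
Proof.
move=> mD /L2_restrict/L2T[].
set F := _ \_ D => mF F2.
have w1 x : 1 <= 1 + x ^+ 2 by rewrite lerDl sqr_ge0.
have w0 x : 0 < 1 + x ^+ 2 by exact: lt_le_trans (w1 x).
have fE x : (f \_ D) x = (oneDsqr x)^-1 * F x.
  rewrite /F !patchE /oneDsqr; case: ifPn => _; last by rewrite mulr0.
  by rewrite mulKf// gt_eqF.
have mf : measurable_fun setT (f \_ D).
  rewrite (_ : f \_ D = (fun x => (oneDsqr x)^-1 * F x)).
    apply: measurable_funM => //; apply: continuous_measurable_fun.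
    exact: continuous_oneDsqrV.
  by apply/funext.
have mF2 : measurable_fun setT (fun x => (F x ^+ 2)%:E).
  by apply/measurable_EFinP; exact: measurable_funX.
have mo : measurable_fun setT (fun x => ((oneDsqr x)^-1)%:E : \bar R).
  apply/measurable_EFinP; apply: continuous_measurable_fun.
  exact: continuous_oneDsqrV.
have o0 x : 0 < (oneDsqr x)^-1 by rewrite invr_gt0.
have o1 x : (oneDsqr x)^-1 <= 1 by exact: oneDsqrV_le1.
split.
  apply/integrableP; split; first exact/measurable_EFinP.
  apply: (@le_lt_trans _ _ (\int[mu]_x ((F x ^+ 2)%:E + ((oneDsqr x)^-1)%:E))%E).
    apply: ge0_le_integral => //.
    - by apply: measurableT_comp => //; exact/measurable_EFinP.
    - exact: emeasurable_funD.
    move=> x _ /=; rewrite lee_fin fE normrM (ger0_norm (ltW (o0 x))).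
    have := sqr_ge0 (`|F x| - (oneDsqr x)^-1); have := real_normK (num_real (F x)).
    by have := o0 x; have := o1 x; nra.
  rewrite ge0_integralD//; last by move=> x _; rewrite lee_fin sqr_ge0.
  by rewrite integral_inv_oneDsqr; apply: lte_add_pinfty => //; rewrite ltry.
apply: le_lt_trans F2; apply: ge0_le_integral => //.
- by move=> x _; rewrite lee_fin sqr_ge0.
- by apply/measurable_EFinP; exact: measurable_funX.
move=> x _; rewrite lee_fin fE exprMn ler_piMl ?sqr_ge0//.
by rewrite exprn_ile1// ltW.
Qed.

End integrable_and_square_integrable.

(** * The odd oscillating function *)

Section smooth_products.
Context {R : realType}.
Local Notation mu := (@lebesgue_measure R).
Local Notation k0 := (@k0 R).
Implicit Types (x : R) (phi : R -> R).

(** The oscillation of u_o at infinity. *)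
Definition carrier (x : R) := Num.sg x * cos (k0 * x).

Lemma measurable_carrier : measurable_fun setT carrier.
Proof.
apply: measurable_funM; first exact: measurable_sg.
by apply: continuous_measurable_fun; exact: continuous_cos_scaled.
Qed.

Lemma carrier_le1 x : `|carrier x| <= 1.
Proof. exact: le_trans (norm_sg_le _ _) (cos_max _). Qed.

(** The carrier jumps at the origin, so its second derivative on the line
contains the derivative of a Dirac mass, which a test function with vanishing
derivative at 0 does not see. *)
Lemma carrier_second_derivative phi phi1 phi2 :
  (forall x, is_derive x 1 phi (phi1 x)) -> (forall x, is_derive x 1 phi1 (phi2 x)) ->
  continuous phi2 -> (exists M, forall x, M <= `|x| -> phi x = 0) ->
  phi1 0 = 0 ->
  \int[mu]_x (carrier x * phi2 x) = \int[mu]_x (- k0 ^+ 2 * carrier x * phi x).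
Proof.
move=> d1 d2 c2 [M phi0] phi10.
have c1 : continuous phi1 by move=> x; exact: is_derive_cvg (d2 x).
pose car1 (x : R) := Num.sg x * (- k0 * sin (k0 * x)).
have dcos x : is_derive x 1 (fun x => cos (k0 * x)) (- k0 * sin (k0 * x)).
  by apply: is_derive_eq (is_derive_scaled (is_derive_cos (k0 * x))) _; ring.
have dsin x : is_derive x 1 (fun x => - k0 * sin (k0 * x)) (- k0 ^+ 2 * cos (k0 * x)).
  by apply: is_derive_eq (is_derive_mul (is_derive_const (- k0) x)
    (is_derive_scaled (is_derive_sin (k0 * x)))) _; ring.
have csin x : {for x, continuous (fun x => - k0 * sin (k0 * x))} := is_derive_cvg (dsin x).
have ccos : continuous (fun x => - k0 ^+ 2 * cos (k0 * x)).
  by move=> x; apply: cvgMl_tmp; exact: is_derive_cvg (dcos x).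
have mcar1 : measurable_fun setT car1.
  apply: measurable_funM; first exact: measurable_sg.
  exact: continuous_measurable_fun.
have M1 : exists M, forall x, M <= `|x| -> phi1 x = 0.
  exists (M + 1) => x Mx; apply: (derivative_support d1 phi0); lra.
have sgp x : 0 < x -> Num.sg x = 1 by exact: gtr0_sg.
have sgm x : x < 0 -> Num.sg x = -1 by exact: ltr0_sg.
rewrite (@integration_by_parts_piecewise _ carrier car1 (fun x => - cos (k0 * x))
  (fun x => - (- k0 * sin (k0 * x))) (fun x => cos (k0 * x)) (fun x => - k0 * sin (k0 * x))
  measurable_carrier mcar1 (fun x _ => dcos x) (fun x _ => csin x)
  (fun x _ => is_derive_opp (dcos x)) _ _ _ phi1 phi2 d2 c2 M1); first last.
- by rewrite phi10 mulr0.
- by move=> x x0; rewrite /carrier /car1 sgm// !mulN1r.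
- by move=> x x0; rewrite /carrier /car1 sgp// !mul1r.
- by move=> x _; apply: cvgN; exact: csin.
rewrite (@integration_by_parts_piecewise _ car1 (fun x => - k0 ^+ 2 * carrier x)
  (fun x => - (- k0 * sin (k0 * x))) (fun x => - (- k0 ^+ 2 * cos (k0 * x)))
  (fun x => - k0 * sin (k0 * x)) (fun x => - k0 ^+ 2 * cos (k0 * x))
  mcar1 _ (fun x _ => dsin x) (fun x _ => ccos x)
  (fun x _ => is_derive_opp (dsin x)) _ _ _ phi phi1 d1 c1 (ex_intro _ M phi0)); first last.
- by rewrite mulr0 sin0 mulr0 oppr0 subr0 mul0r.
- by move=> x x0; rewrite /carrier /car1 sgm// !mulN1r mulrN.
- by move=> x x0; rewrite /carrier /car1 sgp// !mul1r.
- by move=> x _; apply: cvgN; exact: ccos.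
- by apply: measurable_funM => //; exact: measurable_carrier.
by rewrite opprK.
Qed.

Section oscillation.
Variables (u v1 v2 w1 w2 : R -> R).
Local Notation D := [set x : R | 1 < `|x|].
Hypotheses (uH : H2loc_with u v1 v2)
  (ww1 : weak_derivative D (fun x => u x - carrier x) w1)
  (ww2 : weak_derivative D w1 w2)
  (Lw0 : L2 D (fun x => (1 + x ^+ 2) * (u x - carrier x)))
  (Lw2 : L2 D (fun x => (1 + x ^+ 2) * w2 x)).

Let mD : measurable D.
Proof.
by apply: open_measurable; case: ww1 => -[].
Qed.

(** The second derivative of u - carrier, glued from v2 near the origin and
from the weak derivative w2 on |x| > 1 by the cutoff; the last term makes up
for the second derivative of the carrier near the origin. *)
Definition oscillation_residual2 (x : R) :=
  cutoff x * v2 x + (1 - cutoff x) * (w2 \_ D) x + k0 ^+ 2 * (cutoff x * carrier x).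

Let mcut : measurable_fun setT (@cutoff R).
Proof.
by apply: continuous_measurable_fun => x; exact: is_derive_cvg (is_derive_cutoff x).
Qed.

Let ccut : continuous (@cutoff R).
Proof. by move=> x; exact: is_derive_cvg (is_derive_cutoff x). Qed.

Let cutC : {C : R | forall x, `|cutoff x| <= C}.
Proof. by apply: cid; have [C [h _ _]] := @cutoff_bounds R; exists C. Qed.

Let cut_restrict (f : R -> R) x : cutoff x * f x = cutoff x * (f \_ `[-3, 3]) x.
Proof.
rewrite patchE; case: ifPn => // xK.
have x3 : 3 <= `|x|.
  rewrite leNgt; apply: contra xK => x3.
  by rewrite inE/= in_itv/= -ler_norml ltW.
by have [z0 _ _] := cutoff_far x3; rewrite z0 !mul0r.
Qed.

Let L1L2_cut (f : R -> R) : L2loc f -> locally_integrable setT f ->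
  L1L2 (fun x => cutoff x * f x).
Proof.
move=> fl2 fl; rewrite (_ : (fun x => _) = (fun x => cutoff x * (f \_ `[-3, 3]) x)).
  apply: L1L2_mul_bounded mcut (svalP cutC).
  exact: (L1L2_restrict_compact fl2 fl (@segment_compact _ _ _)).
by apply/funext.
Qed.

Let c1 : continuous (fun _ : R => 1 : R). Proof. by move=> x; exact: cvg_cst. Qed.

Let carrier_loc : locally_integrable setT carrier.
Proof. exact: (dominated_locally_integrable measurable_carrier c1 carrier_le1). Qed.

Let carrier_L2loc : L2loc carrier.
Proof. exact: (dominated_L2loc measurable_carrier c1 carrier_le1). Qed.

Lemma L1L2_oscillation_residual2 : L1L2 oscillation_residual2.
Proof.
case: uH => _ _ [_ v2l2] _ [_ v2l _].
apply: L1L2D; last by apply: L1L2Z; exact: L1L2_cut.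
apply: L1L2D; first exact: L1L2_cut.
apply: (@L1L2_mul_bounded _ _ _ (1 + sval cutC)); first exact: L1L2_weighted.
  by apply: measurable_funB.
move=> x; apply: le_trans (ler_normB _ _) _; rewrite normr1 lerD2l.
exact: svalP cutC x.
Qed.

Let u_loc : locally_integrable setT u.
Proof. by case: uH => _ _ _ [] . Qed.

Let u_L2loc : L2loc u.
Proof. by case: uH. Qed.

Lemma L1L2_oscillation_residual : L1L2 (fun x => u x - carrier x).
Proof.
pose f x := u x - carrier x.
have fl : locally_integrable setT f.
  exact: (locally_integrableB u_loc carrier_loc).
have fl2 : L2loc f.
  have cN : L2loc (fun x => - carrier x).
    apply: (dominated_L2loc _ c1); first exact: measurableT_comp measurable_carrier.
    by move=> x; rewrite normrN carrier_le1.
  exact: (L2locD u_L2loc cN).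
have e : (fun x => u x - carrier x) = (fun x => (f \_ D) x + (f \_ `[-1, 1]) x).
  apply/funext => x; rewrite !patchE -/(f x).
  have -> : (x \in D) = (1 < `|x|) by apply/idP/idP; rewrite inE.
  have -> : (x \in `[-1, 1]%classic) = (`|x| <= 1).
    by apply/idP/idP; rewrite inE/= in_itv/= -ler_norml.
  by case: ltP => _; rewrite ?addr0 ?add0r.
rewrite e; apply: L1L2D; first exact: L1L2_weighted.
exact: (L1L2_restrict_compact fl2 fl (@segment_compact _ _ _)).
Qed.

(** The test function is split by the cutoff. Its part near the origin is
tested against the local weak derivatives of u; the other part is supported
away from the origin, where u is the carrier plus a function with weak
derivatives w1 and w2. *)
Lemma oscillation_second_derivative phi phi1 phi2 :
  (forall x, is_derive x 1 phi (phi1 x)) -> (forall x, is_derive x 1 phi1 (phi2 x)) ->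
  continuous phi2 -> (exists M, forall x, M <= `|x| -> phi x = 0) ->
  \int[mu]_x (u x * phi2 x) =
  \int[mu]_x ((oscillation_residual2 x - k0 ^+ 2 * carrier x) * phi x).
Proof.
move=> d1 d2 c2 [M phi0].
have cphi : continuous phi by move=> x; exact: is_derive_cvg (d1 x).
have cphi1 : continuous phi1 by move=> x; exact: is_derive_cvg (d2 x).
have phi10 := derivative_support d1 phi0.
pose eta x := cutoff x * phi x.
pose eta1 x := cutoff1 x * phi x + cutoff x * phi1 x.
pose eta2 x := cutoff2 x * phi x + cutoff1 x * phi1 x + (cutoff1 x * phi1 x + cutoff x * phi2 x).
have de x : is_derive x 1 eta (eta1 x) by exact: (is_derive_mul (is_derive_cutoff x) (d1 x)).
have de1 x : is_derive x 1 eta1 (eta2 x).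
  exact: (is_derive_add (is_derive_mul (is_derive_cutoff1 x) (d1 x))
    (is_derive_mul (is_derive_cutoff x) (d2 x))).
have ccut1 : continuous (@cutoff1 R) by move=> x; exact: is_derive_cvg (is_derive_cutoff1 x).
have ce2 : continuous eta2.
  move=> x; apply: cvgD; apply: cvgD; apply: cvgM.
  - exact: continuous_cutoff2.
  - exact: cphi.
  - exact: ccut1.
  - exact: cphi1.
  - exact: ccut1.
  - exact: cphi1.
  - exact: ccut.
  - exact: c2.
have eta0 x : M <= `|x| -> eta x = 0 by move=> Mx; rewrite /eta phi0// mulr0.
have eta10 := derivative_support de eta0.
have ce : continuous eta by move=> x; exact: is_derive_cvg (de x).
have ce1 : continuous eta1 by move=> x; exact: is_derive_cvg (de1 x).
have eta0' x : M < `|x| -> eta x = 0 by move=> /ltW; exact: eta0.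
have eta10' x : M + 1 <= `|x| -> eta1 x = 0 by move=> h; apply: eta10; lra.
have eta20 := derivative_support de1 eta10'.
pose th x := phi x - eta x.
pose th1 x := phi1 x - eta1 x.
pose th2 x := phi2 x - eta2 x.
have dt x : is_derive x 1 th (th1 x).
  exact: (is_derive_add (d1 x) (is_derive_opp (de x))).
have dt1 x : is_derive x 1 th1 (th2 x).
  exact: (is_derive_add (d2 x) (is_derive_opp (de1 x))).
have ct2 : continuous th2 by move=> x; apply: cvgB; [exact: c2|exact: ce2].
have ct1 : continuous th1 by move=> x; exact: is_derive_cvg (dt1 x).
have ct : continuous th by move=> x; exact: is_derive_cvg (dt x).
have th0 x : M <= `|x| -> th x = 0 by move=> Mx; rewrite /th phi0// eta0// subrr.
have th10 := derivative_support dt th0.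
have th10' x : M + 1 <= `|x| -> th1 x = 0 by move=> h; apply: th10; lra.
have th20 := derivative_support dt1 th10'.
have thc x : `|x| <= 2 -> [/\ th x = 0, th1 x = 0 & th2 x = 0].
  move=> x2; have [z0 z1 z2] := cutoff_near x2.
  by rewrite /th /th1 /th2 /eta /eta1 /eta2 z0 z1 z2; split; ring.
pose K : set R := `[- (M + 1), -2] `|` `[2, M + 1].
have cK : compact K by apply: compactU; exact: segment_compact.
have KD : K `<=` D.
  move=> x [] /=; rewrite in_itv/= => /andP[h1 h2].
    by rewrite ltr0_norm; lra.
  by rewrite gtr0_norm; lra.
have offK x : ~ K x -> `|x| <= 2 \/ M + 1 <= `|x|.
  move=> xK; have [x2|x2] := leP `|x| 2; first by left.
  right; rewrite leNgt; apply/negP => xM; apply: xK.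
  have [x0|x0] := leP 0 x.
    right; rewrite /= in_itv/=; move: x2 xM; rewrite ger0_norm//; lra.
  left; rewrite /= in_itv/=; move: x2 xM; rewrite ltr0_norm//; lra.
have thK x : ~ K x -> th x = 0.
  by move=> /offK[/thc[]//|h]; apply: th0; lra.
have th1K x : ~ K x -> th1 x = 0.
  by move=> /offK[/thc[]//|h]; exact: th10'.
have offD x : ~ D x -> `|x| <= 2 by move=> /= /negP; rewrite -leNgt; lra.
have Hnear : \int[mu]_x (u x * eta2 x) = \int[mu]_x (v2 x * eta x).
  case: uH => _ _ _ wu wv.
  rewrite (weak_derivativeTP wu de1 ce2); last by exists (M + 1).
  rewrite (weak_derivativeTP wv de ce1); last by exists M.
  by rewrite opprK.
have Hfar : \int[mu]_x ((u x - carrier x) * th2 x) = \int[mu]_x ((w2 \_ D) x * th x).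
  rewrite (@Rintegral_support _ _ D); last first.
    by move=> x /offD /thc[_ _ ->]; rewrite mulr0.
  rewrite (weak_derivativeP ww1 dt1 ct2 cK KD th1K).
  rewrite (weak_derivativeP ww2 dt ct1 cK KD thK) opprK.
  rewrite [RHS](@Rintegral_support _ _ D); last first.
    by move=> x /offD /thc[-> _ _]; rewrite mulr0.
  by apply: eq_Rintegral => x xD; rewrite patchE xD.
have Hcar : \int[mu]_x (carrier x * th2 x) = \int[mu]_x (- k0 ^+ 2 * carrier x * th x).
  have [_ t1 _] : [/\ th 0 = 0, th1 0 = 0 & th2 0 = 0] by apply: thc; rewrite normr0.
  by apply: carrier_second_derivative dt dt1 ct2 _ t1; exists M.
have iu_eta := integrable_mul_compact_support u_loc ce2 eta20.
have w0_loc : locally_integrable setT (fun x => u x - carrier x).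
  exact: (locally_integrableB u_loc carrier_loc).
have iw_th := integrable_mul_compact_support w0_loc ct2 th20.
have ic_th := integrable_mul_compact_support carrier_loc ct2 th20.
have -> : \int[mu]_x (u x * phi2 x) = \int[mu]_x (u x * eta2 x) +
    (\int[mu]_x ((u x - carrier x) * th2 x) + \int[mu]_x (carrier x * th2 x)).
  rewrite -(RintegralD measurableT iw_th ic_th).
  rewrite -RintegralD//; last first.
    exact: (integrableD measurableT iw_th ic_th).
  by apply: eq_Rintegral => x _; rewrite /th2; ring.
rewrite Hnear Hfar Hcar.
have th0' x : M < `|x| -> th x = 0 by move=> /ltW; exact: th0.
have v2l : locally_integrable setT v2 by case: uH => _ _ _ _ [].
have iv_eta := integrable_mul_compact_support v2l ce eta0'.
have Lw := L1L2_weighted mD Lw2.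
have [C thC] := continuous_bounded_support ct th0.
have iw2_th : mu.-integrable setT (EFin \o (fun x => (w2 \_ D) x * th x)).
  apply: (integrable_mul_bounded Lw.1 _ thC); exact: continuous_measurable_fun.
have kc_loc : locally_integrable setT (fun x => - k0 ^+ 2 * carrier x).
  have ck : continuous (fun _ : R => k0 ^+ 2) by move=> x; exact: cvg_cst.
  apply: (dominated_locally_integrable _ ck).
    by apply: measurable_funM => //; exact: measurable_carrier.
  move=> x; rewrite normrM normrN (ger0_norm (sqr_ge0 _)) ler_piMr ?sqr_ge0//.
  exact: carrier_le1.
have ikc_th := integrable_mul_compact_support kc_loc ct th0'.
rewrite -(RintegralD measurableT iw2_th ikc_th) -RintegralD//; last first.
  exact: (integrableD measurableT iw2_th ikc_th).
apply: eq_Rintegral => x _; rewrite /oscillation_residual2 /th /eta.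
by ring.
Qed.

End oscillation.
End smooth_products.

(** * Growth of the unregularised wave away from the origin *)

Section positive_profile.
Context {R : realType}.
Implicit Types (f u : R -> R) (x : R).

Lemma limf_einf_gt0 f : (0 < limf_einf (fun x => `|f x|%:E) abs_infty)%E ->
  exists M m, 0 < m /\ forall x, M < `|x| -> m <= `|f x|.
Proof.
rewrite limf_einfE => /ereal_sup_gt[_ [V [M _ MV] <-]].
set I := ereal_inf _ => I0.
have lb x : M < `|x| -> (I <= `|f x|%:E)%E.
  by move=> Mx; apply: ereal_inf_lbound; exists x => //; exact: MV.
have := lb (`|M| + 1); rewrite [`|_ + 1|]ger0_norm; last by rewrite addr_ge0.
have M1 : M < `|M| + 1 by have := ler_norm M; lra.
move=> /(_ M1).
case: I I0 lb => //= r; rewrite lte_fin => r0 lb _.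
by exists M, r; split => // x /lb; rewrite lee_fin.
Qed.

(** The value of the derivative is a limit, which for a function without
derivative is the default value 0; so a positive value implies
differentiability at 0. *)
Lemma derive1_gt0 f : f 0 = 0 -> 0 < f^`()%classic 0 ->
  exists d, [/\ 0 < d, 0 < f^`()%classic 0 & forall x, 0 < x < d ->
    f^`()%classic 0 / 2 * x <= f x].
Proof.
move=> f0; set a := f^`()%classic 0 => a0.
have H : h^-1 *: (f (h + 0) - f 0) @[h --> 0^'] --> a.
  have [//|nc] := pselect (cvg (h^-1 *: (f (h + 0) - f 0) @[h --> 0^'])).
  by move: a0; rewrite /a /derive1 (dvgP nc)/= ltxx.
have /cvgrPdist_le/(_ _ (divr_gt0 a0 (ltr0Sn R 1))) := H.
move=> /nbhs_ballP[d /= d0 dP]; exists d; split => // x /andP[x0 xd].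
have /= := dP x; rewrite /ball/= sub0r normrN gtr0_norm// => /(_ xd).
rewrite gt_eqF// => /(_ isT); rewrite addr0 f0 subr0 /GRing.scale/= => h.
have : a / 2 <= x^-1 * f x by move: h; rewrite ler_norml => /andP[_]; lra.
by rewrite [x^-1 * _]mulrC ler_pdivlMr.
Qed.

(** Near 0 the bound comes from the slope, far away from the lower limit, and
in between from compactness. *)
Lemma linear_lower_bound u : continuous u -> u 0 = 0 ->
  (forall x, 0 < x -> 0 < u x) -> 0 < u^`()%classic 0 ->
  (0 < limf_einf (fun x => `|u x|%:E) abs_infty)%E ->
  exists sl m, [/\ 0 < sl, 0 < m & forall x, 0 <= x -> Num.min (4 * sl * x) (4 * m) <= u x].
Proof.
move=> cu u0 up du linf.
have [d [d0 a0 ud]] := derive1_gt0 u0 du.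
have [M [m1 [m10 um]]] := limf_einf_gt0 linf.
have dM : d / 2 <= Num.max d (M + 1).
  by rewrite le_max; apply/orP; left; lra.
have [c cd cmin] := @EVT_min R u _ _ dM (continuous_subspaceT cu).
have c0 : 0 < c by move: cd; rewrite in_itv/= => /andP[+ _]; lra.
exists (u^`()%classic 0 / 8), (Num.min m1 (u c) / 4); split.
- by lra.
- by rewrite divr_gt0// lt_min m10 up.
move=> x; rewrite le_eqVlt => /orP[/eqP <-|x0].
  by rewrite mulr0 u0 ge_min lexx.
have [xd|dx] := ltP x d.
  rewrite ge_min; apply/orP; left; apply: le_trans (ud x _); last by rewrite x0.
  by rewrite le_eqVlt; apply/orP; left; apply/eqP; field.
rewrite ge_min; apply/orP; right.
have -> : 4 * (Num.min m1 (u c) / 4) = Num.min m1 (u c) by field.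
have [Mx|xM] := ltP M x.
  rewrite ge_min; apply/orP; left.
  by rewrite -(gtr0_norm (up x x0)); apply: um; rewrite gtr0_norm.
rewrite ge_min; apply/orP; right; apply: cmin; rewrite in_itv/=; apply/andP; split.
  by lra.
by rewrite le_max; apply/orP; right; lra.
Qed.

(** |gamma sin(k0 x)| is at most 2 |gamma| x, as k0 < 2, and at most |gamma|;
half of the lower bound survives. *)
Lemma perturbed_lower_bound u sl m gamma : 0 < sl -> 0 < m ->
  (forall x, 0 <= x -> Num.min (4 * sl * x) (4 * m) <= u x) ->
  `|gamma| < Num.min sl m ->
  forall x, 0 <= x -> Num.min (2 * sl * x) (2 * m) <= u x + gamma * sin (k0 * x).
Proof.
move=> sl0 m0 um; rewrite lt_min => /andP[gs gm] x x0.
have k2 := @k0_lt2 R; have k1 := @k0_ge R.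
have kx : 0 <= k0 * x by apply: mulr_ge0 => //; lra.
have s1 := norm_sin_le kx; have s2 := sin_max (k0 * x).
have g0 := normr_ge0 gamma.
have h1 : `|gamma * sin (k0 * x)| <= 2 * sl * x.
  rewrite normrM; apply: (@le_trans _ _ (sl * (k0 * x))).
    by apply: ler_pM => //; exact: ltW.
  have p : 0 <= (2 - k0) * (sl * x) by rewrite mulr_ge0 ?mulr_ge0 ?subr_ge0 ?(ltW k2)// ltW.
  by rewrite mulrCA -mulrA; move: p; rewrite mulrBl; lra.
have h2 : `|gamma * sin (k0 * x)| <= m.
  by rewrite normrM; apply: le_trans (ltW gm); rewrite ler_piMr.
have := um x x0; rewrite !ge_min.
move: h1 h2; rewrite !ler_norml => /andP[h1 _] /andP[h2 _].
by move=> /orP[h|h]; apply/orP; [left|right]; lra.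
Qed.

End positive_profile.

(** * The regularised sign *)

Section regularised_sign.
Context {R : realType}.
Implicit Types (f u psi : R -> R) (x : R).

Lemma derive1_even f : even_fct f -> (forall x, derivable f x 1) -> odd_fct f^`()%classic.
Proof.
move=> fe fd x.
have d (y : R) : is_derive y 1 f (f^`()%classic y) by rewrite derive1E; exact: derivableP.
have dN (y : R) : is_derive y 1 (fun y => f (- y)) (- f^`()%classic (- y)).
  have d0 : is_derive y 1 (fun y : R => - y) (- 1) by apply: is_derive_opp; exact: is_derive_var.
  by have := is_derive_comp d0 (d (- y)); rewrite mulrN1.
have [_ e1] := dN x; have [_ e2] := d x.
have e : (fun y => f (- y)) = f by apply/funext.
by move: e1; rewrite e e2 => ->; rewrite opprK.
Qed.

Definition clamp (a x : R) := Num.max (- a) (Num.min a x).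

Lemma clamp_bound a x : 0 < a -> - a <= clamp a x <= a.
Proof.
by move=> a0; rewrite le_max lexx/= ge_max ge_min lexx/= andbT; lra.
Qed.

Lemma clamp_lipschitz a x y : `|clamp a x - clamp a y| <= `|x - y|.
Proof.
rewrite /clamp /Num.max /Num.min.
by case: (ltP a x) => h1; case: (ltP a y) => h2; case: (ltP (- a) a) => h3;
  case: (ltP (- a) x) => h4; case: (ltP (- a) y) => h5;
  rewrite ler_norml; case: (ler0P (x - y)); lra.
Qed.

(** The regularised sign is constant beyond eps, hence a function of the
clamped variable, and clamping is 1-Lipschitz; so the bound of the second
derivative for |x| < eps gives a global Lipschitz constant. *)
Lemma regularised_sign (psi : R -> R -> R) eps : regularisation psi -> 0 < eps ->
  let Psi := (psi eps)^`()%classic in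
  [/\ odd_fct Psi, (forall x, eps <= x -> Psi x = 1),
      (forall x y, `|Psi x - Psi y| <= 2 / eps * `|x - y|) &
      forall x, `|1 - Psi x| <= 3].
Proof.
move=> reg e0; have [ev [dpsi [dPsi _]] far inner] := reg eps e0 => Psi.
have oddP : odd_fct Psi := derive1_even ev dpsi.
have P1 x : eps <= x -> Psi x = 1.
  by move=> ex; have x0 := lt_le_trans e0 ex; rewrite /Psi far ?gtr0_sg ?gtr0_norm.
have Pm1 x : x <= - eps -> Psi x = -1.
  by move=> xe; rewrite -[x]opprK oddP P1//; lra.
have Pc x : Psi x = Psi (clamp eps x).
  rewrite /clamp /Num.max /Num.min.
  case: (ltP eps x) => h1; case: ltP => h2 //.
  - by rewrite !P1 ?lexx ?ltW.
  - by exfalso; lra.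
  - by rewrite !Pm1 ?lexx.
have d (y : R) : is_derive y 1 Psi ((psi eps)^`(2)%classic y).
  by rewrite /Psi derive1nS /= derive1E; exact: derivableP (dPsi y).
have lip0 x y : x < y -> - eps <= x -> y <= eps -> `|Psi y - Psi x| <= 2 / eps * (y - x).
  move=> xy ex ye.
  have [c] := @MVT R Psi (psi eps)^`(2)%classic x y xy (fun z _ => d z)
    (continuous_subspaceT (fun z => is_derive_cvg (d z))).
  rewrite in_itv/= => /andP[xc cy] ->.
  rewrite normrM (gtr0_norm (_ : 0 < y - x)) ?subr_gt0// ler_wpM2r ?subr_ge0 ?(ltW xy)//.
  by apply: inner; rewrite ltr_norml; lra.
have lip x y : `|Psi x - Psi y| <= 2 / eps * `|x - y|.
  have e2 : 0 <= 2 / eps by rewrite divr_ge0// ltW.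
  apply: (@le_trans _ _ (2 / eps * `|clamp eps x - clamp eps y|)); last first.
    by rewrite ler_wpM2l// clamp_lipschitz.
  rewrite (Pc x) (Pc y).
  have /andP[x1 x2] := clamp_bound x e0; have /andP[y1 y2] := clamp_bound y e0.
  move: (clamp eps x) (clamp eps y) x1 x2 y1 y2 => {}x {}y x1 x2 y1 y2.
  have [xy|yx|->] := ltgtP x y.
  - by rewrite distrC [`|x - y|]distrC [`|y - x|]gtr0_norm ?subr_gt0//; exact: lip0.
  - by rewrite [`|x - y|]gtr0_norm ?subr_gt0//; exact: lip0.
  - by rewrite !subrr normr0 mulr0.
split => // x.
have P0 : Psi 0 = 0 by have := oddP 0; rewrite oppr0; lra.
have := lip (clamp eps x) 0; rewrite P0 !subr0 -Pc.
have h : `|clamp eps x| <= eps by rewrite ler_norml; exact: clamp_bound.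
have : 2 / eps * `|clamp eps x| <= 2.
  by rewrite mulrAC ler_pdivrMr// ler_pM2l.
move=> h2 h3; have := le_trans h3 h2; rewrite !ler_norml => /andP[? ?].
by apply/andP; split; lra.
Qed.

End regularised_sign.

(** * The profile minus its oscillation at infinity *)

Section profile_in_H2.
Context {R : realType}.
Local Notation mu := (@lebesgue_measure R).
Local Notation k0 := (@k0 R).
Implicit Types (x : R) (f g r q : R -> R).

Lemma weak_second_derivativeD (c : R) r r2 q q2 :
  locally_integrable setT r -> locally_integrable setT r2 ->
  locally_integrable setT q -> locally_integrable setT q2 ->
  weak_second_derivative r r2 -> weak_second_derivative q q2 ->
  weak_second_derivative (fun x => c * r x + q x) (fun x => c * r2 x + q2 x).
Proof.
move=> rl r2l ql q2l wr wq phi phi1 phi2 d1 d2 c2 [M phi0].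
have c0 : continuous phi by move=> x; exact: is_derive_cvg (d1 x).
have phi10 := derivative_support d1 phi0.
have phi10' x : M + 1 <= `|x| -> phi1 x = 0 by move=> h; apply: phi10; lra.
have phi20 := derivative_support d2 phi10'.
have phi0' x : M < `|x| -> phi x = 0 by move=> /ltW; exact: phi0.
have E f g h : mu.-integrable setT (EFin \o (fun x => f x * h x)) ->
    mu.-integrable setT (EFin \o (fun x => g x * h x)) ->
    \int[mu]_x ((c * f x + g x) * h x) = c * \int[mu]_x (f x * h x) + \int[mu]_x (g x * h x).
  move=> fi gi; rewrite -RintegralZl//.
  rewrite -(RintegralD measurableT (integrableZl measurableT c fi) gi).
  by apply: eq_Rintegral => x _; ring.
rewrite !E; try exact: integrable_mul_compact_support phi20.
  by congr (c * _ + _); [apply: wr d1 d2 c2 _|apply: wq d1 d2 c2 _]; exists M.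
- exact: (integrable_mul_compact_support r2l c0 phi0').
- exact: (integrable_mul_compact_support q2l c0 phi0').
Qed.

Definition error_constant : R := 2 * (201 ^+ 2 * 20 + (11 * expR 1) ^+ 2).

Lemma error_constant_ge0 : 0 <= error_constant.
Proof. exact: mulr_ge0 (ler0n _ 2) (addr_ge0 (mulr_ge0 (sqr_ge0 _) (ler0n _ 20)) (sqr_ge0 _)). Qed.

Section error.
Variables (M s : R) (G AC AS : R -> R) (lC lS : R).
Hypotheses (s01 : 0 < s <= 1) (cG : continuous G)
  (prim : primitives M s G AC AS lC lS).

Local Notation P := (profile AC AS lC).
Local Notation P1 := (profile1 AC AS lC).
Local Notation beta := (lS / k0).

Let s0 : 0 < s. Proof. by case/andP: s01. Qed.
Let M0 : 0 <= M := primitives_ge0 s01 prim.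

Definition profile2 x := G x - k0 ^+ 2 * P x.

Let cP x : 0 <= x -> {for x, continuous P}.
Proof. by move=> x0; exact: is_derive_cvg (is_derive_profile prim x0). Qed.

Let cP2 x : 0 <= x -> {for x, continuous profile2}.
Proof.
move=> x0; apply: cvgB; first exact: cG.
by apply: cvgMl_tmp; exact: cP.
Qed.

Lemma H2loc_profile :
  H2loc_with (odd_extension P) (fun x => P1 `|x|) (odd_extension profile2).
Proof.
have d x (x0 : 0 <= x) : is_derive x 1 P (P1 x) := is_derive_profile prim x0.
have d1 x (x0 : 0 <= x) : is_derive x 1 P1 (profile2 x) := is_derive_profile1 prim x0.
exact: (@H2loc_odd_extension _ P P1 profile2 (profile0 prim) d d1 cP2).
Qed.

Lemma profile_weak_second_derivative :
  weak_second_derivative (odd_extension P) (odd_extension profile2).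
Proof.
move=> phi phi1 phi2 d1 d2 c2 [N phi0].
have c1 : continuous phi1 by move=> x; exact: is_derive_cvg (d2 x).
have phi10 := derivative_support d1 phi0.
case: H2loc_profile => _ _ _ w1 w2.
rewrite (weak_derivativeTP w1 d2 c2); last first.
  by exists (N + 1) => x h; apply: phi10; lra.
rewrite (weak_derivativeTP w2 d1 c1); last by exists N.
by rewrite opprK.
Qed.

(** What remains of the profile once its oscillation at infinity is removed,
and the corresponding second derivative, both continued as odd functions; they
decay exponentially. *)
Definition profile_error := odd_extension (fun x => P x + beta * cos (k0 * x)).

Definition profile_error2 :=
  odd_extension (fun x => G x - k0 ^+ 2 * (P x + beta * cos (k0 * x))).

Lemma profile_errorE x : profile_error x = odd_extension P x + beta * carrier x.
Proof.
rewrite /profile_error /odd_extension /carrier.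
have -> : cos (k0 * x) = cos (k0 * `|x|).
  by case: (ler0P x) => //; rewrite mulrN cosN.
by ring.
Qed.

Lemma profile_error2E x :
  profile_error2 x = odd_extension profile2 x - k0 ^+ 2 * (beta * carrier x).
Proof.
have := profile_errorE x.
rewrite /profile_error2 /profile_error /odd_extension /profile2 => e.
rewrite mulrBr mulrCA e.
by ring.
Qed.

Let envelope (a b : R) x := a * expR (- (`|x| / 20)) + b * expR (- (`|x| / s ^+ 2)).

Let L1L2_envelope a b : L1L2 (envelope a b).
Proof. by apply: L1L2D; apply: L1L2Z; apply: L1L2_exp_norm => //; rewrite exprn_gt0. Qed.

Let tailE x : tail s `|x| = envelope 20 (s * expR 1) x.
Proof. by rewrite /tail /envelope expRD mulrA. Qed.

Let weightE x : weight s `|x| = envelope 1 (s^-1 * expR 1) x.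
Proof. by rewrite /weight /envelope expRD mulrA mul1r. Qed.

Let error_bound x : `|P `|x| + beta * cos (k0 * `|x|)| <= 2 * M * tail s `|x|.
Proof. exact: (profile_decay s01 prim (normr_ge0 x)). Qed.

Let GM x : `|G `|x| | <= M * weight s `|x|.
Proof. by case: prim => _ + _ _ _; apply. Qed.

Let measurable_even f : (forall x, 0 <= x -> {for x, continuous f}) ->
  measurable_fun setT (odd_extension f).
Proof.
move=> cf; apply: measurable_funM; first exact: measurable_sg.
by apply: continuous_measurable_fun; exact: continuous_even_extension.
Qed.

Let cerr x : 0 <= x -> {for x, continuous (fun x => P x + beta * cos (k0 * x))}.
Proof.
move=> x0; apply: cvgD; first exact: cP.
apply: cvgMl_tmp.
exact: continuous_cos_scaled.
Qed.

Lemma measurable_profile_error : measurable_fun setT profile_error.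
Proof. by apply: measurable_even => x x0; exact: cerr. Qed.

Lemma measurable_profile_error2 : measurable_fun setT profile_error2.
Proof.
apply: measurable_even => x x0; apply: cvgB; first exact: cG.
by apply: cvgMl_tmp; exact: cerr.
Qed.

Lemma L1L2_profile_error : L1L2 profile_error.
Proof.
apply: (L1L2_dominated measurable_profile_error _ (L1L2Z (2 * M) (L1L2_envelope 20 (s * expR 1)))).
by move=> x; rewrite -tailE; apply: le_trans (norm_sg_le _ _) (error_bound x).
Qed.

Let sqk : 0 <= k0 ^+ 2 <= 4.
Proof.
have k1 : 0 < k0 := k0_gt0; have k2 := @k0_lt2 R.
by rewrite sqr_ge0/=; have : 0 <= (2 - k0) * (2 + k0) by [apply: mulr_ge0; lra]; lra.
Qed.

Lemma L1L2_profile_error2 : L1L2 profile_error2.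
Proof.
apply: (L1L2_dominated measurable_profile_error2 _
  (L1L2D (L1L2Z M (L1L2_envelope 1 (s^-1 * expR 1)))
         (L1L2Z (8 * M) (L1L2_envelope 20 (s * expR 1))))).
move=> x; rewrite -tailE -weightE; apply: le_trans (norm_sg_le _ _) _.
apply: le_trans (ler_normB _ _) _; apply: lerD; first exact: GM.
have /andP[k1 k2] := sqk; rewrite normrM (ger0_norm k1).
have -> : 8 * M * tail s `|x| = 4 * (2 * M * tail s `|x|) by ring.
by apply: ler_pM.
Qed.

(** By p'' = g - k0^2 p the difference of the error and its second derivative
is (1 + k0^2) times the error minus g. The constants are 201 = 1 + 10 * 20 and
11 = 1 + 10, from the coefficients 1 and 10 of the weight and of its tail. *)
Let error_difference x : `|profile_error x - profile_error2 x| <=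
  M * envelope 201 (11 * s^-1 * expR 1) x.
Proof.
rewrite /profile_error /profile_error2 /odd_extension -mulrBr.
apply: le_trans (norm_sg_le _ _) _.
have -> : P `|x| + beta * cos (k0 * `|x|) - (G `|x| - k0 ^+ 2 * (P `|x| + beta * cos (k0 * `|x|)))
  = (1 + k0 ^+ 2) * (P `|x| + beta * cos (k0 * `|x|)) - G `|x| by ring.
apply: le_trans (ler_normB _ _) _.
have /andP[k1 k2] := sqk.
rewrite normrM (ger0_norm (_ : 0 <= 1 + k0 ^+ 2)) ?addr_ge0//.
apply: (@le_trans _ _ (5 * (2 * M * tail s `|x|) + M * weight s `|x|)).
  apply: lerD; last exact: GM.
  by apply: ler_pM => //; lra.
have -> : 5 * (2 * M * tail s `|x|) + M * weight s `|x| =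
    M * (10 * tail s `|x| + weight s `|x|) by ring.
apply: ler_wpM2l => //; rewrite tailE weightE /envelope.
have s2 : s <= s^-1.
  by have /andP[_ s1] := s01; apply: (le_trans s1); rewrite invf_ge1.
have e1 := expR_ge0 (1 : R); have e2 := expR_ge0 (- (`|x| / s ^+ 2)).
have e3 := expR_ge0 (- (`|x| / 20)).
move: (expR 1) (expR (- (`|x| / 20))) (expR (- (`|x| / s ^+ 2))) s2 e1 e2 e3.
move: (s^-1) => si a b d sis a0 d0 b0.
have p : 0 <= (si - s) * (a * d) by apply: mulr_ge0; [lra|exact: mulr_ge0].
have -> : 201 * b + 11 * si * a * d = 
  10 * (20 * b + s * a * d) + (1 * b + si * a * d) + 10 * ((si - s) * (a * d)) by ring.
by rewrite lerDl; apply: mulr_ge0.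
Qed.

(** The peak s^-1 exp(1 - x / s^2) has an L^2 norm independent of s, so the
whole bound is proportional to M^2. *)
Lemma sqr_integral_profile_error :
  (\int[mu]_x ((profile_error x - profile_error2 x) ^+ 2)%:E <=
   (M ^+ 2 * error_constant)%:E)%E.
Proof.
pose h (c a x : R) := c * expR (- (`|x| / a)).
have hL c a : 0 < a -> L1L2 (h c a) by move=> a0; apply: L1L2Z; exact: L1L2_exp_norm.
have hI c a : 0 < a -> (\int[mu]_x (h c a x ^+ 2)%:E = (c ^+ 2 * a)%:E)%E.
  move=> a0; have a2 : 0 < a / 2 by rewrite divr_gt0.
  transitivity ((c ^+ 2)%:E * \int[mu]_x (expR (- (`|x| / (a / 2))))%:E)%E.
    rewrite -ge0_integralZl//.
    - apply: eq_integral => x _; rewrite -EFinM /h exprMn -expRM_natl.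
      by congr (_ * expR _)%:E; field; rewrite gt_eqF.
    - by have [/integrableP[]] := L1L2_exp_norm a2.
    - by rewrite lee_fin sqr_ge0.
  by rewrite integral_exp_norm// -EFinM; congr (_ * _)%:E; field.
have s2 : 0 < s ^+ 2 by rewrite exprn_gt0.
have tw : 0 < 20 :> R by rewrite ltr0n.
have L1 := hL (M * 201) _ tw; have L2 := hL (M * (11 * s^-1 * expR 1)) _ s2.
have m1 := L1L2_measurable L1; have m2 := L1L2_measurable L2.
apply: (@le_trans _ _ (\int[mu]_x ((h (M * 201) 20 x + h (M * (11 * s^-1 * expR 1)) (s ^+ 2) x) ^+ 2)%:E)%E).
  apply: ge0_le_integral => //.
  - by move=> x _; rewrite lee_fin sqr_ge0.
  - apply/measurable_EFinP; apply: measurable_funX; apply: measurable_funB.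
      exact: measurable_profile_error.
    exact: measurable_profile_error2.
  - by apply/measurable_EFinP; apply: measurable_funX; exact: measurable_funD.
  - move=> x _; rewrite lee_fin -[leLHS]real_normK ?num_real// ler_sqr ?nnegrE//; last first.
      by rewrite addr_ge0// mulr_ge0 ?expR_ge0// !mulr_ge0 ?expR_ge0 ?invr_ge0// ltW.
    apply: le_trans (error_difference x) _.
    by rewrite /h /envelope mulrDr !mulrA.
apply: le_trans (sqr_integralD m1 m2) _.
rewrite !hI// -EFinD -EFinM lee_fin le_eqVlt; apply/orP; left; apply/eqP.
rewrite /error_constant; move: (expR 1) s0 => e s0'; field.
by rewrite gt_eqF.
Qed.

End error.
End profile_in_H2.

(** * The correction and its norm *)

Section correction.
Context {R : realType}.
Local Notation mu := (@lebesgue_measure R).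
Local Notation k0 := (@k0 R).
Implicit Types (x : R) (f : R -> R).

Variables (u v1 v2 w1 w2 : R -> R).
Local Notation D := [set x : R | 1 < `|x|].
Hypotheses (uH : H2loc_with u v1 v2) (uodd : odd_fct u)
  (ww1 : weak_derivative D (fun x => u x - carrier x) w1)
  (ww2 : weak_derivative D w1 w2)
  (Lw0 : L2 D (fun x => (1 + x ^+ 2) * (u x - carrier x)))
  (Lw2 : L2 D (fun x => (1 + x ^+ 2) * w2 x)).

Local Notation a0 := (fun x => u x - carrier x).
Local Notation a2 := (oscillation_residual2 v2 w2).

Let La0 : L1L2 a0 := L1L2_oscillation_residual uH ww1 Lw0.
Let La2 : L1L2 a2 := L1L2_oscillation_residual2 uH ww1 Lw2.

Let carrier_le1' x : `|carrier x| <= (fun _ : R => 1) x := carrier_le1 x.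

Let carrier_loc : locally_integrable setT (@carrier R).
Proof.
apply: (dominated_locally_integrable measurable_carrier _ carrier_le1').
by move=> x; exact: cvg_cst.
Qed.

Let L1_loc f : L1L2 f -> locally_integrable setT f.
Proof.
move=> Lf; split; [exact: L1L2_measurable|exact: openT|move=> K _ cK].
have [fi _] := Lf; have : mu.-integrable K (EFin \o f).
  by apply: (integrableS _ _ _ fi) => //; exact: compact_measurable.
by case/integrableP.
Qed.

Lemma oscillation_weak_second_derivative :
  weak_second_derivative u (fun x => a2 x - k0 ^+ 2 * carrier x).
Proof.
move=> phi phi1 phi2 d1 d2 c2 M.
exact: (oscillation_second_derivative uH ww1 ww2 Lw2 d1 d2 c2 M).
Qed.

Let a2c_loc : locally_integrable setT (fun x => a2 x - k0 ^+ 2 * carrier x).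
Proof.
apply: locally_integrableB; first exact: L1_loc.
have ck : continuous (fun _ : R => k0 ^+ 2) by move=> x; exact: cvg_cst.
apply: (dominated_locally_integrable _ ck).
  by apply: measurable_funM => //; exact: measurable_carrier.
by move=> x; rewrite normrM (ger0_norm (sqr_ge0 _)) ler_piMr ?sqr_ge0 ?carrier_le1.
Qed.

Let finite_difference : (\int[mu]_x ((a0 x - a2 x) ^+ 2)%:E < +oo)%E.
Proof.
have [_] := L1L2D La0 (L1L2Z (-1) La2).
by under eq_integral do rewrite mulN1r.
Qed.

Section bounds.
Variables (M s : R) (G AC AS : R -> R) (lC lS : R).
Hypotheses (s01 : 0 < s <= 1) (cG : continuous G)
  (prim : primitives M s G AC AS lC lS).

Local Notation P := (profile AC AS lC).
Local Notation beta := (lS / k0).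

(** The function r of the theorem; the coefficient lS / k0 of u is its beta. *)
Definition correction x := lS / k0 * u x + odd_extension P x.

Definition correction2 x :=
  lS / k0 * (a2 x - k0 ^+ 2 * carrier x) + odd_extension (profile2 G AC AS lC) x.

Let correctionE x :
  correction x = beta * a0 x + profile_error AC AS lC lS x.
Proof. by rewrite profile_errorE /correction; ring. Qed.

Let correction2E x :
  correction2 x = beta * a2 x + profile_error2 G AC AS lC lS x.
Proof. by rewrite profile_error2E /correction2; ring. Qed.

Lemma L1L2_correction : L1L2 correction.
Proof.
rewrite (_ : correction = fun x => beta * a0 x + profile_error AC AS lC lS x).
  by apply: L1L2D; [exact: L1L2Z|exact: (L1L2_profile_error s01 prim)].
by apply/funext.
Qed.

Lemma L1L2_correction2 : L1L2 correction2.
Proof.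
rewrite (_ : correction2 = fun x => beta * a2 x + profile_error2 G AC AS lC lS x).
  by apply: L1L2D; [exact: L1L2Z|exact: (L1L2_profile_error2 s01 cG prim)].
by apply/funext.
Qed.

Lemma continuous_correction : continuous correction.
Proof.
move=> x; apply: cvgD.
  by apply: cvgMl_tmp; case: uH => cu _ _ _ _; exact: cu.
by case: (H2loc_profile cG prim) => cP _ _ _ _; exact: cP.
Qed.

Lemma odd_correction : odd_fct correction.
Proof. by move=> x; rewrite /correction uodd odd_extensionN; ring. Qed.

Lemma correction_weak_second_derivative : weak_second_derivative correction correction2.
Proof.
case: (H2loc_profile cG prim) => _ _ _ [pl _ _] [_ p2l _].
case: uH => _ _ _ [ul _ _] _.
apply: weak_second_derivativeD => //; first exact: oscillation_weak_second_derivative.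
exact: (profile_weak_second_derivative cG prim).
Qed.

(** Subtracting the carrier from u and adding it to the profile writes r and
its second derivative as sums of functions in L^1 and L^2. *)
Lemma sqr_integral_correction :
  (\int[mu]_x ((correction x - correction2 x) ^+ 2)%:E <=
   (M ^+ 2)%:E * (2%:E * (((20 + expR 1) ^+ 2)%:E * \int[mu]_x ((a0 x - a2 x) ^+ 2)%:E
     + error_constant%:E)))%E.
Proof.
pose d x := a0 x - a2 x.
pose e x := profile_error AC AS lC lS x - profile_error2 G AC AS lC lS x.
have md : measurable_fun setT d.
  by apply: measurable_funB; exact: L1L2_measurable.
have me : measurable_fun setT e.
  apply: measurable_funB; first exact: (measurable_profile_error prim).
  exact: (measurable_profile_error2 cG prim).
have bd : beta ^+ 2 <= M ^+ 2 * (20 + expR 1) ^+ 2.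
  rewrite -exprMn -[leLHS]real_normK ?num_real// ler_sqr ?nnegrE ?mulr_ge0 ?addr_ge0
    ?expR_ge0 ?(primitives_ge0 s01 prim) ?ler0n//.
  have k := @k0_ge R.
  rewrite normrM normfV (gtr0_norm k0_gt0) ler_pdivrMr ?k0_gt0//.
  apply: le_trans (sin_limit_bound s01 prim) _.
  rewrite -mulrA ler_wpM2l ?(primitives_ge0 s01 prim)//.
  apply: le_trans (tail0_le s01) _; have e0 := expR_ge0 (1 : R).
  by rewrite ler_peMr ?addr_ge0 ?ler0n//; lra.
have -> : (\int[mu]_x ((correction x - correction2 x) ^+ 2)%:E =
    \int[mu]_x ((beta * d x + e x) ^+ 2)%:E)%E.
  apply: eq_integral => x _; rewrite correctionE correction2E /d /e.
  by congr (_ ^+ 2)%:E; ring.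
have mbd : measurable_fun setT (fun x => beta * d x) by exact: measurable_funM.
apply: le_trans (sqr_integralD mbd me) _.
have -> : (\int[mu]_x ((beta * d x) ^+ 2)%:E = (beta ^+ 2)%:E * \int[mu]_x (d x ^+ 2)%:E)%E.
  rewrite -ge0_integralZl//.
  - by apply: eq_integral => x _; rewrite -EFinM exprMn.
  - by apply/measurable_EFinP; exact: measurable_funX.
  - by move=> x _; rewrite lee_fin sqr_ge0.
  - by rewrite lee_fin sqr_ge0.
have h := sqr_integral_profile_error s01 cG prim.
rewrite muleCA; apply: lee_wpmul2l => //.
have d0 : (0 <= \int[mu]_x (d x ^+ 2)%:E)%E.
  by apply: integral_ge0 => x _; rewrite lee_fin sqr_ge0.
have g1 : (0 <= ((20 + expR 1) ^+ 2)%:E * \int[mu]_x (d x ^+ 2)%:E)%E.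
  by apply: mule_ge0 => //; rewrite lee_fin sqr_ge0.
have g2 : (0 <= (error_constant : R)%:E)%E by rewrite lee_fin error_constant_ge0.
rewrite [leRHS](ge0_muleDr _ g1 g2).
apply: leeD; last by rewrite -EFinM.
by rewrite muleA; apply: lee_wpmul2r => //; rewrite -EFinM lee_fin.
Qed.

Lemma H2_correction :
  measurable_fun setT (H2_weighted_fourier correction) /\
  (\int[mu]_k (H2_weighted_fourier correction k ^+ 2)%:E <=
   32%:E * \int[mu]_x ((correction x - correction2 x) ^+ 2)%:E)%E.
Proof.
apply: H2norm_second_derivative.
- by case: L1L2_correction.
- by case: L1L2_correction2.
- exact: continuous_correction.
- exact: odd_correction.
- exact: correction_weak_second_derivative.
Qed.

Lemma H2odd_correction : H2odd correction.
Proof.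
have [mF IF] := H2_correction.
have Lr := L1L2_correction.
split; last exact: odd_correction.
split; first exact: continuous_correction.
  by apply/L2T; split; [exact: L1L2_measurable|case: Lr].
apply/L2T; split => //; apply: le_lt_trans IF _.
apply: lte_mul_pinfty => //.
have [_] := L1L2D L1L2_correction (L1L2Z (-1) L1L2_correction2).
by under eq_integral do rewrite mulN1r.
Qed.

End bounds.

(** Q depends on u only, while M is proportional to s: this is the smallness of
the correction. *)
Lemma correction_H2norm_bound : exists2 Q, 0 <= Q &
  forall M s G AC AS lC lS, 0 < s <= 1 -> continuous G ->
    primitives M s G AC AS lC lS ->
    (\int[mu]_k (H2_weighted_fourier (correction AC AS lC lS) k ^+ 2)%:E <= (M ^+ 2 * Q)%:E)%E.
Proof.
pose N := fine (\int[mu]_x ((a0 x - a2 x) ^+ 2)%:E).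
have NE : (\int[mu]_x ((a0 x - a2 x) ^+ 2)%:E = N%:E)%E.
  rewrite fineK// ge0_fin_numE//.
  by apply: integral_ge0 => x _; rewrite lee_fin sqr_ge0.
have N0 : 0 <= N.
  by apply: fine_ge0; apply: integral_ge0 => x _; rewrite lee_fin sqr_ge0.
exists (32 * (2 * ((20 + expR 1) ^+ 2 * N + error_constant))).
  apply: mulr_ge0 (ler0n _ 32) (mulr_ge0 (ler0n _ 2) (addr_ge0 _ error_constant_ge0)).
  exact: mulr_ge0 (sqr_ge0 _) N0.
move=> M s G AC AS lC lS s01 cG prim.
have [_] := H2_correction s01 cG prim; move=> h; apply: (le_trans h).
have := sqr_integral_correction s01 cG prim; rewrite NE => h2.
rewrite mulrCA EFinM; apply: lee_wpmul2l => //.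
Qed.

End correction.

(** * The perturbed travelling wave *)

Section perturbed_wave.
Context {R : realType}.
Local Notation mu := (@lebesgue_measure R).
Local Notation k0 := (@k0 R).
Implicit Types (x : R).

(** All terms are odd, so the equation needs to be checked on the half line
only. There the shifts of the sine cancel, the terms in P cancel because alpha
+ 2 = c^2 k0^2, and what remains is the equation for G. *)
Lemma perturbed_solution (c gamma M s : R) (Psi u_p G AC AS : R -> R) (lC lS : R) :
  odd_fct u_p -> solution c Num.sg u_p -> (forall x, Num.sg (u_p x) = Num.sg x) ->
  odd_fct Psi -> continuous G -> primitives M s G AC AS lC lS ->
  (forall x, 0 <= x -> let P := profile AC AS lC in
    c ^+ 2 * G x = alpha c * (1 - Psi (u_p x + gamma * sin (k0 * x) - P x)) + shift_sum P x) ->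
  solution c Psi
    (fun x => u_p x + (gamma * sin (k0 * x) - odd_extension (profile AC AS lC) x)).
Proof.
move=> uodd [u1 [u2 [uH uE]]] usg Podd cG prim fixG.
set P := profile AC AS lC in fixG *.
pose Q x := gamma * sin (k0 * x) - P x.
pose Q1 x := gamma * (k0 * cos (k0 * x)) - profile1 AC AS lC x.
pose Q2 x := gamma * (- k0 ^+ 2 * sin (k0 * x)) - (G x - k0 ^+ 2 * P x).
have dsin x : is_derive x 1 (fun x => gamma * sin (k0 * x)) (gamma * (k0 * cos (k0 * x))).
  by derive; ring.
have dcos x : is_derive x 1 (fun x => gamma * (k0 * cos (k0 * x)))
    (gamma * (- k0 ^+ 2 * sin (k0 * x))).
  by derive; ring.
have dQ x (x0 : 0 <= x) : is_derive x 1 Q (Q1 x).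
  exact: (is_derive_add (dsin x) (is_derive_opp (is_derive_profile prim x0))).
have dQ1 x (x0 : 0 <= x) : is_derive x 1 Q1 (Q2 x).
  exact: (is_derive_add (dcos x) (is_derive_opp (is_derive_profile1 prim x0))).
have cQ2 x (x0 : 0 <= x) : {for x, continuous Q2}.
  apply: cvgB.
    by apply: cvgMl_tmp; apply: cvgMl_tmp; exact: continuous_sin_scaled.
  apply: cvgB; first exact: cG.
  by apply: cvgMl_tmp; exact: is_derive_cvg (is_derive_profile prim x0).
have Q0 : Q 0 = 0 by rewrite /Q mulr0 sin0 mulr0 /P (profile0 prim) subr0.
have QE x : odd_extension Q x = gamma * sin (k0 * x) - odd_extension P x.
  rewrite /odd_extension /Q mulrBr mulrCA; congr (_ * _ - _).
  case: (ltrgt0P x) => [x0|x0|->].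
  - by rewrite gtr0_sg// mul1r.
  - by rewrite ltr0_sg// mulN1r mulrN sinN opprK.
  - by rewrite sgr0 mul0r mulr0 sin0.
have -> : (fun x => u_p x + (gamma * sin (k0 * x) - odd_extension P x)) =
    (fun x => u_p x + odd_extension Q x) by apply/funext => x; rewrite QE.
exists (fun x => u1 x + Q1 `|x|), (fun x => u2 x + odd_extension Q2 x); split.
  exact: (H2loc_withD uH (@H2loc_odd_extension _ Q Q1 Q2 Q0 dQ dQ1 cQ2)).
(* The defect that the equation for u_p leaves; it is odd and vanishes for x > 0. *)
pose E x := c ^+ 2 * odd_extension Q2 x - lapD (odd_extension Q) x
  + alpha c * odd_extension Q x - alpha c * (Psi (u_p x + odd_extension Q x) - Num.sg x).
have Eodd x : E (- x) = - E x.
  rewrite /E /lapD uodd !odd_extensionN.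
  have -> : - x + 1 = - (x - 1) by ring.
  have -> : - x - 1 = - (x + 1) by ring.
  rewrite !odd_extensionN -(opprD (u_p x)) Podd sgrN.
  by ring.
have Epos x : 0 < x -> E x = 0.
  move=> x0; have := fixG x (ltW x0) => /=.
  rewrite /E /lapD !QE sin_k0D1 sin_k0B1 !(odd_extensionE _ x0) gtr0_sg//.
  rewrite /shift_sum /Q2 /alpha -/k0.
  rewrite (addrA (u_p x)) => h; move: (Psi _) h => q h.
  by rewrite -[RHS](subrr (c ^+ 2 * G x)) [X in _ = X - _]h; ring.
have E0 x : E x = 0.
  case: (ltrgt0P x) => [|x0|->]; first exact: Epos.
    by rewrite -[x]opprK Eodd Epos ?oppr0// oppr_gt0.
  by have := Eodd 0; rewrite oppr0; lra.
apply: (@filterS _ _ (ae_filter_ringOfSetsType mu)) uE => x ux.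
have := E0 x; rewrite /E; move: ux; rewrite usg /lapD => e1 e2.
by rewrite -[RHS]addr0 -[X in _ = X + _]e1 -[X in _ = _ + X]e2; ring.
Qed.

Lemma alpha_bound (c : R) : 99 / 100 <= c <= 1 -> 49 / 50 <= c ^+ 2 /\ `|alpha c| <= 2.
Proof.
move=> /andP[c0 c1]; have k1 := @k0_ge R; have k2 := @k0_lt2 R.
have h1 : 49 / 50 <= c ^+ 2.
  by apply: (@le_trans _ _ ((99 / 100) ^+ 2)); [lra|rewrite ler_sqr ?nnegrE; lra].
have h2 : c ^+ 2 <= 1 by rewrite expr_le1//; lra.
split => //; rewrite /alpha -/k0.
have h3 : k0 ^+ 2 <= 4 by rewrite (_ : 4 = 2 ^+ 2)%R ?ler_sqr ?nnegrE; lra.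
have h4 := sqr_ge0 (k0); have h5 := sqr_ge0 c.
have h6 : c ^+ 2 * k0 ^+ 2 <= 1 * 4 by apply: ler_pM.
have h7 : 0 <= c ^+ 2 * k0 ^+ 2 by apply: mulr_ge0.
by rewrite ler_norml; apply/andP; split; lra.
Qed.

End perturbed_wave.

(** For c >= 99/100 one has c^2 >= 49/50, which exceeds the mass of the kernel,
and |alpha| <= 2. *)
Theorem theorem3p1 (R : realType) :
  exists c0 : R, [/\ 0 < c0, c0 < 1, 83 / 100 <= c0 ^+ 2 &
  forall c : R, c0 <= c <= 1 ->
  forall psi : R -> R -> R, regularisation psi ->
  forall u_p : R -> R, kreiner_zimmer c u_p ->
  forall u_o : R -> R, odd_oscillation u_o ->
  exists gamma0 rho0 : R, [/\ 0 < gamma0, 0 < rho0 &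
  forall gamma rho : R, `|gamma| < gamma0 -> 0 < rho < rho0 ->
  exists2 eps0 : R, 0 < eps0 &
  forall eps : R, 0 < eps < eps0 ->
  exists (r : R -> R) (beta : R),
    [/\ H2odd r, (H2norm r < rho%:E)%E &
        solution c (psi eps)^`()
          (fun x => u_p x + beta * u_o x + gamma * sin (k0 * x) - r x)]]].
Proof.
exists (99 / 100); split; [lra|lra|lra|].
move=> c cI psi reg u_p [uodd usol _ [usg du linf] _] u_o [[v1 [v2 vH]] vodd [w1 [w2 [ww1 ww2 Lw0 _ Lw2]]]].
have [csq abound] := alpha_bound cI.
have cu : continuous u_p by case: usol => [u1 [u2 [[]]]].
have u0 : u_p 0 = 0 by have := uodd 0; rewrite oppr0; lra.
have up x : 0 < x -> 0 < u_p x by move=> x0; rewrite -sgr_gt0 usg sgr_gt0.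
have [sl [m [sl0 m0 um]]] := linear_lower_bound cu u0 up du linf.
exists (Num.min sl m), 1; split; [by rewrite lt_min sl0|by []|].
move=> gamma rho gm /andP[rho0 _].
have [s0 s00 fixpt] := regularised_profile_exists sl0 m0.
have [Q Q0 Qbound] := correction_H2norm_bound vH vodd ww1 ww2 Lw0 Lw2.
have [K K0 KE] : exists2 K : R, 0 <= K & forall s, (250 * s) ^+ 2 * Q = s ^+ 2 * K.
  exists (250 ^+ 2 * Q); first exact: mulr_ge0 (sqr_ge0 _) Q0.
  by move=> s; rewrite exprMn -mulrA mulrCA.
have K1 : 0 < K + 1 by rewrite ltr_wpDl.
(* With s^2 = eps / sl, this makes both s <= s0 and (K + 1) s^2 < rho^2. *)
exists (sl * Num.min (s0 ^+ 2) (rho ^+ 2 / (K + 1))).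
  by rewrite mulr_gt0// lt_min divr_gt0 ?exprn_gt0.
move=> eps /andP[e0 eeps].
pose s := Num.sqrt (eps / sl).
have sE : s ^+ 2 = eps / sl by rewrite sqr_sqrtr// divr_ge0 ?ltW.
have epsE : sl * s ^+ 2 = eps by rewrite sE mulrC divfK// gt_eqF.
have sp : 0 < s by rewrite sqrtr_gt0 divr_gt0.
have : s ^+ 2 < Num.min (s0 ^+ 2) (rho ^+ 2 / (K + 1)).
  by rewrite -(ltr_pM2l sl0) epsE.
rewrite lt_min => /andP[ss0 srho].
have {}ss0 : 0 < s <= s0.
  by rewrite sp/= ltW// -(ltr_pXn2r (ltn0Sn 1)) ?nnegrE ?ltW.
have [s1 exG] := fixpt s ss0.
have [Podd P1 Plip P3] := regularised_sign reg e0.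
have cU : continuous (fun x => u_p x + gamma * sin (k0 * x)).
  move=> x; apply: cvgD; first exact: cu.
  by apply: cvgMl_tmp; exact: continuous_sin_scaled.
have Ub := perturbed_lower_bound sl0 m0 um gm.
have [||G [AC [AS [lC [lS [cG prim fixG]]]]]] :=
  exG (alpha c) (c ^+ 2) (psi eps)^`()%classic _ csq abound cU Ub _ _ P3.
- by rewrite epsE.
- by rewrite epsE.
have s01 : 0 < s <= 1 by rewrite sp.
exists (correction u_o AC AS lC lS), (lS / k0); split.
- exact: (H2odd_correction vH vodd ww1 ww2 Lw0 Lw2 s01 cG prim).
- apply: Lnorm2_lt => //; apply: le_lt_trans (Qbound _ _ _ _ _ _ _ s01 cG prim) _.
  rewrite lte_fin; move: srho; rewrite ltr_pdivlMr//.
  apply: le_lt_trans.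
  by rewrite KE ler_wpM2l ?sqr_ge0// lerDl.
- have := perturbed_solution uodd usol usg Podd cG prim fixG.
  congr (solution _ _ _); apply/funext => x; rewrite /correction.
  by ring.
Qed.
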